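(* Let $n,k\ge1$, $m\ge0$, and let $\Omega\subseteq\mathbb C^{n+m}$ be a domain which is $n$-star-shaped Hartogs in the first $n$ variables $z=(z_1,\dots,z_n)$; write points as $(z,z')$, $z'\in\mathbb C^m$. Let $\gamma_j>0$ ($1\le j\le n$) and $$V^\gamma=\{(z,z',w)\in\mathbb C^{n+m}\times\mathbb C^k:(g_\gamma(z,w),z')\in\Omega\},\qquad g_\gamma(z,w)=\big(e^{\gamma_1\|w\|^2/2}z_1,\dots,e^{\gamma_n\|w\|^2/2}z_n\big).$$ For $\eta\in\mathbb C^k$ let $V^\gamma_\eta=\{(z,z'):(z,z',\eta)\in V^\gamma\}$ with Bergman kernel $K_{V^\gamma_\eta}$. Define $$l(z,w,\eta)=\big(z_1e^{\gamma_1(\langle w,\eta\rangle-\|\eta\|^2)},\dots,z_ne^{\gamma_n(\langle w,\eta\rangle-\|\eta\|^2)}\big),\qquad D_{V^\gamma}=\frac{e^{(\gamma\cdot\mathbf 1)(\langle w,\eta\rangle-\|\eta\|^2)}}{\pi^k}\Big(\sum_{j=1}^n\gamma_j\Big(I+z_j\frac{\partial}{\partial z_j}\Big)\Big)^k.$$ Then for all $(z,z',w;\zeta,\zeta',\eta)\in V^\gamma\times V^\gamma$, $$K_{V^\gamma}(z,z',w;\bar\zeta,\bar\zeta',\bar\eta)=D_{V^\gamma}\Big[K_{V^\gamma_\eta}\big(l(z,w,\eta),z';\bar\zeta,\bar\zeta'\big)\Big].$$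
   Context: A domain $\Omega\subseteq\mathbb C^{n+m}$ is $n$-star-shaped Hartogs in $(z_1,\dots,z_n)$ if $(z_1,\dots,z_n,\zeta)\in\Omega$ implies $(\lambda_1z_1,\dots,\lambda_nz_n,\zeta)\in\Omega$ for all $|\lambda_j|\le1$. $\langle w,\eta\rangle=\sum_{i=1}^k w_i\bar\eta_i$, $\gamma\cdot\mathbf 1=\sum_j\gamma_j$, $I$ is the identity operator. The Bergman kernel is the reproducing kernel of the space of square-integrable holomorphic functions. The operator acts on the function $(z,z',w)\mapsto K_{V^\gamma_\eta}(l(z,w,\eta),z';\bar\zeta,\bar\zeta')$, with $\partial/\partial z_j$ differentiating in $z_j$. *)

(* Defs.v *)
From HB Require Import structures.
From mathcomp Require Import all_boot all_order all_algebra.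
From mathcomp Require Import all_classical all_reals all_analysis.
From mathcomp Require Import complex.
Import Order.TTheory GRing.Theory Num.Theory ComplexField.
Import numFieldNormedType.Exports.

Set Implicit Arguments.
Unset Strict Implicit.
Unset Printing Implicit Defensive.

Local Open Scope ring_scope.
Local Open Scope complex_scope.
Local Open Scope classical_set_scope.

(* Points of C^N are row vectors 'rV[R[i]]_N; complex-valued functions take
   values in R[i]^o (R[i] seen as a normed module over itself). *)

Section Defs.
Variable R : realType.
Local Notation C := (R[i]^o).

Definition cexp (z : C) : C :=
  (expR (complex.Re z))%:C * (cos (complex.Im z) +i* sin (complex.Im z)).

Definition csq (z : C) : R := complex.Re z ^+ 2 + complex.Im z ^+ 2.

Definition sqnorm (N : nat) (w : 'rV[C]_N) : R := \sum_(i < N) csq (w 0 i).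

Definition cdot (N : nat) (w eta : 'rV[C]_N) : C :=
  \sum_(i < N) w 0 i * conjc (eta 0 i).

(* iterated Lebesgue integral over R^d (coordinates 0..d-1 of s) *)
Fixpoint rint (d : nat) (G : (nat -> R) -> \bar R) : \bar R :=
  match d with
  | 0 => G (fun _ => 0)
  | d'.+1 => (\int[@lebesgue_measure R]_x
                rint d' (fun s => G (fun i => if i == d' then x else s i)))%E
  end.

Definition toC (N : nat) (s : nat -> R) : 'rV[C]_N :=
  \row_(j < N) (s (2 * j)%N +i* s (2 * j + 1)%N).

Definition cint (N : nat) (F : 'rV[C]_N -> \bar R) : \bar R :=
  rint (2 * N) (fun s => F (toC N s)).

Definition cintC (N : nat) (H : 'rV[C]_N -> C) : C :=
  fine (cint (fun x => (complex.Re (H x))%:E))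
  +i* fine (cint (fun x => (complex.Im (H x))%:E)).

Definition holomorphic_on (N : nat) (D : set 'rV[C]_N) (f : 'rV[C]_N -> C) :=
  (forall x, D x -> {for x, continuous f}) /\
  (forall x, D x -> forall j : 'I_N, derivable f x (delta_mx 0 j)).

Definition bergman_space (N : nat) (D : set 'rV[C]_N) (f : 'rV[C]_N -> C) :=
  holomorphic_on D f /\
  (cint (fun x => ((\1_D x : R) * csq (f x))%:E) < +oo)%E.

(* K is the Bergman kernel of D: K(., y) in A^2(D) for y in D, and
   f(y) = \int_D f(x) conj(K(x,y)) dV(x) for all f in A^2(D), y in D.
   (K(x, y) is what the paper writes K(x; \bar y).) *)
Definition is_bergman_kernel (N : nat) (D : set 'rV[C]_N)
    (K : 'rV[C]_N -> 'rV[C]_N -> C) :=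
  (forall y, D y -> bergman_space D (fun x => K x y)) /\
  (forall f, bergman_space D f -> forall y, D y ->
     f y = cintC (fun x => (\1_D x : R)%:C * f x * conjc (K x y))).

Definition is_domain (N : nat) (D : set 'rV[C]_N) := open D /\ connected D.

Definition star_hartogs (n m : nat) (Om : set 'rV[C]_(n + m)) :=
  forall (z : 'rV[C]_n) (z' : 'rV[C]_m), Om (row_mx z z') ->
  forall lam : 'rV[C]_n, (forall j, csq (lam 0 j) <= 1) ->
  Om (row_mx (\row_j (lam 0 j * z 0 j)) z').

Definition g_gamma (n k : nat) (gam : 'I_n -> R) (z : 'rV[C]_n) (w : 'rV[C]_k)
  : 'rV[C]_n := \row_j ((expR (gam j * sqnorm w / 2))%:C * z 0 j).

(* V^gamma, points written row_mx (row_mx z z') w *)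
Definition Vgam (n m k : nat) (gam : 'I_n -> R) (Om : set 'rV[C]_(n + m))
  : set 'rV[C]_(n + m + k) :=
  [set p | Om (row_mx (g_gamma gam (lsubmx (lsubmx p)) (rsubmx p))
                       (rsubmx (lsubmx p)))].

Definition Vslice (n m k : nat) (gam : 'I_n -> R) (Om : set 'rV[C]_(n + m))
  (eta : 'rV[C]_k) : set 'rV[C]_(n + m) :=
  [set q | Vgam (k:=k) gam Om (row_mx q eta)].

Definition lmap (n k : nat) (gam : 'I_n -> R) (z : 'rV[C]_n)
  (w eta : 'rV[C]_k) : 'rV[C]_n :=
  \row_j (cexp ((gam j)%:C * (cdot w eta - (sqnorm eta)%:C)) * z 0 j).

Definition Lop (n : nat) (gam : 'I_n -> R) (G : 'rV[C]_n -> C)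
  : 'rV[C]_n -> C :=
  fun z => \sum_(j < n) (gam j)%:C * (G z + z 0 j * 'D_(delta_mx 0 j) G z).

End Defs.

(* Main.v *)
(* The map (u, z', v) |-> (e^{-gamma <v, eta>} u, z', eta + v) carries the domain
   built over the slice V_eta onto V^gamma and its fibre over v = 0 onto the fibre
   over eta, so by the transformation rule for Bergman kernels it suffices to treat
   eta = 0.  Write delta_w for the dilation z_j |-> e^{-gamma_j |w|^2 / 2} z_j and c
   for the sum of the gamma_j.  Rotation invariance of the kernels, extended to the
   disc by holomorphy, moves dilations from one argument to the other; in particular
   Q(x) := K_V((x, w), (y, 0)) does not depend on w.  Reproducing K_Omega(., p),
   viewed as a function on V, and integrating over the fibres yields
     K_Omega(p, y) = int_{C^k} e^{-c |w|^2} Q(delta_w^2 p) dw.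
   Along the path p = (e^{-gamma t} z, z'), the right-hand side times e^{-ct} is, in
   polar coordinates, pi^k times the k-fold iterated tail integral of
   rho(t) = e^{-ct} Q(e^{-gamma t} z, z'), while d/dt acts on the left-hand side as
   -sum_j gamma_j (I + z_j d/dz_j).  Differentiating k times gives
   (sum_j gamma_j (I + z_j d/dz_j))^k K_Omega = pi^k Q. *)
Require Import Defs.
From HB Require Import structures.
From mathcomp Require Import all_boot all_order all_algebra.
From mathcomp Require Import all_classical all_reals all_analysis.
From mathcomp Require Import complex measurable_realfun.
From mathcomp Require Import ring lra.
Import Order.TTheory GRing.Theory Num.Theory ComplexField.
Import numFieldNormedType.Exports.
Local Open Scope ring_scope.
Local Open Scope complex_scope.
Local Open Scope classical_set_scope.
Set Implicit Arguments.
Unset Strict Implicit.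
Unset Printing Implicit Defensive.

Import Normc.

(** Two definitions shape the proof. [holomorphic_on] asks only for continuity and one complex
    derivative per coordinate, so Fréchet differentiability and holomorphy of the partial
    derivatives are derived, starting from Goursat. [cint] is an iterated integral in a fixed order
    of real coordinates, with [w] outermost, so integrating over the fibres of [V] is immediate,
    while exceptional sets of [w] have to be expressed through finiteness of an iterated integral:
    [K_V(., (y, 0))] is square integrable only on almost every fibre. No derivative is ever taken
    under the integral over [C^k]. Each complex coordinate of [w] contributes one factor [pi] and
    one tail integral, which is where the exponent [k] comes from, and a tail integral is
    differentiated by the fundamental theorem of calculus. All this needs of [Q] is continuity and
    boundedness along a dilation path, and boundedness holds because the path converges to
    [(0, z')], a point of [Omega] by star-shapedness. *)

Section ComplexNorm.
Variable R : realType.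
Implicit Types (x y z : R[i]) (a b : R).

Lemma normcE_norm z : `|z| = (normc z)%:C. Proof. by []. Qed.

Lemma normc_ge0 z : 0 <= normc z.
Proof. by case: z => a b; exact: sqrtr_ge0. Qed.

Lemma normcD_le x y : normc (x + y) <= normc x + normc y.
Proof. exact: le_normcD. Qed.

Lemma normc_opp z : normc (- z) = normc z.
Proof. exact: normcN. Qed.

Lemma normc_subC x y : normc (x - y) = normc (y - x).
Proof. by rewrite -normc_opp opprB. Qed.

Lemma normcB_le x y : normc (x - y) <= normc x + normc y.
Proof. by rewrite -(normc_opp y) normcD_le. Qed.

Lemma normc_tri z x y : normc (x - y) <= normc (x - z) + normc (z - y).
Proof. by rewrite -(subrKA z) normcD_le. Qed.

Lemma normc_real a : normc a%:C = `|a|.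
Proof. by rewrite /= expr0n /= addr0 sqrtr_sqr. Qed.

Lemma normc_eq0 z : (normc z == 0) = (z == 0).
Proof. by apply/eqP/eqP => [/eq0_normc|->]; rewrite ?normc0. Qed.

Lemma normc_gt0 z : (0 < normc z) = (z != 0).
Proof. by rewrite lt_neqAle normc_ge0 andbT eq_sym normc_eq0. Qed.

Lemma Re_le_normc z : `|complex.Re z| <= normc z.
Proof. by case: z => a b /=; rewrite -sqrtr_sqr ler_wsqrtr// lerDl sqr_ge0. Qed.

Lemma Im_le_normc z : `|complex.Im z| <= normc z.
Proof. by case: z => a b /=; rewrite -sqrtr_sqr ler_wsqrtr// lerDr sqr_ge0. Qed.

Lemma normc_le_ReIm z : normc z <= `|complex.Re z| + `|complex.Im z|.
Proof.
rewrite [z in normc z]complexE; apply: (le_trans (normcD_le _ _)).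
by rewrite normcM !normc_real /= expr0n /= expr1n add0r sqrtr1 mul1r.
Qed.

Lemma csq_normc z : csq z = normc z ^+ 2.
Proof. by case: z => a b; rewrite /csq /= sqr_sqrtr// addr_ge0 ?sqr_ge0. Qed.

Lemma csq_ge0 z : 0 <= csq z.
Proof. by rewrite csq_normc sqr_ge0. Qed.

Lemma csqM x y : csq (x * y) = csq x * csq y.
Proof. by rewrite !csq_normc normcM exprMn. Qed.

Lemma normc_conj z : normc (conjc z) = normc z.
Proof. by case: z => a b /=; rewrite sqrrN. Qed.

Lemma csq_le1 z : (csq z <= 1) = (normc z <= 1).
Proof. by rewrite csq_normc expr_le1// normc_ge0. Qed.

Lemma mul_conjc z : z * conjc z = (csq z)%:C.
Proof. by rewrite -sqr_normc normcE_norm -rmorphXn csq_normc. Qed.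

Lemma ReD x y : complex.Re (x + y) = complex.Re x + complex.Re y.
Proof. by case: x y => ? ? []. Qed.
Lemma ImD x y : complex.Im (x + y) = complex.Im x + complex.Im y.
Proof. by case: x y => ? ? []. Qed.
Lemma ReN x : complex.Re (- x) = - complex.Re x. Proof. by case: x. Qed.
Lemma ImN x : complex.Im (- x) = - complex.Im x. Proof. by case: x. Qed.
Lemma ReB x y : complex.Re (x - y) = complex.Re x - complex.Re y.
Proof. by rewrite ReD ReN. Qed.
Lemma ImB x y : complex.Im (x - y) = complex.Im x - complex.Im y.
Proof. by rewrite ImD ImN. Qed.
Lemma ReM x y : complex.Re (x * y) =
  complex.Re x * complex.Re y - complex.Im x * complex.Im y.
Proof. by case: x y => ? ? []. Qed.
Lemma ImM x y : complex.Im (x * y) =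
  complex.Re x * complex.Im y + complex.Im x * complex.Re y.
Proof. by case: x y => ? ? []. Qed.
Lemma ReMr a y : complex.Re (a%:C * y) = a * complex.Re y.
Proof. by rewrite ReM /= mul0r subr0. Qed.
Lemma ImMr a y : complex.Im (a%:C * y) = a * complex.Im y.
Proof. by rewrite ImM /= mul0r addr0. Qed.
Lemma Re_conj x : complex.Re (conjc x) = complex.Re x. Proof. by case: x. Qed.
Lemma Im_conj x : complex.Im (conjc x) = - complex.Im x. Proof. by case: x. Qed.

Lemma complexP x y : complex.Re x = complex.Re y ->
  complex.Im x = complex.Im y -> x = y.
Proof. by case: x y => ? ? [? ?] /= -> ->. Qed.

(** Comparable complex numbers have equal imaginary parts. The radii of balls in [R[i]^o] are
    elements of [R[i]]; this makes them real. *)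
Lemma ltc0_real (e : R[i]) : 0 < e -> exists2 a : R, 0 < a & e = a%:C.
Proof.
by case: e => a b; rewrite ltcE /= => /andP[/eqP -> a0]; exists a.
Qed.

End ComplexNorm.

(** * Epsilon-delta forms of neighbourhoods, limits and derivatives *)

Section Bridges.
Variable R : realType.
Local Notation C := (R[i]^o).

Lemma nbhs_complexP (z : C) (U : set C) :
  nbhs z U <-> exists2 e : R, 0 < e & forall y : C, normc (y - z) < e -> U y.
Proof.
split.
  move=> /nbhs_ballP[e /= e0 eU]; have [a a0 ea] := ltc0_real e0.
  exists a => // y ya; apply: eU.
  by rewrite -ball_normE /ball_ /= ea normcE_norm ltcR normc_subC.
move=> [e e0 eU]; apply/nbhs_ballP; exists e%:C; rewrite /= ?ltcR//.
by move=> y /=; rewrite -ball_normE /ball_ /= normcE_norm ltcR normc_subC; exact: eU.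
Qed.

Lemma nbhs_rVP N (x : 'rV[C]_N) (U : set 'rV[C]_N) :
  nbhs x U <-> exists2 e : R, 0 < e &
    forall y : 'rV[C]_N, (forall j, normc (y 0 j - x 0 j) < e) -> U y.
Proof.
split.
  move=> /nbhs_ballP[e /= e0 eU]; have [a a0 ea] := ltc0_real e0.
  exists a => // y ya; apply: eU; split => // i j.
  by rewrite -ball_normE /ball_ /= ea normcE_norm ltcR normc_subC ord1.
move=> [e e0 eU]; apply/nbhs_ballP; exists e%:C; rewrite /= ?ltcR//.
move=> y [_ /= yb]; apply: eU => j; have := yb 0 j.
by rewrite -ball_normE /ball_ /= normcE_norm ltcR normc_subC.
Qed.

Lemma cvg_complexP T (F : set_system T) {FF : Filter F} (f : T -> C) (l : C) :
  f @ F --> l <->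
  (forall e : R, 0 < e -> \forall t \near F, normc (f t - l) < e).
Proof.
split.
  move=> fl e e0; apply: (fl [set y : C | normc (y - l) < e]).
  by apply/nbhs_complexP; exists e.
move=> H U /nbhs_complexP[e e0 eU]; apply: filterS (H e e0).
by move=> t; exact: eU.
Qed.

Lemma continuous_rVP N (f : 'rV[C]_N -> C) (x : 'rV[C]_N) :
  {for x, continuous f} <-> (forall e : R, 0 < e -> exists2 d : R, 0 < d &
    forall y : 'rV[C]_N, (forall j, normc (y 0 j - x 0 j) < d) -> normc (f y - f x) < e).
Proof.
have P := @cvg_complexP _ (nbhs x) _ f (f x).
rewrite /prop_for /continuous_at; split.
  by move=> /P H e e0; have /nbhs_rVP := H e e0.
by move=> H; apply/P => e e0; apply/nbhs_rVP; exact: H.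
Qed.

(* Complex differentiability with derivative [l], in the epsilon-delta form from
   which derivatives along real lines can be read off. *)
Definition cdiff (f : R[i] -> R[i]) (z l : R[i]) :=
  forall e : R, 0 < e -> exists2 d : R, 0 < d &
    forall h : R[i], normc h < d ->
      normc (f (z + h) - f z - h * l) <= e * normc h.

Lemma cdiff_derivP (V : normedModType C) (f : V -> C) (x v : V) (l : C) :
  cdiff (fun t : R[i] => f (x + t *: v)) 0 l <->
  (fun h : C => h^-1 *: ((f \o shift x) (h *: v) - f x)) @ 0^' --> l.
Proof.
pose q := fun h : C => h^-1 *: ((f \o shift x) (h *: v) - f x).
have P := @cvg_complexP _ (dnbhs (0 : C)) _ q l.
split.
- move=> H; apply/P => e e0; have e20 : 0 < e / 2 by lra.
  have [d d0 dH] := H _ e20.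
  apply/nbhs_complexP; exists d => // h; rewrite subr0 => hd h0.
  rewrite /q /= (addrC (h *: v)); have := dH h hd; rewrite add0r scale0r addr0 => le.
  have nh : 0 < normc h by rewrite normc_gt0.
  rewrite -[l](mulKf h0) -scalerBr -/(_ * _) /GRing.scale /= normcM normcV.
  rewrite mulrC ltr_pdivrMr//; apply: le_lt_trans le _.
  by rewrite ltr_pM2r//; lra.
- move=> /P H e e0; have /nbhs_complexP[d d0 dH] := H _ e0.
  exists d => // h hd; rewrite add0r scale0r addr0.
  have [->|h0] := eqVneq h 0.
    by rewrite scale0r addr0 mul0r subrr subrr normc0 mulr0.
  have := dH h; rewrite subr0 => /(_ hd h0).
  rewrite /q /= (addrC (h *: v)) -[l in normc (_ - l)](mulKf h0) -scalerBr.
  rewrite /GRing.scale /= normcM normcV mulrC => /ltW.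
  by rewrite ler_pdivrMr// normc_gt0.
Qed.

Lemma cdiff_derivable (V : normedModType C) (f : V -> C) (x v : V) (l : C) :
  cdiff (fun t : R[i] => f (x + t *: v)) 0 l -> derivable f x v /\ 'D_v f x = l.
Proof.
move=> /cdiff_derivP H; split; first by apply/cvg_ex; exists l.
by apply: cvg_lim H; exact: norm_hausdorff.
Qed.

Lemma derivable_cdiff (V : normedModType C) (f : V -> C) (x v : V) :
  derivable f x v -> cdiff (fun t : R[i] => f (x + t *: v)) 0 ('D_v f x).
Proof. by move=> H; apply/cdiff_derivP. Qed.

Lemma cdiff_is_derive (f : C -> C) (z l : C) : cdiff f z l <-> is_derive z 1 f l.
Proof.
have E : cdiff f z l <-> cdiff (fun t : R[i] => f (z + t *: (1 : C))) 0 l.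
  split=> H e e0; have [d d0 dH] := H e e0; exists d => // h hd.
    by rewrite add0r scale0r addr0 /GRing.scale /= mulr1; exact: dH.
  by have := dH h hd; rewrite add0r scale0r addr0 /GRing.scale /= mulr1.
split=> [/E/cdiff_derivable[] ? ?|[] dz dl]; first exact: DeriveDef.
by apply/E; rewrite -dl; exact: derivable_cdiff.
Qed.

Lemma real_is_derive (f : R -> R) (x l : R) :
  (forall e : R, 0 < e -> exists2 d : R, 0 < d &
    forall h : R, `|h| < d -> `|f (x + h) - f x - h * l| <= e * `|h|) ->
  is_derive x 1 f l.
Proof.
move=> H.
have L : (fun h : R => h^-1 *: ((f \o shift x) (h *: (1 : R)) - f x)) @ 0^' --> l.
  apply/cvgrPdist_lt => e e0; have e20 : 0 < e / 2 by lra.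
  have [d d0 dH] := H _ e20.
  apply/nbhs_ballP; exists d => // h; rewrite /ball /= sub0r normrN => hd h0.
  have nh : 0 < `|h| by rewrite normr_gt0.
  rewrite -[l](mulKf h0) -scalerBr /GRing.scale /= mulr1 normrM normfV.
  rewrite distrC (addrC h) mulrC ltr_pdivrMr//; apply: le_lt_trans (dH h hd) _.
  by rewrite ltr_pM2r//; lra.
apply: DeriveDef; first by apply/cvg_ex; exists l.
by apply: cvg_lim L; exact: norm_hausdorff.
Qed.

(** Gives real-variable tools (mean value theorem, differential equations) access to holomorphic
    functions. Multiplying [f] by a unit beforehand reaches the imaginary part as well. *)
Lemma cdiff_Re_line (f : R[i] -> R[i]) (a w l : R[i]) (t : R) :
  cdiff f (a + t%:C * w) l ->
  is_derive t 1 (fun s : R => complex.Re (f (a + s%:C * w))) (complex.Re (w * l)).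
Proof.
move=> H; apply: real_is_derive => e e0.
(* Adding 1 keeps the divisor positive when [w = 0]. *)
have w0 : 0 < normc w + 1 by rewrite ltr_wpDl// normc_ge0.
have [d d0 dH] := H _ (divr_gt0 e0 w0).
exists (d / (normc w + 1)); first by rewrite divr_gt0.
move=> h hd; rewrite rmorphD mulrDl addrA -ReB -ReMr -ReB mulrA.
apply: (le_trans (Re_le_normc _)); apply: (le_trans (dH _ _)).
  rewrite normcM normc_real; apply: le_lt_trans (_ : `|h| * (normc w + 1) < d).
    by rewrite ler_wpM2l// lerDl.
  by rewrite -ltr_pdivlMr.
rewrite normcM normc_real.
rewrite (_ : _ * _ = e * `|h| * (normc w / (normc w + 1))); last by ring.
by rewrite ler_piMr ?mulr_ge0 ?(ltW e0)// ler_pdivrMr// mul1r lerDl.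
Qed.

End Bridges.

(** * Goursat's theorem and the mean value property *)
Section IntervalIntegral.
Variable R : realType.
Local Notation mu := (@lebesgue_measure R).
Implicit Types (a b c k M : R) (f g : R -> R).

Definition cont_on (f : R -> R) a b :=
  forall x, a <= x <= b -> {for x, continuous f}.

Lemma cont_on_integrable f a b : cont_on f a b ->
  mu.-integrable `[a, b] (EFin \o f).
Proof.
move=> fc; apply: continuous_compact_integrable; first exact: segment_compact.
apply: continuous_in_subspaceT => x; rewrite inE /= in_itv /=; exact: fc.
Qed.

Lemma cont_onB f g a b : cont_on f a b -> cont_on g a b ->
  cont_on (fun x => f x - g x) a b.
Proof. by move=> fc gc x xab; apply: continuousB; [exact: fc|exact: gc]. Qed.

Lemma Rint_split f a c b : a <= c -> c <= b -> cont_on f a b ->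
  \int[mu]_(x in `[a, b]) f x =
  \int[mu]_(x in `[a, c]) f x + \int[mu]_(x in `[c, b]) f x.
Proof.
move=> ac cb fc; have := Rintegral_itvB (cont_on_integrable fc) (x := c).
rewrite !bnd_simp => /(_ ac cb); rewrite Rintegral_itv_obnd_cbnd; last first.
  apply: integrableS (cont_on_integrable fc) => //.
  by apply: subset_itv; rewrite !bnd_simp.
by move=> <-; rewrite addrC subrK.
Qed.

Lemma Rint_cst k a b : a <= b -> \int[mu]_(x in `[a, b]) k = k * (b - a).
Proof.
move=> ab; rewrite Rintegral_cst//= lebesgue_measure_itv /= lte_fin.
case: ltP => [_ //|ba]; have -> : a = b by apply/eqP; rewrite eq_le ab ba.
by rewrite subrr.
Qed.

Lemma Rint_bound f a b k M : a <= b -> cont_on f a b ->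
  (forall x, a <= x <= b -> `|f x - k| <= M) ->
  `|\int[mu]_(x in `[a, b]) f x - k * (b - a)| <= M * (b - a).
Proof.
move=> ab fc fM; have fi := cont_on_integrable fc.
have ci r : mu.-integrable `[a, b] (EFin \o (fun _ : R => r)).
  by apply: cont_on_integrable => x _; exact: cvg_cst.
rewrite -!(Rint_cst _ ab) -RintegralB//.
have gi : mu.-integrable `[a, b] (EFin \o (fun x => f x - k)).
  by apply: cont_on_integrable; apply: cont_onB => // x _; exact: cvg_cst.
apply: le_trans (le_normr_Rintegral _ gi) _ => //.
apply: le_Rintegral => //; last by have := integrable_norm gi.
Qed.

End IntervalIntegral.

Section Goursat.
Variable R : realType.
Local Notation mu := (@lebesgue_measure R).
Variables (u v : R -> R -> R) (a b c d : R).
Hypotheses (ab : a < b) (cd : c < d).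

(* Cauchy-Riemann in linear-approximation form for [u + iv]. *)
Hypothesis CR : forall x y, a <= x <= b -> c <= y <= d -> exists p q : R,
  forall e, 0 < e -> exists2 r : R, 0 < r & forall h k, `|h| + `|k| < r ->
    `|u (x + h) (y + k) - u x y - (p * h - q * k)| <= e * (`|h| + `|k|) /\
    `|v (x + h) (y + k) - v x y - (q * h + p * k)| <= e * (`|h| + `|k|).

Let ucont x y : a <= x <= b -> c <= y <= d ->
  [/\ {for x, continuous (u ^~ y)}, {for y, continuous (u x)},
   {for x, continuous (v ^~ y)} & {for y, continuous (v x)}].
Proof.
move=> xab ycd; have [p [q H]] := CR xab ycd.
have [r r0 rH] := H 1 ltr01.
have K (P : R) (f : R -> R) (z : R) :
  (forall h, `|h| < r -> `|f (z + h) - f z - P * h| <= `|h|) ->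
  {for z, continuous f}.
  move=> fH; apply/cvgrPdist_le => /= e e0.
  have m0 : 0 < e / (`|P| + 1) by rewrite divr_gt0// ltr_wpDl.
  apply/nbhs_ballP; exists (Num.min r (e / (`|P| + 1))) => /=.
    by rewrite lt_min r0.
  move=> t; rewrite /ball /= lt_min => /andP[tr te].
  have := fH (t - z); rewrite distrC in tr te *.
  rewrite (addrC z) subrK => /(_ tr) le1; rewrite ltr_pdivlMr ?ltr_wpDl// in te.
  rewrite distrC -(subrK (P * (t - z)) (f t - f z)).
  apply: le_trans (ler_normD _ _) _; rewrite normrM; move: te le1.
  by move: `|t - z| `|P| `|_ - _ * _| => ? ? ?; lra.
split.
- apply: (K p) => h hr; have := rH h 0.
  by rewrite normr0 !(mulr0, addr0, subr0, mul1r) => /(_ hr)[].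
- apply: (K (- q)) => h hr; have := rH 0 h.
  by rewrite normr0 !(mulr0, addr0, add0r, sub0r, mul1r) mulNr => /(_ hr)[].
- apply: (K q) => h hr; have := rH h 0.
  by rewrite normr0 !(mulr0, addr0, subr0, mul1r) => /(_ hr)[].
- apply: (K p) => h hr; have := rH 0 h.
  by rewrite normr0 !(mulr0, addr0, add0r, sub0r, mul1r) => /(_ hr)[].
Qed.

Let W := b - a.
Let H := d - c.

(* real part of the contour integral over the sub-rectangle
   [x, x + s W] x [y, y + s H] *)
Let circ x y s : R :=
  \int[mu]_(t in `[x, x + s * W]) (u t y - u t (y + s * H)) -
  \int[mu]_(t in `[y, y + s * H]) (v (x + s * W) t - v x t).

Let inside x y s := [/\ 0 < s, a <= x, x + s * W <= b, c <= y & y + s * H <= d].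

Let W0 : 0 < W. Proof. by rewrite subr_gt0. Qed.
Let H0 : 0 < H. Proof. by rewrite subr_gt0. Qed.

Let contu x1 x2 y : a <= x1 -> x2 <= b -> c <= y <= d -> cont_on (u ^~ y) x1 x2.
Proof.
move=> ax xb ycd t /andP[xt tx].
have tab : a <= t <= b by rewrite (le_trans ax)// (le_trans tx).
by have [] := ucont tab ycd.
Qed.

Let contv y1 y2 x : c <= y1 -> y2 <= d -> a <= x <= b -> cont_on (v x) y1 y2.
Proof.
move=> cy yd xab t /andP[yt ty].
have tcd : c <= t <= d by rewrite (le_trans cy)// (le_trans ty).
by have [] := ucont xab tcd.
Qed.

(** A side shared by two quarters is traversed once in each direction, so after cutting every side
    at its midpoint the inner contributions cancel. *)
Let circ_split x y s : inside x y s ->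
  let s' := s / 2 in
  circ x y s = circ x y s' + circ (x + s' * W) y s' + circ x (y + s' * H) s' +
               circ (x + s' * W) (y + s' * H) s'.
Proof.
move=> [s0 ax xb cy yd] s'.
have s'0 : 0 < s' by rewrite /s'; lra.
have es : s = s' + s' by rewrite /s'; lra.
have ws : 0 < s' * W by rewrite mulr_gt0.
have hs : 0 < s' * H by rewrite mulr_gt0.
rewrite es !mulrDl !addrA in xb yd.
have DB (f g : R -> R) p q : cont_on f p q -> cont_on g p q ->
    \int[mu]_(t in `[p, q]) (f t - g t) =
    \int[mu]_(t in `[p, q]) f t - \int[mu]_(t in `[p, q]) g t.
  by move=> fc gc; rewrite RintegralB//; exact: cont_on_integrable.
rewrite /circ es !mulrDl !addrA.
rewrite !DB; try by (apply: contu; lra). all: try by (apply: contv; lra).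
rewrite (@Rint_split _ (u ^~ y) x (x + s' * W)); try lra; last by apply: contu; lra.
rewrite (@Rint_split _ (u ^~ (y + s' * H + s' * H)) x (x + s' * W)); try lra;
  last by apply: contu; lra.
rewrite (@Rint_split _ (v (x + s' * W + s' * W)) y (y + s' * H)); try lra;
  last by apply: contv; lra.
rewrite (@Rint_split _ (v x) y (y + s' * H)); try lra; last by apply: contv; lra.
Qed.

(** The linear part contributes [q (s H) (s W)] to both integrals and cancels in their difference.
    The error is at most [2 e s (W + H)] on the sides, which have total length [s (W + H)]. *)
Let circ_small x y s x0 y0 p q r e : inside x y s -> 0 <= e ->
  x <= x0 <= x + s * W -> y <= y0 <= y + s * H -> s * (W + H) < r ->
  (forall h k, `|h| + `|k| < r ->
    `|u (x0 + h) (y0 + k) - u x0 y0 - (p * h - q * k)| <= e * (`|h| + `|k|) /\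
    `|v (x0 + h) (y0 + k) - v x0 y0 - (q * h + p * k)| <= e * (`|h| + `|k|)) ->
  `|circ x y s| <= 2 * e * s ^+ 2 * (W + H) ^+ 2.
Proof.
move=> [s0 ax xb cy yd] e0 xx0 yy0 sr uv.
have ws : 0 < s * W by rewrite mulr_gt0.
have hs : 0 < s * H by rewrite mulr_gt0.
have E t t' : x <= t <= x + s * W -> y <= t' <= y + s * H ->
   `|t - x0| + `|t' - y0| <= s * (W + H).
  by move=> tx ty; rewrite mulrDr lerD// ler_norml; lra.
have ev t t' : x <= t <= x + s * W -> y <= t' <= y + s * H ->
    `|u t t' - u x0 y0 - (p * (t - x0) - q * (t' - y0))| <= e * (s * (W + H)) /\
    `|v t t' - v x0 y0 - (q * (t - x0) + p * (t' - y0))| <= e * (s * (W + H)).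
  move=> tx ty; have le := E _ _ tx ty.
  have := uv (t - x0) (t' - y0) (le_lt_trans le sr).
  rewrite (addrC x0) (addrC y0) !subrK => -[U V].
  by split; [apply: le_trans U _|apply: le_trans V _]; rewrite ler_wpM2l.
have tri (A B A' B' : R) M : `|A - A'| <= M -> `|B - B'| <= M ->
    `|A - B - (A' - B')| <= 2 * M.
  move=> HA HB; rewrite (_ : _ - _ = (A - A') - (B - B')); last by ring.
  by apply: le_trans (ler_normB _ _) _; lra.
have y1 : y <= y <= y + s * H by rewrite lexx; lra.
have y2 : y <= y + s * H <= y + s * H by rewrite lexx andbT; lra.
have x1 : x <= x <= x + s * W by rewrite lexx; lra.
have x2 : x <= x + s * W <= x + s * W by rewrite lexx andbT; lra.
have iu : `|\int[mu]_(t in `[x, x + s * W]) (u t y - u t (y + s * H)) -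
    q * (s * H) * (x + s * W - x)| <= 2 * (e * (s * (W + H))) * (x + s * W - x).
  apply: Rint_bound; [lra| |].
    by apply: cont_onB; apply: contu; lra.
  move=> t tx; have [h1 _] := ev t y tx y1; have [h2 _] := ev t _ tx y2.
  move: h1 h2; rewrite -!addrA -!opprD => h1 h2.
  have := tri _ _ _ _ _ h1 h2; congr (`|_| <= _); ring.
have iv : `|\int[mu]_(t in `[y, y + s * H]) (v (x + s * W) t - v x t) -
    q * (s * W) * (y + s * H - y)| <= 2 * (e * (s * (W + H))) * (y + s * H - y).
  apply: Rint_bound; [lra| |].
    by apply: cont_onB; apply: contv; lra.
  move=> t ty; have [_ h1] := ev _ t x2 ty; have [_ h2] := ev _ t x1 ty.
  move: h1 h2; rewrite -!addrA -!opprD => h1 h2.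
  have := tri _ _ _ _ _ h1 h2; congr (`|_| <= _); ring.
rewrite /circ; move: iu iv; set I := Rintegral _ _ _; set J := Rintegral _ _ _.
rewrite !(addrAC _ _ (- _)) !subrr !add0r => iu iv.
rewrite (_ : I - J = (I - q * (s * H) * (s * W)) - (J - q * (s * W) * (s * H)));
  last by ring.
apply: le_trans (ler_normB _ _) _; apply: le_trans (lerD iu iv) _.
by rewrite le_eqVlt; apply/orP; left; apply/eqP; ring.
Qed.

(** By the triangle inequality some quarter carries at least a quarter of the integral, which is
    exactly how [s ^+ 2] scales. *)
Let next_rect (eps : R) x y s : inside x y s -> eps * s ^+ 2 <= `|circ x y s| ->
  exists x' y', (inside x' y' (s / 2) /\ eps * (s / 2) ^+ 2 <= `|circ x' y' (s / 2)|)
  /\ [/\ x <= x', x' + s / 2 * W <= x + s * W, y <= y' &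
         y' + s / 2 * H <= y + s * H].
Proof.
move=> ins big; have split := circ_split ins.
case: ins => s0 ax xb cy yd.
have ws : 0 < s / 2 * W by rewrite !mulr_gt0.
have hs : 0 < s / 2 * H by rewrite !mulr_gt0.
have eW : s * W = s / 2 * W + s / 2 * W by field.
have eH : s * H = s / 2 * H + s / 2 * H by field.
have s20 : 0 < s / 2 by lra.
apply: contrapT => no.
have small x' y' : x <= x' -> x' + s / 2 * W <= x + s * W -> y <= y' ->
    y' + s / 2 * H <= y + s * H -> `|circ x' y' (s / 2)| < eps * (s / 2) ^+ 2.
  move=> xx xw yy yh; rewrite ltNge; apply/negP => le; apply: no.
  exists x', y'; split; last by split.
  by split => //; split => //; lra.
have h1 : `|circ x y (s / 2)| < eps * (s / 2) ^+ 2 by apply: small; lra.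
have h2 : `|circ (x + s / 2 * W) y (s / 2)| < eps * (s / 2) ^+ 2.
  by apply: small; lra.
have h3 : `|circ x (y + s / 2 * H) (s / 2)| < eps * (s / 2) ^+ 2.
  by apply: small; lra.
have h4 : `|circ (x + s / 2 * W) (y + s / 2 * H) (s / 2)| < eps * (s / 2) ^+ 2.
  by apply: small; lra.
have := ler_normD (circ x y (s / 2) + circ (x + s / 2 * W) y (s / 2) +
  circ x (y + s / 2 * H) (s / 2)) (circ (x + s / 2 * W) (y + s / 2 * H) (s / 2)).
have := ler_normD (circ x y (s / 2) + circ (x + s / 2 * W) y (s / 2))
  (circ x (y + s / 2 * H) (s / 2)).
have := ler_normD (circ x y (s / 2)) (circ (x + s / 2 * W) y (s / 2)).
have e4 : eps * s ^+ 2 = 4 * (eps * (s / 2) ^+ 2) by field.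
rewrite e4 split in big.
by move: h1 h2 h3 h4 big; lra.
Qed.

(** Goursat's argument: a nonzero contour integral would persist, relative to area, in nested
    rectangles shrinking to a point, contradicting differentiability at that point. *)
Lemma rectangle_integral0 : \int[mu]_(t in `[a, b]) (u t c - u t d) =
  \int[mu]_(t in `[c, d]) (v b t - v a t).
Proof.
have -> : b = a + 1 * W by rewrite /W; ring.
have -> : d = c + 1 * H by rewrite /H; ring.
apply/eqP; rewrite -subr_eq0 -[X in X == 0]/(circ a c 1).
apply/negP => /negP cn0; set eps := `|circ a c 1|.
have eps0 : 0 < eps by rewrite normr_gt0.
pose good (q : R * R * R) := inside q.1.1 q.1.2 q.2 /\
  eps * q.2 ^+ 2 <= `|circ q.1.1 q.1.2 q.2|.
pose sub (q' q : R * R * R) := [/\ q.1.1 <= q'.1.1,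
  q'.1.1 + q'.2 * W <= q.1.1 + q.2 * W, q.1.2 <= q'.1.2 &
  q'.1.2 + q'.2 * H <= q.1.2 + q.2 * H].
(* The selection has to be a total function; on rectangles that are not [good] its value is
   arbitrary. *)
have /choice[F HF] : forall q, exists q', good q ->
    [/\ good q', q'.2 = q.2 / 2 & sub q' q].
  move=> [[x y] s]; have [[i1 i2]|n] := pselect (good (x, y, s)); last by exists (x, y, s).
  by have [x' [y' [? ?]]] := next_rect i1 i2; exists (x', y', s / 2).
pose Q n := iter n F (a, c, 1).
have gQ n : good (Q n).
  elim: n => [|n IH]; last by have [] := HF _ IH.
  split; last by rewrite /= expr1n mulr1.
  by split => //=; rewrite ?ltr01//; rewrite /W /H; lra.
have QS n : (Q n.+1).2 = (Q n).2 / 2 /\ sub (Q n.+1) (Q n).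
  by have [] := HF _ (gQ n).
have s2 n : (Q n).2 = 2^-1 ^+ n.
  by elim: n => [|n IH]; rewrite ?expr0// (QS n).1 IH exprS mulrC.
have sub_tr n k : sub (Q (k + n)%N) (Q n).
  elim: k => [|k]; first by split.
  have [_] := QS (k + n)%N; rewrite /sub addSn => -[a1 a2 a3 a4] [b1 b2 b3 b4].
  by split; [exact: le_trans b1 a1|exact: le_trans a2 b2|
             exact: le_trans b3 a3|exact: le_trans a4 b4].
have sub_any n k : (Q n).1.1 <= (Q k).1.1 + (Q k).2 * W /\
    (Q n).1.2 <= (Q k).1.2 + (Q k).2 * H.
  have [[+ _] [+ _]] := (gQ n, gQ k) => -[sn _ _ _ _] [sk _ _ _ _].
  have wn : 0 < (Q n).2 * W by rewrite mulr_gt0.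
  have hn : 0 < (Q n).2 * H by rewrite mulr_gt0.
  have wk : 0 < (Q k).2 * W by rewrite mulr_gt0.
  have hk : 0 < (Q k).2 * H by rewrite mulr_gt0.
  have [kn|/ltnW nk] := leqP k n.
    have := sub_tr k (n - k)%N; rewrite subnK// => -[_ a2 _ a4].
    by split; [apply: le_trans a2|apply: le_trans a4]; rewrite lerDl ltW.
  have := sub_tr n (k - n)%N; rewrite subnK// => -[a1 _ a3 _].
  by split; [apply: le_trans a1 _|apply: le_trans a3 _]; rewrite lerDl ltW.
(* The common point of the nested rectangles is the supremum of their lower left corners, which
   [sub_any] bounds by every upper right corner. *)
pose x0 := sup (range (fun n => (Q n).1.1)).
pose y0 := sup (range (fun n => (Q n).1.2)).
have hx k : (Q k).1.1 <= x0 <= (Q k).1.1 + (Q k).2 * W.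
  apply/andP; split.
    apply: ub_le_sup; last by exists k.
    by exists ((Q 0%N).1.1 + (Q 0%N).2 * W) => _ [n _ <-]; have [] := sub_any n 0%N.
  apply: ge_sup; first by exists (Q 0%N).1.1, 0%N.
  by move=> _ [n _ <-]; have [] := sub_any n k.
have hy k : (Q k).1.2 <= y0 <= (Q k).1.2 + (Q k).2 * H.
  apply/andP; split.
    apply: ub_le_sup; last by exists k.
    by exists ((Q 0%N).1.2 + (Q 0%N).2 * H) => _ [n _ <-]; have [] := sub_any n 0%N.
  apply: ge_sup; first by exists (Q 0%N).1.2, 0%N.
  by move=> _ [n _ <-]; have [] := sub_any n k.
have [p [q CR0]] : exists p q : R,
  forall e, 0 < e -> exists2 r : R, 0 < r & forall h k, `|h| + `|k| < r ->
    `|u (x0 + h) (y0 + k) - u x0 y0 - (p * h - q * k)| <= e * (`|h| + `|k|) /\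
    `|v (x0 + h) (y0 + k) - v x0 y0 - (q * h + p * k)| <= e * (`|h| + `|k|).
  apply: CR.
    by have := hx 0%N; rewrite /= /W; lra.
  by have := hy 0%N; rewrite /= /H; lra.
have WH0 : 0 < W + H by rewrite addr_gt0.
(* With this [e] the bound of [circ_small] becomes [eps s^2 / 2], half of the lower bound kept by
   the construction. *)
pose e := eps / (4 * (W + H) ^+ 2).
have e0 : 0 < e by rewrite divr_gt0// mulr_gt0// exprn_gt0.
have [r r0 rP] := CR0 e e0.
have [n nr] : exists n, 2^-1 ^+ n * (W + H) < r.
  have : (fun n => 2^-1 ^+ n : R) @ \oo --> (0 : R).
    by apply: cvg_expr; rewrite ger0_norm; lra.
  move=> /cvgrPdist_lt/(_ (r / (W + H)))[]; first by rewrite divr_gt0.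
  move=> n _ /(_ n (leqnn _)); rewrite sub0r normrN ger0_norm ?exprn_ge0 ?invr_ge0//.
  by rewrite ltr_pdivlMr// => ?; exists n.
have [ins big] := gQ n.
have := circ_small ins (ltW e0) (hx n) (hy n) _ rP; rewrite s2 => /(_ nr).
rewrite s2 in big; move=> /(le_trans big); apply/negP; rewrite -ltNge.
have t0 : 0 < (2^-1 : R) ^+ n ^+ 2 by rewrite !exprn_gt0// invr_gt0.
rewrite (_ : 2 * e * _ * _ = eps * (2^-1 : R) ^+ n ^+ 2 / 2); last first.
  by rewrite /e; field; apply/eqP; lra.
by rewrite gtr_pMr ?mulr_gt0//; lra.
Qed.

End Goursat.

(** * The complex exponential *)

Section ComplexExp.
Variable R : realType.
Local Notation C := (R[i]^o).
Implicit Types (x y z : R[i]).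

Lemma is_derive_approx (f : R -> R) (x l : R) : is_derive x 1 f l ->
  forall e : R, 0 < e -> exists2 d : R, 0 < d &
    forall h : R, `|h| < d -> `|f (x + h) - f x - h * l| <= e * `|h|.
Proof.
move=> [dfx dl] e e0.
have : (fun h : R => h^-1 *: ((f \o shift x) (h *: (1 : R)) - f x)) @ 0^' --> l.
  by rewrite -dl; exact: dfx.
move=> /cvgrPdist_lt/(_ _ e0)/nbhs_ballP[d /= d0 dH].
exists d => // h hd; have [->|h0] := eqVneq h 0.
  by rewrite addr0 subrr mul0r subrr !normr0 mulr0.
have := dH h; rewrite /ball /= sub0r normrN => /(_ hd h0).
have nh : 0 < `|h| by rewrite normr_gt0.
rewrite -[l in `|l - _|](mulKf h0) -scalerBr /GRing.scale /= mulr1 normrM normfV.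
by rewrite distrC (addrC h) mulrC ltr_pdivrMr// => /ltW.
Qed.

Lemma cexp_Re z : complex.Re (cexp z) = expR (complex.Re z) * cos (complex.Im z).
Proof. by rewrite /cexp ReM /= mul0r subr0. Qed.

Lemma cexp_Im z : complex.Im (cexp z) = expR (complex.Re z) * sin (complex.Im z).
Proof. by rewrite /cexp ImM /= mul0r addr0. Qed.

#[local] Opaque cexp.

Lemma cexpD x y : cexp (x + y) = cexp x * cexp y.
Proof.
apply: complexP.
  by rewrite cexp_Re ReD ImD ReM !cexp_Re !cexp_Im expRD cosD; ring.
by rewrite cexp_Im ReD ImD ImM !cexp_Re !cexp_Im expRD sinD; ring.
Qed.

Lemma cexp0 : cexp (0 : R[i]) = 1.
Proof.
by apply: complexP; rewrite ?cexp_Re ?cexp_Im /= expR0 ?cos0 ?sin0 ?mulr1 ?mulr0.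
Qed.

Lemma cexpN z : cexp (- z) = (cexp z)^-1.
Proof.
have e : cexp z * cexp (- z) = 1 by rewrite -cexpD subrr cexp0.
have z0 : cexp z != 0.
  by apply/eqP => z0; have := e; rewrite z0 mul0r => /eqP; rewrite eq_sym oner_eq0.
by apply: (mulfI z0); rewrite e divff.
Qed.

Lemma cexp_real (a : R) : cexp a%:C = (expR a)%:C.
Proof.
by apply: complexP; rewrite ?cexp_Re ?cexp_Im /= ?cos0 ?sin0 ?mulr1 ?mulr0.
Qed.

Lemma normc_cexp z : normc (cexp z) = expR (complex.Re z).
Proof.
apply/eqP; rewrite -(@eqrXn2 _ 2)// ?normc_ge0 ?expR_ge0// -csq_normc /csq.
by rewrite cexp_Re cexp_Im !exprMn -mulrDr cos2Dsin2 mulr1.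
Qed.

Lemma cexp_neq0 z : cexp z != 0.
Proof. by rewrite -normc_eq0 normc_cexp gt_eqF// expR_gt0. Qed.

Lemma cexp_2pi (a : R) : cexp (a +i* (2 * pi)) = cexp (a +i* 0).
Proof.
apply: complexP; rewrite ?cexp_Re ?cexp_Im /= mulr_natl.
  by rewrite cos2pi cos0.
by rewrite sin2pi sin0.
Qed.

(** The functional equation reduces the claim to [z = 0], where it follows from the real derivatives
    of [expR], [cos] and [sin] at 0. *)
Lemma cdiff_cexp z : cdiff (@cexp R) z (cexp z).
Proof.
suff H e : 0 < e -> exists2 d : R, 0 < d &
    forall h : R[i], normc h < d -> normc (cexp h - 1 - h) <= e * normc h.
  move=> e e0; have ez0 : 0 < e / expR (complex.Re z) by rewrite divr_gt0// expR_gt0.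
  have [d d0 dH] := H _ ez0.
  exists d => // h hd.
  rewrite cexpD (_ : _ - _ = cexp z * (cexp h - 1 - h)); last by ring.
  have := dH h hd; rewrite normcM normc_cexp mulrAC ler_pdivlMr ?expR_gt0//.
  by rewrite mulrC.
(* The real part costs [3 ep] and the imaginary part [5 ep]; the cap at 1 controls the products of
   errors. *)
move=> e0; pose ep : R := Num.min 1 (e / 8).
have ep0 : 0 < ep by rewrite lt_min ltr01/=; lra.
have ep1 : ep <= 1 by rewrite ge_min lexx.
have epe : ep <= e / 8 by rewrite ge_min lexx orbT.
clearbody ep.
have [d1 d10 H1] := is_derive_approx (is_derive_expR (0 : R)) ep0.
have [d2 d20 H2] := is_derive_approx (is_derive_cos (0 : R)) ep0.
have [d3 d30 H3] := is_derive_approx (is_derive_sin (0 : R)) ep0.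
exists (Num.min (Num.min d1 d2) (Num.min d3 ep)); first by rewrite !lt_min d10 d20 d30 ep0.
move=> h; rewrite !lt_min => /andP[/andP[h1 h2] /andP[h3 h4]].
have Reh := Re_le_normc h; have Imh := Im_le_normc h.
have := H1 _ (le_lt_trans Reh h1); have := H2 _ (le_lt_trans Imh h2).
have := H3 _ (le_lt_trans Imh h3).
rewrite !add0r expR0 cos0 sin0 !oppr0 mulr0 !subr0 !addr0 !mulr1.
set a := complex.Re h in Reh *; set b := complex.Im h in Imh * => E3 E2 E1.
set N := normc h in h1 h2 h3 h4 Reh Imh *.
have N0 : 0 <= N := normc_ge0 h.
have N1 : N <= 1 by rewrite (le_trans (ltW h4)).
have cb : `|cos b| <= 1 := cos_max b.
have K1 : `|expR a * cos b - 1 - a| <= 3 * ep * N.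
  rewrite (_ : _ - a = (expR a - 1 - a) * cos b + (1 + a) * (cos b - 1)); last by ring.
  apply: le_trans (ler_normD _ _) _; rewrite !normrM.
  have A1 : `|expR a - 1 - a| * `|cos b| <= ep * N.
    rewrite -[leRHS]mulr1; apply: ler_pM => //; apply: le_trans E1 _.
    by rewrite ler_wpM2l// ltW.
  have A2 : `|1 + a| * `|cos b - 1| <= 2 * (ep * N).
    apply: ler_pM => //; last by apply: le_trans E2 _; rewrite ler_wpM2l// ltW.
    by apply: le_trans (ler_normD _ _) _; rewrite normr1; lra.
  by lra.
have K2 : `|expR a * sin b - b| <= 5 * ep * N.
  rewrite (_ : _ - b = (expR a - 1) * sin b + (sin b - b)); last by ring.
  apply: le_trans (ler_normD _ _) _; rewrite !normrM.
  have A0 : ep * `|a| <= 1 * `|a| by rewrite ler_wpM2r.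
  have A0' : ep * `|b| <= 1 * `|b| by rewrite ler_wpM2r.
  have A1 : `|expR a - 1| <= 2 * N.
    by rewrite -(subrK a (expR a - 1)); apply: le_trans (ler_normD _ _) _; lra.
  have A2 : `|sin b| <= 2 * ep.
    by rewrite -(subrK b (sin b)); apply: le_trans (ler_normD _ _) _; lra.
  have A3 : `|expR a - 1| * `|sin b| <= 2 * N * (2 * ep) by apply: ler_pM.
  have A4 : ep * `|b| <= ep * N by rewrite ler_wpM2l// ltW.
  by lra.
apply: le_trans (normc_le_ReIm _) _.
rewrite !ReB !ImB cexp_Re cexp_Im -/a -/b /= subr0.
apply: le_trans (lerD K1 K2) _; rewrite -mulrDl -mulrDl ler_wpM2r//; lra.
Qed.

End ComplexExp.

Section MeanValue.
Variable R : realType.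
Local Notation C := (R[i]^o).
Local Notation mu := (@lebesgue_measure R).
Implicit Types (f : C -> C).

Lemma differentiable_cdiff f z : differentiable f z <-> exists l, cdiff f z l.
Proof.
split=> [/derivable1_diffP/derivableP/cdiff_is_derive H|[l /cdiff_is_derive[H _]]].
  by exists ('D_1 f z).
exact/derivable1_diffP.
Qed.

Lemma Re_continuous : continuous (@complex.Re R : C -> R).
Proof.
move=> z; have P := @cvgrPdist_lt _ _ _ (nbhs z) _ (@complex.Re R : C -> R).
apply/P => e e0; apply/nbhs_complexP; exists e => // y.
by rewrite -ReB -normrN -ReN opprB; exact: le_lt_trans (Re_le_normc _).
Qed.

Lemma Im_continuous : continuous (@complex.Im R : C -> R).
Proof.
move=> z; have P := @cvgrPdist_lt _ _ _ (nbhs z) _ (@complex.Im R : C -> R).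
apply/P => e e0; apply/nbhs_complexP; exists e => // y.
by rewrite -ImB -normrN -ImN opprB; exact: le_lt_trans (Im_le_normc _).
Qed.

Lemma complex_line_continuous (a w : C) : continuous (fun t : R => a + t%:C * w : C).
Proof.
move=> t; have P := @cvg_complexP _ _ (nbhs t) _ (fun t : R => a + t%:C * w : C).
apply/P => e e0; apply/nbhs_ballP; exists (e / (normc w + 1)) => /=.
  by rewrite divr_gt0// ltr_wpDl// normc_ge0.
have w0 : 0 < normc w + 1 by rewrite ltr_wpDl// normc_ge0.
move=> s; rewrite /ball /= distrC ltr_pdivlMr// => H.
rewrite opprD addrACA subrr add0r -mulrBl -rmorphB normcM normc_real.
by apply: le_lt_trans H; rewrite ler_wpM2l// lerDl.
Qed.

Definition circ_pt (r y : R) : C := r%:C * cexp (0 +i* y).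

Lemma normc_circ_pt r y : 0 <= r -> normc (circ_pt r y) = r.
Proof.
by move=> r0; rewrite normcM normc_real normc_cexp /= expR0 mulr1 ger0_norm.
Qed.

Lemma cexp_circ_pt (a y : R) : cexp (a +i* y) = circ_pt (expR a) y.
Proof.
rewrite /circ_pt -cexp_real -cexpD; congr cexp.
by apply: complexP; rewrite ?ReD ?ImD /= ?addr0 ?add0r.
Qed.

Lemma differentiable_mulc (a z : C) : differentiable (fun w : C => a * w : C) z.
Proof.
apply/differentiable_cdiff; exists a => e e0; exists 1; first exact: ltr01.
move=> h _; rewrite mulrDr (addrC (a * z)) addrK mulrC subrr normc0.
by rewrite mulr_ge0 ?normc_ge0// ltW.
Qed.

Lemma circ_pt_continuous r : continuous (circ_pt r).
Proof.
move=> y; rewrite /circ_pt.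
have -> : (fun y => r%:C * cexp (0 +i* y)) =
    (fun z : C => r%:C * cexp z : C) \o (fun y : R => (0 : C) + y%:C * ('i%C : C)).
  apply/funext => t /=; congr (_ * cexp _).
  by apply: complexP; rewrite ?ReD ?ImD ?ReM ?ImM /=; ring.
apply: continuous_comp; first exact: complex_line_continuous.
apply: differentiable_continuous.
apply: (@differentiable_comp _ _ _ _ (@cexp R : C -> C) (fun w : C => r%:C * w : C)).
  by apply/differentiable_cdiff; eexists; exact: cdiff_cexp.
exact: differentiable_mulc.
Qed.

(* On the strip, [f (e^s)] is holomorphic and [2 pi i]-periodic, so the
   horizontal sides of a rectangle of height [2 pi] cancel. *)
Lemma circle_mean_radius f (d r : R) : 0 < d -> d < r ->
  (forall z : C, d <= normc z <= r -> differentiable f z) ->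
  \int[mu]_(y in `[0, 2 * pi]) complex.Im (f (circ_pt r y)) =
  \int[mu]_(y in `[0, 2 * pi]) complex.Im (f (circ_pt d y)).
Proof.
move=> d0 dr fd.
have r0 : 0 < r by lra.
have pi0 : 0 < 2 * pi :> R by rewrite mulr_gt0// pi_gt0.
pose F (z : R[i]) : R[i] := f (cexp z).
pose u x y := complex.Re (F (x +i* y)); pose v x y := complex.Im (F (x +i* y)).
have Fd x y : ln d <= x <= ln r -> exists l, cdiff F (x +i* y) l.
  move=> /andP[dx xr]; apply/differentiable_cdiff; apply: differentiable_comp.
    by apply/differentiable_cdiff; eexists; exact: cdiff_cexp.
  apply: fd; rewrite normc_cexp /= -[X in X <= _ <= _](lnK d0).
  by rewrite -[X in _ <= _ <= X](lnK r0) !ler_expR dx.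
have lnlt : ln d < ln r by rewrite ltr_ln ?posrE.
lapply (@rectangle_integral0 R u v (ln d) (ln r) 0 (2 * pi) lnlt pi0); last first.
  move=> x y xb _; have [[p q] l] := Fd x y xb; exists p, q => e e0.
  have [s s0 sH] := l _ e0; exists s => // h k hk.
  have hle : normc (h +i* k) <= `|h| + `|k| := normc_le_ReIm (h +i* k).
  have := sH (h +i* k) (le_lt_trans hle hk).
  have -> : x +i* y + (h +i* k) = (x + h) +i* (y + k) by [].
  move=> le; have le2 := le_trans le (ler_wpM2l (ltW e0) hle).
  split; [move: (le_trans (Re_le_normc _) le2)|move: (le_trans (Im_le_normc _) le2)].
    by rewrite !ReB ReM /= (mulrC h) (mulrC k).
  by rewrite !ImB ImM /= (mulrC h) (mulrC k).
rewrite (_ : Rintegral _ _ _ = 0); last first.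
  rewrite (_ : (fun _ => _) = cst 0); first by rewrite Rintegral_cst//= mul0r.
  by apply/funext => t; rewrite /u /F cexp_2pi subrr.
have vE s t : 0 < s -> v (ln s) t = complex.Im (f (circ_pt s t)).
  by move=> s0; rewrite /v /F cexp_circ_pt lnK.
have cv s : d <= s <= r -> cont_on (fun t => complex.Im (f (circ_pt s t))) 0 (2 * pi).
  move=> sdr t _; apply: continuous_comp; last exact: Im_continuous.
  apply: continuous_comp; first exact: circ_pt_continuous.
  by apply: differentiable_continuous; apply: fd; rewrite normc_circ_pt//; case/andP: sdr => ds _; exact: le_trans (ltW d0) ds.
under eq_Rintegral do rewrite !vE//.
rewrite RintegralB//.
- by move=> /esym/eqP; rewrite subr_eq0 => /eqP.
- by apply: cont_on_integrable; apply: cv; rewrite lexx andbT ltW.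
- by apply: cont_on_integrable; apply: cv; rewrite lexx ltW.
Qed.

(** The circle integral is independent of the radius, and letting the radius tend to 0 uses only
    continuity at the centre. Asking for differentiability off 0 allows difference quotients with a
    removable singularity as [f]. *)
Lemma mean_value_Im f (r : R) : 0 < r -> {for (0 : C), continuous f} ->
  (forall z : C, 0 < normc z <= r -> differentiable f z) ->
  \int[mu]_(y in `[0, 2 * pi]) complex.Im (f (circ_pt r y)) = complex.Im (f 0) * (2 * pi).
Proof.
move=> r0 f0 fd.
have pi0 : 0 < 2 * pi :> R by rewrite mulr_gt0// pi_gt0.
apply/eqP; rewrite -subr_eq0 -normr_le0; apply/ler_addgt0Pr => e e0; rewrite add0r.
have ep0 : 0 < e / (2 * pi) by rewrite divr_gt0.
have /cvgrPdist_lt/(_ _ ep0)/nbhs_complexP[d d0 dH] :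
    {for (0 : C), continuous ((@complex.Im R : C -> R) \o f)}.
  by apply: continuous_comp => //; exact: Im_continuous.
have [s [s0 sd sr]] : exists s : R, [/\ 0 < s, s < d & s < r].
  exists (Num.min d r / 2); rewrite !ltr_pdivrMr// divr_gt0 ?lt_min ?d0//.
  by split=> //; rewrite gt_min; apply/orP; [left|right]; lra.
have fcont t : {for t, continuous (fun y => complex.Im (f (circ_pt s y)))}.
  apply: continuous_comp; last exact: Im_continuous.
  apply: continuous_comp; first exact: circ_pt_continuous.
  by apply: differentiable_continuous; apply: fd; rewrite normc_circ_pt ?(ltW s0)// s0 ltW.
have fds (z : C) : s <= normc z <= r -> differentiable f z.
  by move=> /andP[sz zr]; apply: fd; rewrite (lt_le_trans s0 sz) zr.
rewrite (circle_mean_radius s0 sr fds).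
have := @Rint_bound _ (fun y => complex.Im (f (circ_pt s y))) 0 (2 * pi)
  (complex.Im (f 0)) (e / (2 * pi)) (ltW pi0).
rewrite !subr0 divfK ?lt0r_neq0//; apply; first by move=> *; exact: fcont.
by move=> y _; rewrite distrC ltW//; apply: dH; rewrite subr0 normc_circ_pt ?(ltW s0).
Qed.

Lemma mean_value_Re f (r : R) : 0 < r -> {for (0 : C), continuous f} ->
  (forall z : C, 0 < normc z <= r -> differentiable f z) ->
  \int[mu]_(y in `[0, 2 * pi]) complex.Re (f (circ_pt r y)) = complex.Re (f 0) * (2 * pi).
Proof.
(* The real part is the imaginary part of [i f]. *)
move=> r0 f0 fd; have Ii (z : R[i]) : complex.Im ('i%C * z) = complex.Re z.
  by rewrite ImM /= mul0r mul1r add0r.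
pose g : C -> C := (fun w : C => 'i%C * w : C) \o f.
have g0 : {for (0 : C), continuous g}.
  apply: continuous_comp; first exact: f0.
  apply: differentiable_continuous; exact: differentiable_mulc.
have gd (z : C) : 0 < normc z <= r -> differentiable g z.
  move=> zr; apply: differentiable_comp; first exact: fd.
  exact: differentiable_mulc.
have := mean_value_Im r0 g0 gd; rewrite /g /= Ii => <-.
by apply: eq_Rintegral => y _; rewrite /= Ii.
Qed.

End MeanValue.

#[local] Opaque cexp.
Section OneVariable.
Variable R : realType.
Local Notation C := (R[i]^o).
Local Notation mu := (@lebesgue_measure R).

Lemma differentiable_mobius (a z : C) : 1 + conjc a * z != 0 ->
  differentiable (fun w : C => (w + a) / (1 + conjc a * w) : C) z.
Proof.
move=> D0; apply: differentiableM.
  by apply: differentiableD.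
by apply: differentiableV => //; apply: differentiableD.
Qed.

(** Compares numerator and denominator of the automorphism [(w + a) / (1 + conj(a) w)]: the sign of
    [1 - |w|^2] decides whether its modulus is below, at or above 1 when [|a| < 1]. *)
Lemma mobius_identity (a w : R[i]) :
  csq (1 + conjc a * w) - csq (w + a) = (1 - csq a) * (1 - csq w).
Proof. by case: a w => a1 a2 [w1 w2]; rewrite /csq /=; ring. Qed.

(* A disc automorphism moves [a] to the centre; then apply the mean value
   property. *)
Lemma holomorphic_zero_on_circle (f : C -> C) :
  (forall z : C, normc z <= 1 -> differentiable f z) ->
  (forall z : C, normc z = 1 -> f z = 0) ->
  forall a : C, normc a <= 1 -> f a = 0.
Proof.
move=> fd f0 a; rewrite le_eqVlt => /predU1P[|a1]; first exact: f0.
pose M (w : C) : C := (w + a) / (1 + conjc a * w).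
have ca : csq a < 1 by rewrite csq_normc expr_lt1// normc_ge0.
have D0 w : normc w <= 1 -> 1 + conjc a * w != 0.
  move=> w1; rewrite addrC addr_eq0; apply/eqP => /(congr1 (@normc R)).
  rewrite normcM normc_conj normc_opp normc1 => H.
  have : normc a * normc w < 1 by apply: le_lt_trans a1; rewrite ler_piMr// normc_ge0.
  by rewrite H ltxx.
have csqM w : normc w <= 1 -> csq (M w) = csq (w + a) / csq (1 + conjc a * w).
  by move=> w1; rewrite csqM !csq_normc normcV exprVn.
have D1 w : normc w <= 1 -> 0 < csq (1 + conjc a * w).
  by move=> w1; rewrite csq_normc exprn_gt0// normc_gt0 D0.
have M1 w : normc w <= 1 -> normc (M w) <= 1.
  move=> w1; rewrite -csq_le1 csqM// ler_pdivrMr ?D1// mul1r -subr_ge0.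
  rewrite mobius_identity mulr_ge0// subr_ge0 ?csq_le1// ltW//.
have M1E w : normc w = 1 -> normc (M w) = 1.
  move=> w1; have w1' : normc w <= 1 by rewrite w1.
  apply/eqP; rewrite -(@eqrXn2 _ 2)// ?normc_ge0// -csq_normc csqM// expr1n.
  rewrite -(inj_eq (mulIf (lt0r_neq0 (D1 w w1')))) divfK ?lt0r_neq0 ?D1// mul1r.
  rewrite eq_sym -subr_eq0 mobius_identity (csq_normc w) w1 expr1n subrr mulr0//.
have M0 : M 0 = a by rewrite /M mulr0 addr0 add0r divr1.
have gd (w : C) : normc w <= 1 -> differentiable (f \o M) w.
  move=> w1; apply: differentiable_comp; first exact: differentiable_mobius (D0 _ w1).
  by apply: fd; exact: M1.
have g0 : {for (0 : C), continuous (f \o M)}.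
  by apply: differentiable_continuous; apply: gd; rewrite normc0.
have gd' (w : C) : 0 < normc w <= 1 -> differentiable (f \o M) w by case/andP => _ /gd.
have E y : (f \o M) (circ_pt 1 y) = 0 by apply: f0; rewrite M1E// normc_circ_pt.
have pi0 : 2 * pi != 0 :> R by rewrite mulf_neq0 ?pnatr_eq0// gt_eqF// pi_gt0.
have Z (h : R -> R) : (forall y, h y = 0) -> \int[mu]_(y in `[0, 2 * pi]) h y = 0.
  by move=> h0; rewrite (_ : h = cst 0) ?Rintegral_cst ?mul0r//; exact/funext.
have := mean_value_Re ltr01 g0 gd'; rewrite Z; last by move=> y; rewrite E.
move=> /esym/eqP; rewrite mulf_eq0 (negbTE pi0) orbF /= M0 => /eqP fr.
have := mean_value_Im ltr01 g0 gd'; rewrite Z; last by move=> y; rewrite E.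
move=> /esym/eqP; rewrite mulf_eq0 (negbTE pi0) orbF /= M0 => /eqP fi.
exact: complexP.
Qed.

(** The difference quotient, completed by [l] at 0, has the mean value property, and its value at
    the centre is the derivative. Derivatives thereby become integrals of values of [f] over a
    circle of fixed radius. *)
Lemma circle_derivative (f : C -> C) (r : R) (l : C) : 0 < r ->
  (forall z : C, normc z <= r -> differentiable f z) -> cdiff f 0 l ->
  \int[mu]_(y in `[0, 2 * pi]) complex.Re ((f (circ_pt r y) - f 0) / circ_pt r y) =
    complex.Re l * (2 * pi) /\
  \int[mu]_(y in `[0, 2 * pi]) complex.Im ((f (circ_pt r y) - f 0) / circ_pt r y) =
    complex.Im l * (2 * pi).
Proof.
move=> r0 fd fl.
pose g (z : C) : C := if z == 0 then l else (f z - f 0) / z.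
have gr y : g (circ_pt r y) = (f (circ_pt r y) - f 0) / circ_pt r y.
  by rewrite /g -normc_eq0 normc_circ_pt ?ltW// gt_eqF.
have g0 : {for (0 : C), continuous g}.
  have P := @cvg_complexP _ _ (nbhs (0 : C)) _ g (g 0).
  apply/P => e e0; have e20 : 0 < e / 2 by lra.
  have [d d0 dH] := fl _ e20.
  apply/nbhs_complexP; exists d => // z; rewrite subr0 => zd.
  rewrite /g eqxx; have [_|z0] := eqVneq z 0; first by rewrite subrr normc0.
  have nz : 0 < normc z by rewrite normc_gt0.
  have := dH z zd; rewrite add0r -ler_pdivrMr// -normcV -normcM => le.
  rewrite (_ : _ - l = (f z - f 0 - z * l) / z); last by field.
  by apply: le_lt_trans le _; lra.
have gd (z : C) : 0 < normc z <= r -> differentiable g z.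
  move=> /andP[z0 zr]; rewrite normc_gt0 in z0.
  apply/derivable1_diffP.
  apply: (@near_eq_derivable _ _ _ (fun w : C => (f w - f 0) / w : C)).
    apply/nbhs_complexP; exists (normc z); first by rewrite normc_gt0.
    move=> w wz; rewrite /g; have [w0|//] := eqVneq w 0.
    by move: wz; rewrite w0 sub0r normc_opp ltxx.
  apply/derivable1_diffP; apply: differentiableM.
    by apply: differentiableB; [exact: fd|exact: differentiable_cst].
  exact: differentiableV.
have g0l : g 0 = l by rewrite /g eqxx.
split; [rewrite -g0l -(mean_value_Re r0 g0 gd)|rewrite -g0l -(mean_value_Im r0 g0 gd)];
  by apply: eq_Rintegral => y _; rewrite gr.
Qed.

End OneVariable.

#[local] Opaque cexp.
(** * Holomorphic functions of several variables *)
Section SeveralVariables.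
Variables (R : realType) (N : nat).
Local Notation C := (R[i]^o).
Local Notation V := 'rV[C]_N.
Local Notation mu := (@lebesgue_measure R).
Local Notation e_ j := (delta_mx 0 j : V).

Definition near_by (x : V) (r : R) (y : V) := forall j, normc (y 0 j - x 0 j) < r.

Lemma near_by_le x r r' y : r <= r' -> near_by x r y -> near_by x r' y.
Proof. by move=> rr H j; exact: lt_le_trans (H j) rr. Qed.

Lemma near_by_refl x r : 0 < r -> near_by x r x.
Proof. by move=> r0 j; rewrite subrr normc0. Qed.

Lemma near_byD x r1 r2 y (j : 'I_N) (t : C) :
  near_by x r1 y -> normc t < r2 -> near_by x (r1 + r2) (y + t *: e_ j).
Proof.
move=> H tr i; rewrite !mxE eqxx /= addrAC.
apply: le_lt_trans (normcD_le _ _) _; apply: ltr_leD; first exact: H.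
rewrite /GRing.scale /=; case: (i == j); first by rewrite mulr1 ltW.
by rewrite mulr0 normc0; exact: le_trans (normc_ge0 t) (ltW tr).
Qed.

Lemma near_by_self x r (j : 'I_N) (t : C) : normc t < r -> near_by x r (x + t *: e_ j).
Proof.
move=> tr i; rewrite !mxE eqxx /= addrAC subrr add0r /GRing.scale /=.
case: (i == j); first by rewrite mulr1.
by rewrite mulr0 normc0; exact: le_lt_trans (normc_ge0 t) tr.
Qed.

Lemma open_near_by (D : set V) x : open D -> D x ->
  exists2 r : R, 0 < r & forall y, near_by x r y -> D y.
Proof. by move=> oD Dx; apply/nbhs_rVP; exact: open_nbhs_nbhs. Qed.

Variables (D : set V) (f : V -> C).
Hypotheses (oD : open D) (hf : holomorphic_on D f).

Local Notation pd j := (fun x : V => 'D_(e_ j) f x : R[i]).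

Lemma slice_cdiff x (j : 'I_N) (t : C) : D (x + t *: e_ j) ->
  cdiff (fun s : R[i] => f (x + (s : C) *: e_ j)) t (pd j (x + t *: e_ j)).
Proof.
move=> Dt; have := derivable_cdiff (hf.2 _ Dt j) => H e e0.
have [d d0 dH] := H e e0; exists d; first exact: d0.
move=> h hd; have := dH h hd.
by rewrite add0r scale0r addr0 -(addrA x) -scalerDl.
Qed.

(** Compactness of the parameter interval turns a radius depending on the point of the circle into
    one radius for the whole circle and all nearby centres. *)
Lemma circle_uniform x (j : 'I_N) (r : R) (P : R -> V -> Prop) :
  (forall t0, exists2 d : R, 0 < d & forall t p, normc (circ_pt r t - circ_pt r t0) < d ->
     near_by (x + circ_pt r t0 *: e_ j) d p -> P t p) ->
  exists2 d : R, 0 < d & forall y, near_by x d y ->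
    forall t, 0 <= t <= 2 * pi -> P t (y + circ_pt r t *: e_ j).
Proof.
move=> H.
have /compact_near_coveringP K : compact `[0, 2 * pi : R]%classic by exact: segment_compact.
lapply (K V (nbhs x) (fun y t => P t (y + circ_pt r t *: e_ j)) _); last first.
  move=> t0 _; have [d d0 dH] := H t0.
  have d20 : 0 < d / 2 by lra.
  have /cvg_complexP/(_ _ d20) ct := @circ_pt_continuous R r t0.
  exists ([set t | normc (circ_pt r t - circ_pt r t0) < d / 2], [set y | near_by x (d / 2) y]).
    by split => //=; apply/nbhs_rVP; exists (d / 2).
  move=> [t y] /= [td yd]; apply: dH; first by apply: lt_trans td _; lra.
  have -> : y + circ_pt r t *: e_ j = (y + circ_pt r t0 *: e_ j) +
      (circ_pt r t - circ_pt r t0 : C) *: e_ j.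
    by rewrite scalerBl -addrA [_ *: _ + (_ - _)]addrC subrK.
  rewrite (splitr d); apply: near_byD => // i.
  by rewrite !mxE opprD addrACA subrr addr0; exact: yd.
by move=> /nbhs_rVP[d d0 dH]; exists d => // y yd t t02; apply: dH => //=; rewrite in_itv.
Qed.

Lemma circle_uniform_continuous (g : V -> R[i]) x (j : 'I_N) (r : R) :
  (forall t0 (e : R), 0 < e -> exists2 d : R, 0 < d & forall p,
     near_by (x + circ_pt r t0 *: e_ j) d p ->
     normc (g p - g (x + circ_pt r t0 *: e_ j)) <= e) ->
  forall e : R, 0 < e -> exists2 d : R, 0 < d & forall y, near_by x d y ->
    forall t, 0 <= t <= 2 * pi ->
      normc (g (y + circ_pt r t *: e_ j) - g (x + circ_pt r t *: e_ j)) <= e.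
Proof.
move=> H e e0; apply: (circle_uniform (P := fun t p =>
  normc (g p - g (x + circ_pt r t *: e_ j)) <= e)) => t0.
have e20 : 0 < e / 2 by lra.
have [d d0 dH] := H t0 _ e20.
exists d => // t p td pd; apply: le_trans (normc_tri (g (x + circ_pt r t0 *: e_ j)) _ _) _.
have h1 := dH p pd.
have /dH : near_by (x + circ_pt r t0 *: e_ j) d (x + circ_pt r t *: e_ j).
  have -> : x + circ_pt r t *: e_ j = x + circ_pt r t0 *: e_ j +
      (circ_pt r t - circ_pt r t0 : C) *: e_ j.
    by rewrite scalerBl -addrA [_ *: _ + (_ - _)]addrC subrK.
  exact: near_by_self.
move=> h2; rewrite [leRHS]splitr; apply: lerD; first exact: h1.
by rewrite normc_subC; exact: h2.
Qed.

Lemma holomorphic_le x : D x -> forall e : R, 0 < e -> exists2 d : R, 0 < d &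
  forall p, near_by x d p -> normc (f p - f x) <= e.
Proof.
move=> Dx e e0; have [d d0 dH] := (continuous_rVP _ _).1 (hf.1 _ Dx) _ e0.
by exists d; [exact: d0|move=> p pd; apply: ltW; exact: dH].
Qed.

Lemma partial_circle p (j : 'I_N) (s : R) : 0 < s ->
  (forall t : C, normc t <= s -> D (p + t *: e_ j)) ->
  let q t : R[i] := (f (p + circ_pt s t *: e_ j) - f p) / circ_pt s t in
  [/\ cont_on (fun t => complex.Re (q t)) 0 (2 * pi),
      cont_on (fun t => complex.Im (q t)) 0 (2 * pi),
      \int[mu]_(t in `[0, 2 * pi]) complex.Re (q t) = complex.Re (pd j p) * (2 * pi) &
      \int[mu]_(t in `[0, 2 * pi]) complex.Im (q t) = complex.Im (pd j p) * (2 * pi)].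
Proof.
move=> s0 Dc q; pose g (z : C) : C := f (p + z *: e_ j).
have cs t : normc (circ_pt s t) = s by rewrite normc_circ_pt// ltW.
have gd (z : C) : normc z <= s -> differentiable g z.
  move=> zs; apply/differentiable_cdiff.
  by exists (pd j (p + z *: e_ j)); apply: slice_cdiff; exact: Dc.
have g0 : cdiff g 0 (pd j p).
  have := @slice_cdiff p j 0; rewrite scale0r addr0; apply.
  by rewrite -(addr0 p) -(scale0r (e_ j)); apply: Dc; rewrite ?normc0// ltW.
have [I1 I2] := circle_derivative s0 gd g0.
have qc t : {for t, continuous (q : R -> C)}.
  apply: (@continuous_comp _ _ _ (circ_pt s) (fun z : C => (g z - f p) / z : C)).
    exact: circ_pt_continuous.
  apply: differentiable_continuous; apply: differentiableM.
    by apply: differentiableB => //; apply: gd; rewrite cs.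
  by apply: differentiableV => //; rewrite -normc_eq0 cs gt_eqF.
rewrite /g scale0r addr0 in I1 I2; split; [| |exact: I1|exact: I2].
- move=> t _; apply: (@continuous_comp _ _ _ (q : R -> C) (@complex.Re R : C -> R)).
    exact: qc.
  exact: Re_continuous.
- move=> t _; apply: (@continuous_comp _ _ _ (q : R -> C) (@complex.Im R : C -> R)).
    exact: qc.
  exact: Im_continuous.
Qed.

Lemma mean_le (a b : R -> R) (A B e : R) :
  cont_on a 0 (2 * pi) -> cont_on b 0 (2 * pi) ->
  \int[mu]_(t in `[0, 2 * pi]) a t = A * (2 * pi) ->
  \int[mu]_(t in `[0, 2 * pi]) b t = B * (2 * pi) ->
  (forall t, 0 <= t <= 2 * pi -> `|a t - b t| <= e) -> `|A - B| <= e.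
Proof.
move=> ac bc aA bB ab; have pi0 : 0 < 2 * pi :> R by rewrite mulr_gt0// pi_gt0.
rewrite -(ler_pM2r pi0) -{1}(gtr0_norm pi0) -normrM mulrBl -aA -bB.
have := @Rint_bound _ (fun t => a t - b t) 0 (2 * pi) 0 e (ltW pi0) (cont_onB ac bc).
rewrite RintegralB//; try exact: cont_on_integrable.
rewrite mul0r !subr0; apply => t t02; rewrite subr0; exact: ab.
Qed.

(** The partial derivative at [y] is a mean of difference quotients over a circle of fixed radius
    around [y]; continuity of [f], uniform along that circle, makes these quotients vary little with
    [y]. *)
Lemma partial_continuous x (j : 'I_N) : D x -> forall e : R, 0 < e ->
  exists2 d : R, 0 < d & forall y, near_by x d y -> normc (pd j y - pd j x) <= e.
Proof.
move=> Dx e e0; have [r r0 rD] := open_near_by oD Dx.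
(* One third for moving the centre, two thirds for the closed disc of radius [s], since [near_byD]
   wants a strict inequality. *)
pose s := r / 3; have s0 : 0 < s by rewrite /s; lra.
have cs t : normc (circ_pt s t) = s by rewrite normc_circ_pt// ltW.
have Dc y t : near_by x s y -> normc t <= s -> D (y + t *: e_ j).
  move=> ys ts; apply: rD.
  have -> : r = s + (2 * s) by rewrite /s; field.
  by apply: near_byD => //; lra.
(* Two values of [f] are compared, the quotient divides by [s], and real and imaginary part each get
   [e / 2]. *)
pose ep := e * s / 4; have ep0 : 0 < ep by rewrite /ep divr_gt0// mulr_gt0.
have [d1 d10 H1] : exists2 d : R, 0 < d & forall y, near_by x d y ->
    forall t, 0 <= t <= 2 * pi -> normc (f (y + circ_pt s t *: e_ j) -
      f (x + circ_pt s t *: e_ j)) <= ep.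
  apply: (circle_uniform_continuous (g := f)); last exact: ep0.
  by move=> t0; apply: holomorphic_le; apply: Dc; rewrite ?cs//; exact: near_by_refl.
have [d2 d20 H2] := holomorphic_le Dx ep0.
exists (Num.min s (Num.min d1 d2)) => [|y yd]; first by rewrite !lt_min s0 d10.
have ys : near_by x s y by apply: near_by_le yd; rewrite ge_min lexx.
have y1 : near_by x d1 y by apply: near_by_le yd; rewrite !ge_min lexx orbT.
have y2 : near_by x d2 y by apply: near_by_le yd; rewrite !ge_min lexx !orbT.
have swap (a b c d : R[i]) : a - b - (c - d) = (a - c) + (d - b) by ring.
have qle t : 0 <= t <= 2 * pi -> normc
    ((f (y + circ_pt s t *: e_ j) - f y) / circ_pt s t -
     (f (x + circ_pt s t *: e_ j) - f x) / circ_pt s t) <= e / 2.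
  move=> t02; rewrite -mulrBl normcM normcV cs ler_pdivrMr//.
  rewrite swap; apply: le_trans (normcD_le _ _) _.
  have -> : e / 2 * s = ep + ep by rewrite /ep; field.
  apply: lerD; first exact: H1.
  by rewrite normc_subC; exact: H2.
have [cr1 ci1 R1 I1] := partial_circle s0 (fun t => Dc y t ys).
have [cr0 ci0 R0 I0] := partial_circle s0 (fun t => Dc x t (near_by_refl x s0)).
apply: le_trans (normc_le_ReIm _) _; rewrite ReB ImB [leRHS]splitr.
apply: lerD.
  apply: (mean_le cr1 cr0 R1 R0) => t t02.
  by rewrite -ReB; apply: le_trans (Re_le_normc _) _; exact: qle.
apply: (mean_le ci1 ci0 I1 I0) => t t02.
by rewrite -ImB; apply: le_trans (Im_le_normc _) _; exact: qle.
Qed.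

End SeveralVariables.

#[local] Opaque cexp.
Section Frechet.
Variables (R : realType) (N : nat).
Local Notation C := (R[i]^o).
Local Notation V := 'rV[C]_N.
Local Notation mu := (@lebesgue_measure R).
Local Notation e_ j := (delta_mx 0 j : V).

(** The real mean value theorem is applied to [Re (c (g(th) - t h l))] for [c = 1] and [c = -i];
    adding the two estimates produces the factor 2. *)
Lemma segment_increment (g : R[i] -> R[i]) (h l : R[i]) (M : R) :
  (forall t : R, 0 <= t <= 1 -> exists2 d, cdiff g (t%:C * h) d & normc (d - l) <= M) ->
  normc (g h - g 0 - h * l) <= 2 * (M * normc h).
Proof.
move=> H.
have /choice[d dP] : forall t : R, exists d : R[i], 0 <= t <= 1 ->
    cdiff g (t%:C * h) d /\ normc (d - l) <= M.
  move=> t; case: (boolP (0 <= t <= 1)) => [/H[d d1 d2]|_]; last by exists 0.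
  by exists d.
have key (c : R[i]) : normc c = 1 ->
    `|complex.Re (c * (g h - g 0 - h * l))| <= M * normc h.
  move=> c1.
  pose psi (t : R) : R := complex.Re (c * (g (0 + t%:C * h) - (0 + t%:C * h) * l)).
  have psid (t : R) : 0 <= t <= 1 -> is_derive t 1 psi (complex.Re (h * (c * (d t - l)))).
    move=> t01; apply: (@cdiff_Re_line _ (fun z => c * (g z - z * l))).
    apply/cdiff_is_derive.
    have /cdiff_is_derive[gd gdl] := (dP t t01).1.
    rewrite add0r; set z := _ * h in gd gdl *.
    have D1 : is_derive (z : C) (1 : C) (g : C -> C) (d t) by exact: DeriveDef.
    apply/cdiff_is_derive => e e0.
    have /cdiff_is_derive D2 := D1; have [r r0 rH] := D2 e e0.
    exists r => // k kr; have := rH k kr.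
    have E : c * (g (z + k) - (z + k) * l) - c * (g z - z * l) - k * (c * (d t - l)) =
      c * (g (z + k) - g z - k * d t) by ring.
    by move=> le; rewrite E normcM c1 mul1r.
  have [t t01] : exists2 t, t \in `[0, 1]%R &
      psi 1 - psi 0 = complex.Re (h * (c * (d t - l))) * (1 - 0).
    apply: MVT_segment => //.
      by move=> t; rewrite in_itv /= => /andP[/ltW t0 /ltW t1]; apply: psid; rewrite t0.
    apply: continuous_in_subspaceT => t; rewrite inE /= in_itv /= => t01.
    have [+ _] := psid t t01; move=> /derivable1_diffP; exact: differentiable_continuous.
  rewrite in_itv /= in t01.
  rewrite /psi -ReB !add0r mul1r mul0r mul0r subr0 subr0 mulr1 -mulrBr => E.
  rewrite (_ : g h - g 0 - h * l = g h - h * l - g 0); last by ring.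
  rewrite E; apply: le_trans (Re_le_normc _) _.
  rewrite !normcM c1 mul1r mulrC ler_wpM2r ?normc_ge0//.
  by have [] := dP t t01.
apply: le_trans (normc_le_ReIm _) _; rewrite mulr_natl mulr2n; apply: lerD.
  by have := key 1 (normc1 _); rewrite mul1r.
have ni : normc (- 'i%C : R[i]) = 1 by rewrite normc_opp /= expr0n /= expr1n add0r sqrtr1.
have ri (z : R[i]) : complex.Re (- 'i%C * z) = complex.Im z by rewrite ReM /=; ring.
by have := key _ ni; rewrite ri.
Qed.

Variables (D : set V) (f : V -> C).
Hypotheses (oD : open D) (hf : holomorphic_on D f).

Local Notation pd j := (fun x : V => 'D_(e_ j) f x : R[i]).

(** The increment starts at any [p] near [x] while the derivative stays at [x]; [frechet_bound]
    needs this because it moves through intermediate points. *)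
Lemma strong_partial x (j : 'I_N) : D x -> forall e : R, 0 < e ->
  exists2 r : R, 0 < r & forall p (h : R[i]), near_by x r p -> normc h < r ->
    normc (f (p + (h : C) *: e_ j) - f p - h * pd j x) <= e * normc h.
Proof.
move=> Dx e e0; have e20 : 0 < e / 2 by lra.
have [r1 r10 H1] := open_near_by oD Dx.
have [r2 r20 H2] := partial_continuous oD hf j Dx e20.
pose r := Num.min r1 r2 / 2.
have m0 : 0 < Num.min r1 r2 by rewrite lt_min r10.
have r0 : 0 < r by rewrite /r; lra.
exists r => // p h xp hr.
have := @segment_increment (fun s => f (p + (s : C) *: e_ j)) h (pd j x) (e / 2).
rewrite scale0r addr0 => H; apply: le_trans (H _) _; last first.
  by rewrite le_eqVlt; apply/orP; left; apply/eqP; field.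
move=> t /andP[t0 t1].
have near_t : near_by x (Num.min r1 r2) (p + (t%:C * h : C) *: e_ j).
  rewrite (_ : Num.min r1 r2 = r + r); last by rewrite /r; field.
  apply: near_byD => //; rewrite normcM normc_real ger0_norm//.
  by apply: le_lt_trans hr; rewrite ler_piMl ?normc_ge0.
exists (pd j (p + (t%:C * h : C) *: e_ j)); last first.
  by apply: H2; apply: near_by_le near_t; rewrite ge_min lexx orbT.
apply: (slice_cdiff hf); apply: H1; apply: near_by_le near_t.
by rewrite ge_min lexx.
Qed.

(** The increment is telescoped by changing one coordinate at a time, and each summand is an
    instance of [strong_partial]. *)
Lemma frechet_bound x : D x -> forall e : R, 0 < e ->
  exists2 r : R, 0 < r & forall h : V, (forall j, normc (h 0 j) < r) ->
    normc (f (x + h) - f x - \sum_j h 0 j * pd j x) <= e * \sum_j normc (h 0 j).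
Proof.
move=> Dx e e0.
have /choice[r rP] : forall j : 'I_N, exists r : R, 0 < r /\
    forall p (h : R[i]), near_by x r p -> normc h < r ->
    normc (f (p + (h : C) *: e_ j) - f p - h * pd j x) <= e * normc h.
  by move=> j; have [r r0 H] := strong_partial j Dx e0; exists r.
pose s := \big[Num.min/1]_j r j.
have s0 : 0 < s.
  rewrite /s; elim/big_ind : _ => [//|a b a0 b0|j _]; last exact: (rP j).1.
  by rewrite lt_min a0 b0.
have sr j : s <= r j by exact: bigmin_le.
exists s => // h hs.
(* In [y m] the first [m] coordinates have already been moved. *)
pose y (m : nat) : V := \row_j (x 0 j + (if (j < m)%N then h 0 j else 0)).
have y0 : y 0%N = x by apply/rowP => j; rewrite mxE addr0.
have yN : y N = x + h by apply/rowP => j; rewrite !mxE ltn_ord.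
have yS (j : 'I_N) : y j.+1 = y j + h 0 j *: e_ j.
  apply/rowP => i; rewrite !mxE eqxx /= -addrA; congr (_ + _).
  rewrite /GRing.scale /= ltnS; have [->|ij] := eqVneq i j.
    by rewrite leqnn ltnn mulr1 add0r.
  by rewrite leq_eqVlt (inj_eq val_inj) (negbTE ij) mulr0 addr0.
have ynear m : near_by x s (y m).
  move=> j; rewrite mxE (addrC (x 0 j)) addrK; case: ifP => // _.
  by rewrite normc0.
have -> : f (x + h) - f x = \sum_(j < N) (f (y j.+1) - f (y j)).
  by rewrite -yN -[in LHS]y0 -(big_mkord xpredT (fun j => f (y j.+1) - f (y j)))
    telescope_sumr.
rewrite -sumrB mulr_sumr.
have sumle (I : finType) (F : I -> R[i]) (G : I -> R) :
    (forall i, normc (F i) <= G i) -> normc (\sum_i F i) <= \sum_i G i.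
  move=> FG; elim/big_ind2 : _ => //; first by rewrite normc0.
  by move=> a b c d ab cd; apply: le_trans (normcD_le _ _) _; exact: lerD.
apply: sumle => j; rewrite yS; apply: (rP j).2; last exact: lt_le_trans (hs j) _.
exact: near_by_le (ynear j).
Qed.

(** Passes from separate complex differentiability to Fréchet differentiability, so that chain and
    product rules become available. *)
Lemma holomorphic_differentiable x : D x -> differentiable f x.
Proof.
move=> Dx.
pose df (v : V) : C := \sum_j v 0 j * pd j x.
have df_lin : linear df.
  move=> a u v; rewrite /df scaler_sumr -big_split /=; apply: eq_bigr => j _.
  by rewrite !mxE mulrDl /GRing.scale /= mulrA.
pose L : {linear V -> C} := HB.pack df (GRing.isLinear.Build _ _ _ _ df df_lin).
have Lc : continuous L.
  move=> v; apply: (@continuous_comp _ _ _ id L); first exact: cvg_id.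
  apply: differentiable_continuous.
  have -> : (L : V -> C) = \sum_j ((fun v : V => v 0 j : C) * cst (pd j x : C)).
    by apply/funext => u; rewrite fct_sumE.
  apply: differentiable_sum => j.
  by apply: differentiableM => //; exact: differentiable_coord.
have Lo : (f \o shift x : V -> C) = (cst (f x) + (L : V -> C) : V -> C) +o_ (0 : V) (id : V -> V).
  apply/eqaddoP => e e0; have [a a0 ->] := ltc0_real e0.
  (* The sum of the moduli of the coordinates of [h] is at most [N] times the norm of [h]; the extra
     1 covers [N = 0]. *)
  have a'0 : 0 < a / (N%:R + 1) by rewrite divr_gt0// ltr_wpDl.
  have [r r0 rH] := frechet_bound Dx a'0.
  apply/nbhs_rVP; exists r => // h hr.
  have {}hr j : normc (h 0 j) < r by have := hr j; rewrite mxE subr0.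
  have le := rH h hr.
  have hj j : `|h 0 j| <= `|h|.
    rewrite [leRHS]/Num.norm /= mx_normE -[leLHS]nngE num_le.
    exact: (le_bigmax _ (fun i : 'I_1 * 'I_N => `|h i.1 i.2|%:nng) (0, j)).
  have hN : (\sum_j normc (h 0 j))%:C <= `|h| * N%:R.
    rewrite rmorph_sum /= mulr_natr -[N in _ *+ N]card_ord -sumr_const.
    by apply: ler_sum => j _; exact: hj.
  have E : (f \o shift x - (cst (f x) + L)) h = f (x + h) - f x - df h.
    by rewrite fctE /= (addrC x) opprD addrA.
  rewrite E normcE_norm; apply: (@le_trans _ _ (a / (N%:R + 1) * \sum_j normc (h 0 j))%:C).
    by rewrite lecR.
  rewrite rmorphM /=; apply: le_trans (ler_wpM2l _ hN) _; first by rewrite lecR ltW.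
  rewrite mulrCA mulrC ler_wpM2r//.
  rewrite -(rmorph_nat (real_complex R)) -rmorphM lecR mulrAC -mulrA.
  by rewrite ler_piMr ?(ltW a0)// ler_pdivrMr ?ltr_wpDl// mul1r lerDl.
apply/diff_locallyP; rewrite (diff_unique Lc Lo); split; [exact: Lc|exact: Lo].
Qed.


End Frechet.

#[local] Opaque cexp.
Section PartialHolomorphic.
Variables (R : realType) (N : nat).
Local Notation C := (R[i]^o).
Local Notation V := 'rV[C]_N.
Local Notation mu := (@lebesgue_measure R).
Local Notation e_ j := (delta_mx 0 j : V).

Variables (D : set V) (f : V -> C).
Hypotheses (oD : open D) (hf : holomorphic_on D f).

Local Notation pd j := (fun x : V => 'D_(e_ j) f x : R[i]).

Lemma partial_continuous_at x (j : 'I_N) : D x -> {for x, continuous (pd j : V -> C)}.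
Proof.
move=> Dx; apply/continuous_rVP => e e0; have e20 : 0 < e / 2 by lra.
have [d d0 dH] := partial_continuous oD hf j Dx e20.
exists d; first exact: d0.
by move=> y yd; apply: le_lt_trans (dH y yd) _; lra.
Qed.

Lemma slice_continuous (x v : V) : continuous (fun z : C => x + z *: v : V).
Proof.
move=> z; apply: (@continuousD _ _ _ (fun _ => x) (fun z : C => z *: v)).
  exact: cst_continuous.
exact: scalel_continuous.
Qed.

Lemma partial_increment p (i : 'I_N) (h : R[i]) (M : R) :
  (forall t : R, 0 <= t <= 1 -> D (p + (t%:C * h : C) *: e_ i) /\
     normc (pd i (p + (t%:C * h : C) *: e_ i) - pd i p) <= M) ->
  normc (f (p + (h : C) *: e_ i) - f p - h * pd i p) <= 2 * (M * normc h).
Proof.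
move=> H; have := @segment_increment R (fun s => f (p + (s : C) *: e_ i)) h (pd i p) M.
rewrite scale0r addr0; apply=> t t01; have [Dt tM] := H t t01.
exists (pd i (p + (t%:C * h : C) *: e_ i)); last exact: tM.
exact: (slice_cdiff hf).
Qed.

(** The circle formula for the [j]-th partial derivative is differentiated in direction [i] under
    the integral. The candidate derivative [A + iB] is the circle mean of the difference quotients
    [G] of the [i]-th partial derivative. *)
Lemma partial_holomorphic (j : 'I_N) : holomorphic_on D (fun x => 'D_(e_ j) f x).
Proof.
split=> [x Dx|x Dx i]; first exact: partial_continuous_at.
have [r r0 rD] := open_near_by oD Dx.
pose s := r / 3; have s0 : 0 < s by rewrite /s; lra.
have cs t : normc (circ_pt s t) = s by rewrite normc_circ_pt// ltW.
have Dc y t : near_by x s y -> normc t <= s -> D (y + t *: e_ j).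
  move=> ys ts; apply: rD.
  have -> : r = s + (2 * s) by rewrite /s; field.
  by apply: near_byD => //; lra.
have xs := near_by_refl x s0.
pose G t : R[i] := (pd i (x + circ_pt s t *: e_ j) - pd i x) / circ_pt s t.
have Gc t : {for t, continuous (G : R -> C)}.
  apply: (@continuous_comp _ _ _ (circ_pt s)
    (fun z : C => (pd i (x + z *: e_ j) - pd i x) / z : C)).
    exact: circ_pt_continuous.
  have c0 : circ_pt s t != 0 by rewrite -normc_eq0 cs gt_eqF.
  apply: (@continuousM _ _ (fun z : C => pd i (x + z *: e_ j) - pd i x : C)
    (fun z : C => z^-1 : C)); last first.
    by apply: differentiable_continuous; exact: differentiableV.
  apply: (@continuousB _ _ _ (fun z : C => pd i (x + z *: e_ j) : C)
    (fun z : C => pd i x : C)); last exact: cst_continuous.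
  apply: (@continuous_comp _ _ _ (fun z : C => x + z *: e_ j) (pd i : V -> C)).
    exact: slice_continuous.
  by apply: partial_continuous_at; apply: Dc; rewrite ?cs.
have Rc : cont_on (fun t => complex.Re (G t)) 0 (2 * pi).
  move=> t _; apply: (@continuous_comp _ _ _ (G : R -> C) (@complex.Re R : C -> R)).
    exact: Gc.
  exact: Re_continuous.
have Ic : cont_on (fun t => complex.Im (G t)) 0 (2 * pi).
  move=> t _; apply: (@continuous_comp _ _ _ (G : R -> C) (@complex.Im R : C -> R)).
    exact: Gc.
  exact: Im_continuous.
have Ri := cont_on_integrable Rc; have Ii := cont_on_integrable Ic.
have pi0 : 2 * pi != 0 :> R by rewrite mulf_neq0 ?pnatr_eq0// gt_eqF// pi_gt0.
pose A := (\int[mu]_(t in `[0, 2 * pi]) complex.Re (G t)) / (2 * pi).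
pose B := (\int[mu]_(t in `[0, 2 * pi]) complex.Im (G t)) / (2 * pi).
have AE : \int[mu]_(t in `[0, 2 * pi]) complex.Re (G t) = A * (2 * pi).
  by rewrite /A divfK.
have BE : \int[mu]_(t in `[0, 2 * pi]) complex.Im (G t) = B * (2 * pi).
  by rewrite /B divfK.
clearbody A B.
have lin (a b : R) : cont_on (fun t => a * complex.Re (G t) + b * complex.Im (G t)) 0 (2 * pi)
    /\ \int[mu]_(t in `[0, 2 * pi]) (a * complex.Re (G t) + b * complex.Im (G t)) =
       (a * A + b * B) * (2 * pi).
  have mulc (c : R) (u : R -> R) : cont_on u 0 (2 * pi) -> cont_on (fun t => c * u t) 0 (2 * pi).
    move=> uc t t02; apply: (@continuousM _ _ (fun=> c) u); last exact: uc.
    exact: cst_continuous.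
  have c1 := mulc a _ Rc; have c2 := mulc b _ Ic; split.
    move=> t t02; apply: (@continuousD _ _ _ (fun t => a * complex.Re (G t))
      (fun t => b * complex.Im (G t))); [exact: c1|exact: c2].
  rewrite RintegralD//; [|exact: cont_on_integrable c1|exact: cont_on_integrable c2].
  rewrite (RintegralZl _ _ Ri)// (RintegralZl _ _ Ii)// AE BE; ring.
have [] := @cdiff_derivable R _ (fun x => 'D_(e_ j) f x) x (e_ i) (A +i* B); last by [].
(* Two increments enter, each estimated with the factor 2 of [partial_increment], against the target
   [e / 2 * s]. *)
move=> e e0; pose ep := e * s / 8; have ep0 : 0 < ep by rewrite /ep divr_gt0// mulr_gt0.
have [d1 d10 H1] : exists2 d : R, 0 < d & forall y, near_by x d y ->
    forall t, 0 <= t <= 2 * pi -> normc (pd i (y + circ_pt s t *: e_ j) -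
      pd i (x + circ_pt s t *: e_ j)) <= ep.
  apply: (circle_uniform_continuous (g := pd i)); last exact: ep0.
  by move=> t0; apply: (partial_continuous oD hf); apply: Dc; rewrite ?cs.
have [d2 d20 H2] := partial_continuous oD hf i Dx ep0.
have m0 : 0 < Num.min s (Num.min d1 d2) by rewrite !lt_min s0 d10.
exists (Num.min s (Num.min d1 d2)); first exact: m0.
move=> h hd; rewrite add0r scale0r addr0.
have near_t (t : R) : 0 <= t <= 1 ->
    near_by x (Num.min s (Num.min d1 d2)) (x + (t%:C * h : C) *: e_ i).
  move=> /andP[t0 t1]; apply: near_by_self; rewrite normcM normc_real ger0_norm//.
  by apply: le_lt_trans hd; rewrite ler_piMl ?normc_ge0.
have yh : near_by x (Num.min s (Num.min d1 d2)) (x + (h : C) *: e_ i).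
  exact: near_by_self.
have ys : near_by x s (x + (h : C) *: e_ i) by apply: near_by_le yh; rewrite ge_min lexx.
have qle t : 0 <= t <= 2 * pi -> normc
    ((f (x + (h : C) *: e_ i + circ_pt s t *: e_ j) - f (x + (h : C) *: e_ i)) / circ_pt s t -
     (f (x + circ_pt s t *: e_ j) - f x) / circ_pt s t - h * G t) <= e / 2 * normc h.
  move=> t02; have alg (a b c d p q u : R[i]) : (a - b) / u - (c - d) / u - h * ((p - q) / u)
      = ((a - c - h * p) - (b - d - h * q)) / u by ring.
  rewrite alg normcM normcV cs ler_pdivrMr//; apply: le_trans (normcB_le _ _) _.
  have -> : e / 2 * normc h * s = 2 * (ep * normc h) + 2 * (ep * normc h).
    by rewrite /ep; field.
  apply: lerD.
    rewrite [x + (h : C) *: _ + _]addrAC; apply: partial_increment => t' t'01.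
    have nt := near_t t' t'01; rewrite addrAC; split.
      apply: Dc; last by rewrite cs.
      by apply: near_by_le nt; rewrite ge_min lexx.
    by apply: H1 (t02); apply: near_by_le nt; rewrite !ge_min lexx orbT.
  apply: partial_increment => t' t'01; have nt := near_t t' t'01; split.
    rewrite -[_ + _]addr0 -(scale0r (e_ j)); apply: Dc; last by rewrite normc0 ltW.
    by apply: near_by_le nt; rewrite ge_min lexx.
  by apply: H2; apply: near_by_le nt; rewrite !ge_min lexx !orbT.
have [cr1 ci1 R1 I1] := partial_circle hf s0 (fun t => Dc _ t ys).
have [cr0 ci0 R0 I0] := partial_circle hf s0 (fun t => Dc x t xs).
have diffI (a b : R -> R) (A1 B1 : R) : cont_on a 0 (2 * pi) -> cont_on b 0 (2 * pi) ->
    \int[mu]_(t in `[0, 2 * pi]) a t = A1 * (2 * pi) ->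
    \int[mu]_(t in `[0, 2 * pi]) b t = B1 * (2 * pi) ->
    cont_on (fun t => a t - b t) 0 (2 * pi) /\
    \int[mu]_(t in `[0, 2 * pi]) (a t - b t) = (A1 - B1) * (2 * pi).
  move=> ac bc aA bB; split; first exact: cont_onB.
  by rewrite RintegralB//; [rewrite aA bB mulrBl|exact: cont_on_integrable..].
have [crd Rd] := diffI _ _ _ _ cr1 cr0 R1 R0.
have [cid Id] := diffI _ _ _ _ ci1 ci0 I1 I0.
apply: le_trans (normc_le_ReIm _) _.
have -> : e * normc h = e / 2 * normc h + e / 2 * normc h by field.
rewrite !ReB !ImB ReM ImM [complex.Re (A +i* B)]/= [complex.Im (A +i* B)]/=.
apply: lerD.
  have [cl El] := lin (complex.Re h) (- complex.Im h); rewrite mulNr in El.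
  apply: (mean_le crd cl Rd El) => t t02.
  by rewrite mulNr -ReM -!ReB; apply: le_trans (Re_le_normc _) _; exact: qle.
have [cl El] := lin (complex.Im h) (complex.Re h); rewrite addrC in El.
apply: (mean_le cid cl Id El) => t t02.
rewrite (addrC (complex.Im h * _)) -ImM -!ImB; apply: le_trans (Im_le_normc _) _; exact: qle.
Qed.

End PartialHolomorphic.

(** * Composition rules for holomorphic functions *)

Section HolomorphicCalculus.
Variable R : realType.
Local Notation C := (R[i]^o).

Lemma differentiable_holomorphic N (D : set 'rV[C]_N) (f : 'rV[C]_N -> C) :
  (forall x, D x -> differentiable f x) -> holomorphic_on D f.
Proof.
move=> fd; split=> x Dx; first exact/differentiable_continuous/fd.
by move=> j; apply: diff_derivable; exact: fd.
Qed.

Lemma differentiable_row N M (A : 'rV[C]_N -> 'rV[C]_M) x :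
  (forall j, differentiable (fun y => A y 0 j : C) x) -> differentiable A x.
Proof.
move=> Ad; have -> : A = \sum_(j < M) (fun y => (A y 0 j : C) *: (delta_mx 0 j : 'rV[C]_M)).
  by apply/funext => y; rewrite fct_sumE [LHS]row_sum_delta.
apply: differentiable_sum => j.
by apply: differentiableZl; exact: Ad.
Qed.

Lemma holomorphic_comp N M (D : set 'rV[C]_N) (D' : set 'rV[C]_M)
    (A : 'rV[C]_N -> 'rV[C]_M) (f : 'rV[C]_M -> C) :
  open D' -> holomorphic_on D' f -> (forall x, D x -> D' (A x)) ->
  (forall x j, D x -> differentiable (fun y => A y 0 j : C) x) ->
  holomorphic_on D (f \o A).
Proof.
move=> oD' hf DA Ad; apply: differentiable_holomorphic => x Dx.
apply: differentiable_comp; first by apply: differentiable_row => j; exact: Ad.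
by apply: (holomorphic_differentiable oD' hf); exact: DA.
Qed.

Lemma differentiable_cexp N (g : 'rV[C]_N -> C) x : differentiable g x ->
  differentiable (fun y => cexp (g y) : C) x.
Proof.
move=> gd; apply: (@differentiable_comp _ _ _ _ g (@cexp R : C -> C)) => //.
by apply/differentiable_cdiff; eexists; exact: cdiff_cexp.
Qed.

End HolomorphicCalculus.

(* [rint] integrates functions of whole sequences one coordinate at a time, so the
   relevant sigma-algebra is the one generated by the coordinates. *)
Definition coord_sets (R : realType) : set (set (nat -> R)) :=
  [set A | exists i (B : set (measurableTypeR R)), measurable B /\ A = (fun s => s i) @^-1` B].
Arguments coord_sets R : clear implicits.

Notation seqR R := (g_sigma_algebraType (coord_sets R)).

(** * Iterated Lebesgue integrals *)
Section IteratedIntegral.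
Variable R : realType.
Local Open Scope ereal_scope.
Local Notation mu := (@lebesgue_measure R).
Local Notation RT := (measurableTypeR R).

Definition upd (s : nat -> R) (d : nat) (x : R) : nat -> R :=
  fun i => if i == d then x else s i.

Lemma measurable_coord i : measurable_fun setT ((fun s => s i) : seqR R -> RT).
Proof.
move=> _ B mB; rewrite setTI; apply: sub_sigma_algebra.
by exists i, B.
Qed.

Lemma measurable_seqR d (T : measurableType d) (f : T -> seqR R) :
  (forall i, measurable_fun setT ((fun t => f t i) : T -> RT)) -> measurable_fun setT f.
Proof.
move=> mf; refine (@measurability _ _ T (seqR R) setT f (coord_sets R) erefl _).
move=> _ [_ [i [B [mB ->]]] <-]; rewrite setTI -comp_preimage.
by have := mf i measurableT _ mB; rewrite setTI.
Qed.

Lemma measurable_upd e (T : measurableType e) (f : T -> seqR R) (x : T -> RT) d :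
  measurable_fun setT f -> measurable_fun setT x ->
  measurable_fun setT ((fun t => upd (f t) d (x t)) : T -> seqR R).
Proof.
move=> mf mx; apply: measurable_seqR => i; rewrite /upd.
case: (i == d) => //; apply: (measurableT_comp (measurable_coord i) mf).
Qed.

Lemma measurable_integral e (T : measurableType e) (h : T * RT -> \bar R) :
  measurable_fun setT h -> measurable_fun setT (fun t => \int[mu]_x h (t, x)).
Proof.
move=> mh.
have -> : (fun t => \int[mu]_x h (t, x)) = (fun t =>
    \int[mu]_x (h ^\+) (t, x) - \int[mu]_x (h ^\-) (t, x)).
  apply/funext => t; rewrite integralE; congr (_ - _); apply: eq_integral => x _.
    by rewrite !funeposE.
  by rewrite !funenegE.
apply: emeasurable_funB.
  apply: (measurable_fun_fubini_tonelli_F (m2 := mu) (h ^\+)).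
    exact: measurable_funepos.
  by [].
apply: (measurable_fun_fubini_tonelli_F (m2 := mu) (h ^\-)).
  exact: measurable_funeneg.
by [].
Qed.

(** The parameter space [T] is arbitrary so that the induction can absorb the outermost integration
    variable into it. *)
Lemma measurable_rint n e (T : measurableType e) (F : T -> seqR R -> \bar R) :
  measurable_fun setT (fun p : T * seqR R => F p.1 p.2) ->
  measurable_fun setT (fun t => rint n (F t)).
Proof.
elim: n e T F => [|n IH] e T F mF /=.
  apply: (measurableT_comp mF (g := fun t => (t, (fun=> 0%R) : seqR R))).
  exact: measurable_fun_pair.
apply: (@measurable_integral _ _ (fun p => rint n (fun s => F p.1 (upd s n p.2)))).
apply: IH.
apply: (measurableT_comp mF (g := fun p : (T * RT) * seqR R =>
  (p.1.1, upd p.2 n p.1.2 : seqR R))).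
apply: measurable_fun_pair; first by apply: measurableT_comp.
by apply: measurable_upd => //; exact: measurableT_comp.
Qed.

Local Notation mseq := (fun G : seqR R -> \bar R => measurable_fun setT G).

Lemma mseq_upd n G x : mseq G -> mseq (fun s => G (upd s n x)).
Proof. by move=> mG; apply: (measurableT_comp mG); exact: measurable_upd. Qed.

Lemma measurable_rint_upd n G : mseq G ->
  measurable_fun setT (fun x : RT => rint n (fun s => G (upd s n x))).
Proof.
move=> mG; apply: measurable_rint.
by apply: (measurableT_comp mG); exact: measurable_upd.
Qed.

Lemma rint_ge0 n G : (forall s, 0 <= G s) -> 0 <= rint n G :> \bar R.
Proof. by elim: n G => [|n IH] G G0 //=; apply: integral_ge0 => x _; apply: IH. Qed.

Lemma le_rint n G1 G2 : mseq G1 -> mseq G2 -> (forall s, 0 <= G1 s) ->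
  (forall s, G1 s <= G2 s) -> rint n G1 <= rint n G2.
Proof.
elim: n G1 G2 => [|n IH] G1 G2 m1 m2 G0 G12 //=; apply: ge0_le_integral => //.
- by move=> x _; exact: rint_ge0.
- exact: measurable_rint_upd.
- exact: measurable_rint_upd.
- by move=> x _; apply: IH => //; exact: mseq_upd.
Qed.

Lemma rintZ n (a : R) G : (0 <= a)%R -> mseq G -> (forall s, 0 <= G s) ->
  rint n (fun s => a%:E * G s) = a%:E * rint n G.
Proof.
move=> a0; elim: n G => [|n IH] G mG G0 //=.
rewrite -ge0_integralZl//; last 2 first.
- exact: measurable_rint_upd.
- by move=> x _; exact: rint_ge0.
by apply: eq_integral => x _; apply: IH => //; exact: mseq_upd.
Qed.

Lemma ge0_rintD n G1 G2 : mseq G1 -> mseq G2 -> (forall s, 0 <= G1 s) ->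
  (forall s, 0 <= G2 s) -> rint n (fun s => G1 s + G2 s) = rint n G1 + rint n G2.
Proof.
elim: n G1 G2 => [|n IH] G1 G2 m1 m2 G10 G20 //=.
rewrite -ge0_integralD//; last 4 first.
- by move=> x _; exact: rint_ge0.
- exact: measurable_rint_upd.
- by move=> x _; exact: rint_ge0.
- exact: measurable_rint_upd.
by apply: eq_integral => x _; apply: IH => //; exact: mseq_upd.
Qed.

(** [H] describes an exceptional set, namely where it is infinite. At every level, finiteness of the
    integral makes the inner integral of [H] finite for almost every value of the coordinate, and
    the induction hypothesis applies there. *)
Lemma rint_ae n H : mseq H -> (forall s, 0 <= H s) -> rint n H < +oo ->
  forall G1 G2, mseq G1 -> mseq G2 -> (forall s, H s < +oo -> G1 s = G2 s) ->
  rint n G1 = rint n G2.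
Proof.
elim: n H => [|n IH] H mH H0 /= Hoo G1 G2 m1 m2 G12; first exact: G12.
apply: ae_eq_integral => //; try exact: measurable_rint_upd.
have Hi : mu.-integrable setT (fun x : RT => rint n (fun s => H (upd s n x))).
  apply/integrableP; split; first exact: measurable_rint_upd.
  under eq_integral do rewrite gee0_abs ?rint_ge0//.
  exact: Hoo.
apply: filterS (integrable_ae measurableT Hi) => x fx _.
apply: (IH (fun s => H (upd s n x))); try exact: mseq_upd; [by []| |by move=> s; exact: G12].
by rewrite -ge0_fin_numE ?rint_ge0//; exact: fx.
Qed.

(** The inner integrals of the two parts may both be infinite, but only on a null set of the outer
    variable, since the iterated integral of the absolute value is finite. *)
Lemma rint_funeposneg n G : mseq G -> rint n (fun s => `|G s|) < +oo ->
  rint n G = rint n (G^\+) - rint n (G^\-).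
Proof.
elim: n G => [|n IH] G mG /= Goo; first by rewrite [in LHS](funeposneg G).
have mabs : mseq (fun s => `|G s|) by exact: measurableT_comp.
have mp : mseq (G^\+) by exact: measurable_funepos.
have mn : mseq (G^\-) by exact: measurable_funeneg.
have Hi : mu.-integrable setT (fun x : RT => rint n (fun s => `|G (upd s n x)|)).
  apply/integrableP; split; first exact: (measurable_rint_upd n mabs).
  under eq_integral do rewrite gee0_abs ?rint_ge0//.
  exact: Goo.
have le (K : seqR R -> \bar R) : mseq K -> (forall s, 0 <= K s <= `|G s|) ->
    mu.-integrable setT (fun x : RT => rint n (fun s => K (upd s n x))).
  move=> mK KG; apply: le_integrable Hi => //; first exact: measurable_rint_upd.
  move=> x _; rewrite !gee0_abs ?rint_ge0//; last 1 first.
    by move=> s; case/andP: (KG (upd s n x)).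
  apply: le_rint; [exact: mseq_upd|exact: (mseq_upd n x mabs)| |];
    by move=> s; case/andP: (KG (upd s n x)).
have ip := le _ mp; have in' := le _ mn.
rewrite -integralB//; last 2 first.
- apply: ip => s; rewrite funepos_ge0 -[`|G s|]/((abse \o G) s) fune_abse /=.
  by rewrite leeDl// funeneg_ge0.
- apply: in' => s; rewrite funeneg_ge0 -[`|G s|]/((abse \o G) s) fune_abse /=.
  by rewrite leeDr// funepos_ge0.
apply: ae_eq_integral => //; first exact: measurable_rint_upd.
  by apply: emeasurable_funB; exact: measurable_rint_upd.
apply: filterS (integrable_ae measurableT Hi) => x fx _ /=.
have := IH (G \o (fun s : seqR R => upd s n x : seqR R)) (mseq_upd n x mG).
rewrite funepos_comp funeneg_comp; apply.
by rewrite -ge0_fin_numE ?rint_ge0//; exact: fx.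
Qed.

End IteratedIntegral.

Section Affine.
Variable R : realType.
Local Open Scope ereal_scope.
Local Notation mu := (@lebesgue_measure R).
Local Notation RT := (measurableTypeR R).

Lemma measurable_affine (a b : R) : measurable_fun setT ((fun x => a * x + b)%R : RT -> RT).
Proof.
by apply: measurable_funD => //; apply: measurable_funM.
Qed.

Lemma affine_preimage_measure (a b x y : R) : (a != 0)%R ->
  `|a|%:E * mu ((fun t => a * t + b)%R @^-1` `]x, y]) = mu `]x, y].
Proof.
move=> a0; have [apos|aneg] := ltrP 0%R a.
  have -> : (fun t => a * t + b)%R @^-1` `]x, y] = `]((x - b) / a)%R, ((y - b) / a)%R]%classic.
    apply/seteqP; split => t /=; rewrite !in_itv /= ltr_pdivrMr// ler_pdivlMr//;
      by rewrite ltrBlDr lerBrDr mulrC.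
  rewrite !lebesgue_measure_itv /= !lte_fin ltr_pM2r ?invr_gt0// ltrD2r.
  case: ifPn => // xy; last by rewrite mule0.
  rewrite gtr0_norm// -EFinD -EFinM; congr _%:E; field; exact: lt0r_neq0.
have {}aneg : (a < 0)%R by rewrite lt_neqAle a0.
have -> : (fun t => a * t + b)%R @^-1` `]x, y] = `[((y - b) / a)%R, ((x - b) / a)%R[%classic.
  apply/seteqP; split => t /=; rewrite !in_itv /= ler_ndivrMr// ltr_ndivlMr//;
    by rewrite ltrBlDr lerBrDr mulrC andbC.
rewrite !lebesgue_measure_itv /= !lte_fin ltr_nM2r ?invr_lt0// ltrD2r.
case: ifPn => // xy; last by rewrite mule0.
rewrite ltr0_norm// -EFinD -EFinM; congr _%:E; field; exact: ltr0_neq0.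
Qed.

(** Lebesgue measure is determined by its values on half-open intervals, so [k * nu] is Lebesgue
    measure. *)
Lemma ge0_integral_scaled (nu : {measure set RT -> \bar R}) (k : {nonneg R})
    (f : RT -> \bar R) :
  (forall x y : R, k%:num%:E * nu `]x, y]%classic = mu `]x, y]%classic) ->
  measurable_fun setT f -> (forall x, 0 <= f x) ->
  \int[mu]_x f x = k%:num%:E * \int[nu]_x f x.
Proof.
move=> knu mf f0; rewrite -ge0_integral_mscale//.
apply: eq_measure_integral => A mA _.
apply: lebesgue_measure_unique => // _ [[x y]] _ <-.
by rewrite /mscale /=; apply/esym; exact: knu.
Qed.

Lemma ge0_integral_affine (a b : R) (f : RT -> \bar R) : (a != 0)%R ->
  measurable_fun setT f -> (forall x, 0 <= f x) ->
  \int[mu]_x f (a * x + b)%R = `|a|^-1%:E * \int[mu]_x f x.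
Proof.
move=> a0 mf f0; have na : (0 <= `|a|)%R by [].
have key := ge0_integral_pushforward (measurable_affine a b) mu measurableT mf
  (fun x _ => f0 x).
rewrite preimage_setT in key; apply: (eq_trans (esym key)).
set J := (X in X = _); have -> : \int[mu]_x f x = `|a|%:E * J.
  rewrite /J; apply: (@ge0_integral_scaled _ (NngNum na) f _ mf f0).
    exact: measurable_affine.
  by move=> mphi x y; exact: (affine_preimage_measure b x y a0).
by rewrite muleA -EFinM mulVf ?normr_eq0// mul1e.
Qed.

Lemma fubini_tonelliT (F : RT * RT -> \bar R) : measurable_fun setT F ->
  (forall p, 0 <= F p) ->
  \int[mu]_x \int[mu]_y F (x, y) = \int[mu]_y \int[mu]_x F (x, y).
Proof. by move=> mF F0; exact: (fubini_tonelli (m1 := mu) (m2 := mu) F). Qed.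

(* multiplication by [a + ib], [a != 0], is a composition of two shears and two
   dilations of the coordinate axes *)
Lemma ge0_integral_complexM_Re (a b p q : R) (F : RT * RT -> \bar R) :
  (a != 0)%R -> measurable_fun setT F -> (forall p, 0 <= F p) ->
  \int[mu]_y \int[mu]_x F (a * x - b * y + p, a * y + b * x + q)%R =
  (a ^+ 2 + b ^+ 2)^-1%:E * \int[mu]_y \int[mu]_x F (x, y).
Proof.
move=> a0 mF F0.
(* The dilation factors of the two axes are [a] and [c]; their product is the Jacobian
   [a^2 + b^2]. *)
pose c := (a + b ^+ 2 / a)%R.
have cE : (c = (a ^+ 2 + b ^+ 2) / a)%R by rewrite /c; field.
have n0 : (0 < a ^+ 2 + b ^+ 2)%R by rewrite ltr_wpDr ?sqr_ge0// exprn_even_gt0.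
have c0 : (c != 0)%R by rewrite cE mulf_neq0 ?invr_eq0// gt_eqF.
pose r := (q - b / a * p)%R.
have mG : measurable_fun setT (fun t : RT * RT => F (t.1, b / a * t.1 + (c * t.2 + r))%R).
  apply: (measurableT_comp mF (g := fun t : RT * RT =>
    (t.1, b / a * t.1 + (c * t.2 + r))%R : RT * RT)).
  apply: measurable_fun_pair => //; apply: measurable_funD.
    by apply: measurable_funM.
  by apply: measurable_funD => //; apply: measurable_funM.
have E1 y : \int[mu]_x F (a * x - b * y + p, a * y + b * x + q)%R =
    `|a|^-1%:E * \int[mu]_x F (x, b / a * x + (c * y + r))%R.
  rewrite -(@ge0_integral_affine a (p - b * y) (fun x => F (x, b / a * x + (c * y + r))%R))//.
    by apply: eq_integral => x _; congr (F (_, _)); rewrite /c /r; [ring|field].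
  exact: (measurableT_comp mG (pair2_measurable y)).
under eq_integral do rewrite E1.
have mGy : measurable_fun setT (fun y : RT => \int[mu]_x F (x, b / a * x + (c * y + r))%R).
  apply: (@measurable_integral R _ RT (fun t : RT * RT => F (t.2, b / a * t.2 + (c * t.1 + r))%R)).
  exact: (measurableT_comp mG (@measurable_swap _ _ RT RT)).
have Gy0 y : setT y -> 0 <= \int[mu]_x F (x, b / a * x + (c * y + r))%R.
  by move=> _; apply: integral_ge0.
have ia0 : 0 <= `|a|^-1%:E by rewrite lee_fin invr_ge0.
rewrite (ge0_integralZl mu measurableT mGy Gy0 ia0).
rewrite -(fubini_tonelliT mG (fun t => F0 _)).
have E2 x : \int[mu]_y F (x, b / a * x + (c * y + r))%R =
    `|c|^-1%:E * \int[mu]_y F (x, y).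
  rewrite -(@ge0_integral_affine c (b / a * x + r) (fun y => F (x, y)))//.
    by apply: eq_integral => y _; congr (F (_, _)); ring.
  exact: (measurableT_comp mF (pair1_measurable x)).
under eq_integral do rewrite E2.
rewrite ge0_integralZl//; first last.
- by move=> x _; apply: integral_ge0.
- exact: (@measurable_integral R _ RT F).
rewrite muleA -EFinM -invfM -normrM (fubini_tonelliT mF)//.
by rewrite cE mulrC divfK// gtr0_norm.
Qed.

(** In the remaining case [a = 0], multiplication by [ib] exchanges the axes and dilates each of
    them by [b] up to sign. *)
Lemma ge0_integral_complexM (a b p q : R) (F : RT * RT -> \bar R) :
  (a ^+ 2 + b ^+ 2 != 0)%R -> measurable_fun setT F -> (forall p, 0 <= F p) ->
  \int[mu]_y \int[mu]_x F (a * x - b * y + p, a * y + b * x + q)%R =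
  (a ^+ 2 + b ^+ 2)^-1%:E * \int[mu]_y \int[mu]_x F (x, y).
Proof.
move=> ab0 mF F0; have [a0|] := eqVneq a 0%R; last first.
  by move=> a0; exact: ge0_integral_complexM_Re.
have b0 : (b != 0)%R by move: ab0; rewrite a0 expr0n add0r expf_eq0.
pose G (t : RT * RT) := F (- b * t.2 + p, b * t.1 + q)%R.
have mG : measurable_fun setT G.
  apply: (measurableT_comp mF (g := fun t : RT * RT => (- b * t.2 + p, b * t.1 + q)%R : RT * RT)).
  by apply: measurable_fun_pair; apply: measurable_funD => //; apply: measurable_funM.
transitivity (\int[mu]_y \int[mu]_x G (x, y)).
  apply: eq_integral => y _; apply: eq_integral => x _.
  by rewrite /G /=; congr (F (_, _)); rewrite a0; ring.
have E1 y : \int[mu]_x G (x, y) = `|b|^-1%:E * \int[mu]_x F (- b * y + p, x)%R.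
  rewrite -(@ge0_integral_affine b q (fun x => F (- b * y + p, x)%R))//.
  exact: (measurableT_comp mF (pair1_measurable _)).
under eq_integral do rewrite E1.
have mH : measurable_fun setT (fun z : RT => \int[mu]_x F (z, x)).
  exact: (@measurable_integral R _ RT F).
rewrite ge0_integralZl//; first last.
- by move=> y _; apply: integral_ge0.
- exact: (measurableT_comp mH (measurable_affine _ _)).
rewrite (@ge0_integral_affine (- b) p (fun z => \int[mu]_x F (z, x)))//; first last.
- by move=> y; apply: integral_ge0.
- by rewrite oppr_eq0.
rewrite muleA -EFinM -invfM normrN -normrM -expr2 a0 expr0n add0r ger0_norm ?sqr_ge0//.
by rewrite fubini_tonelliT.
Qed.

End Affine.

Section ComplexIntegral.
Variable R : realType.
Local Open Scope ereal_scope.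
Local Notation mu := (@lebesgue_measure R).
Local Notation RT := (measurableTypeR R).
Local Notation C := (R[i]^o).

Lemma rint_ext n (G1 G2 : (nat -> R) -> \bar R) :
  (forall s, (forall i, (n <= i)%N -> s i = 0%R) -> G1 s = G2 s) ->
  rint n G1 = rint n G2.
Proof.
elim: n G1 G2 => [|n IH] G1 G2 G12 /=; first exact: G12.
apply: eq_integral => x _; apply: IH => s s0; apply: G12 => i ni.
by rewrite gtn_eqF// s0// ltnW.
Qed.

Definition glue (m : nat) (s t : nat -> R) : nat -> R :=
  fun i => if (i < m)%N then s i else t (i - m)%N.

(** [rint] integrates the last coordinate outermost, so splitting off the last [d] coordinates
    merely regroups the definition. It is an identity for every [G], and [cint_split] inherits
    this. *)
Lemma rint_add m d G :
  rint (m + d) G = rint d (fun t => rint m (fun s => G (glue m s t))) :> \bar R.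
Proof.
elim: d G => [|d IH] G.
  rewrite addn0 /=; apply: rint_ext => s s0; congr G; apply/funext => i.
  by rewrite /glue; case: ltnP => // /s0.
rewrite addnS /=; apply: eq_integral => x _; rewrite IH.
congr rint; apply/funext => t; congr rint; apply/funext => s; congr G.
apply/funext => i; rewrite /glue; case: ltnP => im.
  by rewrite ltn_eqF// (leq_trans im)// leq_addr.
by rewrite -(eqn_add2l m (i - m)) subnKC.
Qed.

Lemma measurable_glue m e (T : measurableType e) (f g : T -> seqR R) :
  measurable_fun setT f -> measurable_fun setT g ->
  measurable_fun setT ((fun t => glue m (f t) (g t)) : T -> seqR R).
Proof.
move=> mf mg; apply: measurable_seqR => i; rewrite /glue; case: (i < m)%N.
  exact: (measurableT_comp (measurable_coord i) mf).
exact: (measurableT_comp (measurable_coord _) mg).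
Qed.

(* the map [z_j |-> c_j z_j + b_j] for [j < n], on real coordinates *)
Definition affine_coords n (c b : nat -> R[i]) (s : nat -> R) : nat -> R :=
  fun i => let z := (c i./2 * (s (2 * i./2)%N +i* s (2 * i./2).+1) + b i./2)%R in
  if (i < 2 * n)%N then if odd i then complex.Im z else complex.Re z else 0%R.

Lemma measurable_affine_coords n c b :
  measurable_fun setT (affine_coords n c b : seqR R -> seqR R).
Proof.
apply: measurable_seqR => i; rewrite /affine_coords.
have mc j : measurable_fun setT ((fun s : seqR R => s j) : seqR R -> RT).
  exact: measurable_coord.
case: (i < 2 * n)%N => //; case: (odd i).
  apply: (eq_measurable_fun (fun s : seqR R => complex.Re (c i./2) * s (2 * i./2).+1 +
    complex.Im (c i./2) * s (2 * i./2)%N + complex.Im (b i./2))%R).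
    by move=> s _; rewrite ImD ImM.
  apply: measurable_funD => //; apply: measurable_funD; apply: measurable_funM => //;
    exact: mc.
apply: (eq_measurable_fun (fun s : seqR R => complex.Re (c i./2) * s (2 * i./2)%N -
    complex.Im (c i./2) * s (2 * i./2).+1 + complex.Re (b i./2))%R).
  by move=> s _; rewrite ReD ReM.
apply: measurable_funD => //; apply: measurable_funB; apply: measurable_funM => //;
  exact: mc.
Qed.

Lemma affine_coords_upd c b n s x y :
  affine_coords n.+1 c b (upd (upd s (2 * n) x) (2 * n).+1 y) =
  upd (upd (affine_coords n c b s) (2 * n)
    (complex.Re (c n) * x - complex.Im (c n) * y + complex.Re (b n))%R) (2 * n).+1
    (complex.Re (c n) * y + complex.Im (c n) * x + complex.Im (b n))%R.
Proof.
apply/funext => i; rewrite /affine_coords.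
have [in_|ni] := eqVneq i./2 n.
  rewrite in_ /upd ltn_eqF// eqxx eqxx; have := odd_double_half i; rewrite in_.
  case: (odd i) => /= <-; rewrite -mul2n ?add1n ?add0n mulnS.
    by rewrite !add2n leqnn eqxx ImD ImM.
  by rewrite !add2n ltnS leqnSn ltn_eqF// eqxx ReD ReM.
have n1 : (2 * i./2 == 2 * n)%N = false by rewrite eqn_pmul2l// (negbTE ni).
have n2 : (2 * i./2 == (2 * n).+1)%N = false.
  by apply/eqP => /(congr1 odd); rewrite /= !oddM.
have n3 : ((2 * i./2).+1 == 2 * n)%N = false.
  by apply/eqP => /(congr1 odd); rewrite /= !oddM.
have n4 : ((2 * i./2).+1 == (2 * n).+1)%N = false by rewrite eqSS.
have n5 : (i == 2 * n)%N = false.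
  by apply/eqP => ie; move: ni; rewrite ie mul2n doubleK eqxx.
have n6 : (i == (2 * n).+1)%N = false.
  by apply/eqP => ie; move: ni; rewrite ie mul2n /= uphalf_double eqxx.
rewrite /upd n1 n2 n3 n4 n5 n6 mulnS !add2n !ltnS.
by rewrite leq_eqVlt n6 /= ltnS leq_eqVlt n5.
Qed.

(** Each induction step peels off the real coordinates [2n] and [2n + 1], the two outermost ones,
    and applies the planar substitution to them. *)
Lemma ge0_rint_affine c b n (G : seqR R -> \bar R) :
  (forall j, (j < n)%N -> c j != 0%R) -> measurable_fun setT G -> (forall s, 0 <= G s) ->
  rint (2 * n) (fun s => G (affine_coords n c b s)) =
  ((\prod_(j < n) csq (c j))^-1)%:E * rint (2 * n) G.
Proof.
elim: n G => [|n IH] G c0 mG G0.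
  by rewrite big_ord0 invr1 mul1e /=; congr G; apply/funext.
rewrite mulnS !add2n /= big_ord_recr /= invfM mulrC EFinM -muleA.
pose P := ((\prod_(j < n) csq (c j))^-1)%:E.
pose H (t : RT * RT) := rint (2 * n) (fun s => G (upd (upd s (2 * n) t.1) (2 * n).+1 t.2)).
have mH : measurable_fun setT H.
  apply: measurable_rint; apply: (measurableT_comp mG (g := fun p : (RT * RT) * seqR R =>
    upd (upd p.2 (2 * n) p.1.1) (2 * n).+1 p.1.2 : seqR R)).
  apply: measurable_upd; last by apply: (measurableT_comp measurable_snd).
  by apply: measurable_upd => //; apply: (measurableT_comp measurable_fst).
have H0 t : 0 <= H t by exact: rint_ge0.
have P0 : 0 <= P by rewrite lee_fin invr_ge0 prodr_ge0// => j _; exact: csq_ge0.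
have mHy : measurable_fun setT (fun y : RT => \int[mu]_x H (x, y)).
  apply: (@measurable_integral R _ RT (fun t : RT * RT => H (t.2, t.1))).
  exact: (measurableT_comp mH (@measurable_swap _ _ RT RT)).
have Hy0 y : setT y -> 0 <= \int[mu]_x H (x, y) by move=> _; apply: integral_ge0.
transitivity (\int[mu]_y \int[mu]_x (P * H ((complex.Re (c n) * x - complex.Im (c n) * y +
    complex.Re (b n))%R, (complex.Re (c n) * y + complex.Im (c n) * x + complex.Im (b n))%R))).
  apply: eq_integral => y _; apply: eq_integral => x _.
  rewrite /H /= -IH//; last 2 first.
  - by move=> j jn; apply: c0; exact: ltnW.
  - apply: (measurableT_comp mG).
    by apply: measurable_upd => //; exact: measurable_upd.
  by congr rint; apply/funext => s; rewrite affine_coords_upd.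
rewrite (@ge0_integral_complexM R _ _ _ _ (fun t => P * H t)); last 3 first.
- have := c0 n (leqnn _); rewrite -/(csq (c n)) csq_normc expf_eq0 /=.
  by rewrite normc_eq0.
- exact: measurable_funeM.
- by move=> t; apply: mule_ge0.
rewrite -/(csq (c n)); congr (_ * _).
rewrite -(ge0_integralZl mu measurableT mHy Hy0 P0); apply: eq_integral => y _.
rewrite ge0_integralZl//.
exact: (measurableT_comp mH (pair2_measurable y)).
Qed.

End ComplexIntegral.

(** * Integrals over [C^N] *)

Section CInt.
Variable R : realType.
Local Open Scope ereal_scope.
Local Notation C := (R[i]^o).

(** Measurability is stated on real coordinate sequences, where [cint] is computed; row vectors
    receive no sigma-algebra of their own. *)
Definition cmeas N (F : 'rV[C]_N -> \bar R) :=
  measurable_fun setT ((fun s => F (toC N s)) : seqR R -> \bar R).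

Definition fromC N (x : 'rV[C]_N) : nat -> R := fun i =>
  if insub i./2 is Some j then
    if odd i then complex.Im (x 0%R j) else complex.Re (x 0%R j) else 0%R.

Lemma toC_fromC N (x : 'rV[C]_N) : toC N (fromC x) = x.
Proof.
apply/rowP => j; rewrite mxE /fromC mul2n doubleK addn1 /= uphalf_double valK.
by rewrite odd_double; apply: complexP.
Qed.

Lemma toC_glue N k s t :
  toC (N + k) (glue (2 * N) s t) = row_mx (toC N s) (toC k t) :> 'rV[C]_(N + k).
Proof.
apply/rowP => j; rewrite mxE; case: (split_ordP j) => i ->.
  by rewrite row_mxEl mxE /= /glue addn1 !mul2n ltn_Sdouble ltn_double ltn_ord.
rewrite row_mxEr mxE /= /glue mulnDr -addnA !ltnNge !leq_addr /=.
by rewrite !addKn.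
Qed.

Lemma cint_split N k (F : 'rV[C]_(N + k) -> \bar R) :
  cint F = cint (fun w : 'rV[C]_k => cint (fun q : 'rV[C]_N => F (row_mx q w))).
Proof.
rewrite /cint mulnDr rint_add; congr rint; apply/funext => t; congr rint.
by apply/funext => s; rewrite toC_glue.
Qed.

Lemma cmeas_section N k (F : 'rV[C]_(N + k) -> \bar R) (w : 'rV[C]_k) :
  cmeas F -> cmeas (fun q : 'rV[C]_N => F (row_mx q w)).
Proof.
move=> mF; rewrite /cmeas -(toC_fromC w).
apply: (eq_measurable_fun (fun s : seqR R => F (toC (N + k) (glue (2 * N) s (fromC w))))).
  by move=> s _; rewrite toC_glue.
apply: (measurableT_comp mF (g := fun s : seqR R => glue (2 * N) s (fromC w) : seqR R)).
exact: measurable_glue.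
Qed.

Lemma cmeas_cint N k (F : 'rV[C]_(N + k) -> \bar R) :
  cmeas F -> cmeas (fun w : 'rV[C]_k => cint (fun q : 'rV[C]_N => F (row_mx q w))).
Proof.
move=> mF; apply: measurable_rint.
apply: (eq_measurable_fun (fun p : seqR R * seqR R => F (toC (N + k) (glue (2 * N) p.2 p.1)))).
  by move=> p _; rewrite toC_glue.
apply: (measurableT_comp mF (g := fun p : seqR R * seqR R => glue (2 * N) p.2 p.1 : seqR R)).
exact: measurable_glue.
Qed.

Definition affrow N (c b x : 'rV[C]_N) : 'rV[C]_N := \row_j (c 0 j * x 0 j + b 0 j)%R.

Let coordfun N (c : 'rV[C]_N) (j : nat) : R[i] := if insub j is Some i then c 0%R i else 0%R.

Lemma toC_affine N (c b : 'rV[C]_N) s :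
  toC N (affine_coords N (coordfun c) (coordfun b) s) = affrow c b (toC N s).
Proof.
apply/rowP => j; rewrite !mxE /affine_coords addn1 !mul2n /= !odd_double /=.
by rewrite ltn_Sdouble ltn_double ltn_ord uphalf_double doubleK /coordfun !valK;
  exact: complexP.
Qed.

Lemma ge0_cint_affine N (c b : 'rV[C]_N) (F : 'rV[C]_N -> \bar R) :
  (forall j, c 0 j != 0)%R -> cmeas F -> (forall x, 0 <= F x) ->
  cint (fun x => F (affrow c b x)) = ((\prod_j csq (c 0%R j))^-1)%:E * cint F.
Proof.
move=> c0 mF F0; rewrite /cint.
under [in LHS]eq_fun do rewrite -toC_affine.
rewrite (ge0_rint_affine (coordfun b) (G := fun s => F (toC N s)))//.
  by congr (_^-1%:E * _); apply: eq_bigr => j _; rewrite /coordfun valK.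
by move=> j jN; rewrite /coordfun; case: insubP => [i _ _|]; rewrite ?jN.
Qed.

Lemma cmeas_affine N (c b : 'rV[C]_N) (F : 'rV[C]_N -> \bar R) :
  cmeas F -> cmeas (fun x => F (affrow c b x)).
Proof.
move=> mF; apply: (eq_measurable_fun (fun s : seqR R =>
  F (toC N (affine_coords N (coordfun c) (coordfun b) s)))).
  by move=> s _; rewrite toC_affine.
apply: (measurableT_comp mF); exact: measurable_affine_coords.
Qed.

Lemma cint_ge0 N (F : 'rV[C]_N -> \bar R) : (forall x, 0 <= F x) -> 0 <= cint F.
Proof. by move=> F0; apply: rint_ge0. Qed.

Lemma le_cint N (F G : 'rV[C]_N -> \bar R) : cmeas F -> cmeas G ->
  (forall x, 0 <= F x) -> (forall x, F x <= G x) -> cint F <= cint G.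
Proof. by move=> mF mG F0 FG; apply: le_rint. Qed.

Lemma ge0_cintZ N (a : R) (F : 'rV[C]_N -> \bar R) : (0 <= a)%R -> cmeas F ->
  (forall x, 0 <= F x) -> cint (fun x => a%:E * F x) = a%:E * cint F.
Proof. by move=> a0 mF F0; exact: (rintZ (2 * N) a0 mF (fun s => F0 _)). Qed.

Lemma ge0_cintD N (F G : 'rV[C]_N -> \bar R) : cmeas F -> cmeas G ->
  (forall x, 0 <= F x) -> (forall x, 0 <= G x) ->
  cint (fun x => F x + G x) = cint F + cint G.
Proof.
by move=> mF mG F0 G0; exact: (ge0_rintD (2 * N) mF mG (fun s => F0 _) (fun s => G0 _)).
Qed.

Lemma cint_ae N (H F G : 'rV[C]_N -> \bar R) : cmeas H -> (forall x, 0 <= H x) ->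
  cint H < +oo -> cmeas F -> cmeas G -> (forall x, H x < +oo -> F x = G x) ->
  cint F = cint G.
Proof.
move=> mH H0 Hoo mF mG FG.
by apply: (rint_ae mH (fun s => H0 _) Hoo mF mG) => s; exact: FG.
Qed.

Lemma cmeas_comp N (h : \bar R -> \bar R) (F : 'rV[C]_N -> \bar R) :
  measurable_fun setT h -> cmeas F -> cmeas (h \o F).
Proof. by move=> mh mF; exact: (measurableT_comp mh mF). Qed.

Section RealValued.
Variable N : nat.
Implicit Types h g : 'rV[C]_N -> R.

Definition cintegrable h := cmeas (EFin \o h) /\ cint (fun x => `|h x|%:E) < +oo.

Definition cintR h : R := fine (cint (EFin \o h)).

Lemma cmeas_norm h : cmeas (EFin \o h) -> cmeas (fun x => `|h x|%:E).
Proof. by move=> mh; exact: (cmeas_comp (@abse_measurable R setT) mh). Qed.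

Lemma cmeas_EFin h : cmeas (EFin \o h) <->
  measurable_fun setT ((fun s => h (toC N s)) : seqR R -> measurableTypeR R).
Proof. exact: (measurable_EFinP setT (fun s : seqR R => h (toC N s))). Qed.

Lemma cint_fin h : cmeas (EFin \o h) -> (forall x, 0 <= h x)%R ->
  cint (EFin \o h) < +oo -> cint (EFin \o h) = (cintR h)%:E.
Proof.
by move=> mh h0 hoo; rewrite /cintR fineK// ge0_fin_numE// cint_ge0// => x; rewrite lee_fin.
Qed.

Definition pos_part h x : R := (Num.max (h x) 0)%R.
Definition neg_part h x : R := (Num.max (- h x) 0)%R.

Lemma pos_part_ge0 h x : (0 <= pos_part h x)%R. Proof. by rewrite le_max lexx orbT. Qed.
Lemma neg_part_ge0 h x : (0 <= neg_part h x)%R. Proof. by rewrite le_max lexx orbT. Qed.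

Lemma pos_negB h x : (pos_part h x - neg_part h x = h x)%R.
Proof.
rewrite /pos_part /neg_part.
by have [?|?] := leP (h x) 0%R; have [?|?] := leP (- h x)%R 0%R; lra.
Qed.

Lemma pos_part_le h x : (pos_part h x <= `|h x|)%R.
Proof. by rewrite /pos_part ge_max ler_norm normr_ge0. Qed.

Lemma neg_part_le h x : (neg_part h x <= `|h x|)%R.
Proof. by rewrite /neg_part ge_max ler_normr normr_ge0 lexx orbT. Qed.

Lemma cintegrable_le g h : cmeas (EFin \o h) -> cintegrable g ->
  (forall x, `|h x| <= `|g x|)%R -> cintegrable h.
Proof.
move=> mh [mg goo] hg; split=> //; apply: le_lt_trans goo; apply: le_cint.
- exact: cmeas_norm.
- exact: cmeas_norm.
- by move=> x; rewrite lee_fin.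
- by move=> x; rewrite lee_fin.
Qed.

Lemma cmeas_pos h : cmeas (EFin \o h) -> cmeas (EFin \o pos_part h).
Proof.
move/cmeas_EFin => mh; apply/cmeas_EFin.
exact: (measurable_maxr mh (measurable_cst (0%R : measurableTypeR R))).
Qed.

Lemma cmeas_neg h : cmeas (EFin \o h) -> cmeas (EFin \o neg_part h).
Proof.
move/cmeas_EFin => mh; apply/cmeas_EFin.
apply: (measurable_maxr _ (measurable_cst (0%R : measurableTypeR R))).
exact: (measurableT_comp (@oppr_measurable R setT) mh).
Qed.

Lemma cintegrable_pos h : cintegrable h -> cintegrable (pos_part h).
Proof.
move=> hi; apply: (cintegrable_le (cmeas_pos hi.1) hi) => x.
by rewrite ger0_norm ?pos_part_ge0// pos_part_le.
Qed.

Lemma cintegrable_neg h : cintegrable h -> cintegrable (neg_part h).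
Proof.
move=> hi; apply: (cintegrable_le (cmeas_neg hi.1) hi) => x.
by rewrite ger0_norm ?neg_part_ge0// neg_part_le.
Qed.

Lemma ge0_cintegrableE h : cintegrable h -> (forall x, 0 <= h x)%R ->
  cint (EFin \o h) = (cintR h)%:E.
Proof.
move=> [mh hoo] h0; apply: cint_fin => //; apply: le_lt_trans hoo; apply: le_cint => //.
- exact: cmeas_norm.
- by move=> x; rewrite lee_fin ler_norm.
Qed.

Lemma cint_posneg h : cintegrable h ->
  cint (EFin \o h) = (cintR (pos_part h) - cintR (neg_part h))%:E.
Proof.
move=> hi; have [mh hoo] := hi.
have := rint_funeposneg (n := 2 * N) (G := fun s => (h (toC N s))%:E) mh hoo.
rewrite /cint => ->.
rewrite EFinB -(ge0_cintegrableE (cintegrable_pos hi) (pos_part_ge0 h)).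
rewrite -(ge0_cintegrableE (cintegrable_neg hi) (neg_part_ge0 h)).
congr (rint _ _ - rint _ _); apply/funext => s /=.
  by rewrite funeposE /pos_part EFin_max.
by rewrite funenegE /neg_part EFin_max EFinN.
Qed.

Lemma cintegrableE h : cintegrable h -> cint (EFin \o h) = (cintR h)%:E.
Proof. by move=> hi; rewrite /cintR (cint_posneg hi). Qed.

Lemma cintR_posneg h : cintegrable h ->
  cintR h = (cintR (pos_part h) - cintR (neg_part h))%R.
Proof. by move=> hi; rewrite {1}/cintR (cint_posneg hi). Qed.

Lemma cintegrableD g h : cintegrable g -> cintegrable h ->
  cintegrable (fun x => g x + h x)%R.
Proof.
move=> [mg goo] [mh hoo]; split.
  by apply/cmeas_EFin; apply: measurable_funD; apply/cmeas_EFin.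
apply: (@le_lt_trans _ _ (cint (fun x => `|g x|%:E + `|h x|%:E))).
  apply: le_cint.
  - by apply: cmeas_norm; apply/cmeas_EFin; apply: measurable_funD; apply/cmeas_EFin.
  - by apply: emeasurable_funD; exact: cmeas_norm.
  - by move=> x; rewrite lee_fin.
  - by move=> x; rewrite -EFinD lee_fin ler_normD.
rewrite ge0_cintD; first exact: lte_add_pinfty.
- exact: cmeas_norm.
- exact: cmeas_norm.
- by move=> x; rewrite lee_fin.
- by move=> x; rewrite lee_fin.
Qed.

Lemma cintegrableZ a h : cintegrable h -> cintegrable (fun x => a * h x)%R.
Proof.
move=> [mh hoo]; split.
  by apply/cmeas_EFin; apply: measurable_funM => //; exact/cmeas_EFin.
have -> : (fun x => `|a * h x|%:E) = (fun x => `|a|%:E * `|h x|%:E).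
  by apply/funext => x; rewrite normrM EFinM.
have n0 x : 0 <= `|h x|%:E by rewrite lee_fin.
by rewrite (ge0_cintZ (normr_ge0 a) (cmeas_norm mh) n0) lte_mul_pinfty// lee_fin.
Qed.

Lemma ge0_cintRD g h : cintegrable g -> cintegrable h -> (forall x, 0 <= g x)%R ->
  (forall x, 0 <= h x)%R -> cintR (fun x => g x + h x)%R = (cintR g + cintR h)%R.
Proof.
move=> gi hi g0 h0; apply: EFin_inj; rewrite EFinD.
rewrite -(cintegrableE (cintegrableD gi hi)) -(cintegrableE gi) -(cintegrableE hi).
have g0' x : 0 <= (EFin \o g) x by rewrite lee_fin.
have h0' x : 0 <= (EFin \o h) x by rewrite lee_fin.
by rewrite -(ge0_cintD gi.1 hi.1 g0' h0').
Qed.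

(** The positive part of a sum is not the sum of the positive parts, so the nonnegative case is
    applied to a rearranged identity without subtractions. *)
Lemma cintRD g h : cintegrable g -> cintegrable h ->
  cintR (fun x => g x + h x)%R = (cintR g + cintR h)%R.
Proof.
move=> gi hi; have si := cintegrableD gi hi.
rewrite (cintR_posneg si) (cintR_posneg gi) (cintR_posneg hi).
set s := (fun x => g x + h x)%R in si *.
have ps := cintegrable_pos si; have ns := cintegrable_neg si.
have pg := cintegrable_pos gi; have ng := cintegrable_neg gi.
have ph := cintegrable_pos hi; have nh := cintegrable_neg hi.
have D0 (u v : 'rV[C]_N -> R) : (forall x, 0 <= u x)%R -> (forall x, 0 <= v x)%R ->
  forall x, (0 <= u x + v x)%R by move=> u0 v0 x; exact: addr_ge0.
have E1 := ge0_cintRD ng nh (neg_part_ge0 g) (neg_part_ge0 h).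
have E2 := ge0_cintRD ps (cintegrableD ng nh) (pos_part_ge0 s)
  (D0 _ _ (neg_part_ge0 g) (neg_part_ge0 h)).
have E3 := ge0_cintRD pg ph (pos_part_ge0 g) (pos_part_ge0 h).
have E4 := ge0_cintRD ns (cintegrableD pg ph) (neg_part_ge0 s)
  (D0 _ _ (pos_part_ge0 g) (pos_part_ge0 h)).
suff E : cintR (fun x => pos_part s x + (neg_part g x + neg_part h x))%R =
    cintR (fun x => neg_part s x + (pos_part g x + pos_part h x))%R.
  by move: E; rewrite E2 E4 E1 E3; lra.
congr cintR; apply/funext => x; have := pos_negB s x; have := pos_negB g x.
by have := pos_negB h x; rewrite /s; lra.
Qed.

Lemma cintRN h : cintegrable h -> cintR (fun x => - h x)%R = (- cintR h)%R.
Proof.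
move=> hi; have ni : cintegrable (fun x => - h x)%R.
  by have := cintegrableZ (-1) hi; under eq_fun do rewrite mulN1r.
have := cintRD hi ni; have -> : (fun x => h x + - h x)%R = (fun=> 0%R).
  by apply/funext => x; rewrite subrr.
have -> : cintR (fun=> 0%R) = 0%R; last by lra.
rewrite /cintR (_ : _ \o _ = fun x => 0%:E * `|h x|%:E); last first.
  by apply/funext => x; rewrite mul0e.
by rewrite ge0_cintZ ?mul0e//; exact: cmeas_norm hi.1.
Qed.

Lemma cintRZ a h : cintegrable h -> cintR (fun x => a * h x)%R = (a * cintR h)%R.
Proof.
move=> hi; wlog a0 : a / (0 <= a)%R => [th|].
  have [/th//|/ltW a0] := leP 0%R a.
  have na0 : (0 <= - a)%R by rewrite oppr_ge0.
  have -> : (fun x => a * h x)%R = (fun x => - (- a * h x))%R.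
    by apply/funext => x; rewrite mulNr opprK.
  by rewrite (cintRN (cintegrableZ _ hi)) th// mulNr opprK.
have ai := cintegrableZ a hi.
rewrite (cintR_posneg ai) (cintR_posneg hi) mulrBr.
have key (u : 'rV[C]_N -> R) : cintegrable u -> (forall x, 0 <= u x)%R ->
    cintR (fun x => a * u x)%R = (a * cintR u)%R.
  move=> ui u0; apply: EFin_inj; rewrite EFinM.
  have u0' x : 0 <= (EFin \o u) x by rewrite lee_fin.
  by rewrite -(cintegrableE (cintegrableZ a ui)) -(cintegrableE ui) -(ge0_cintZ a0 ui.1 u0').
rewrite -(key _ (cintegrable_pos hi) (pos_part_ge0 h)).
rewrite -(key _ (cintegrable_neg hi) (neg_part_ge0 h)).
congr (cintR _ - cintR _)%R; apply/funext => x.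
  by rewrite /pos_part maxr_pMr// mulr0.
by rewrite /neg_part maxr_pMr// mulr0 mulrN.
Qed.

Lemma cintR_affine (c b : 'rV[C]_N) h : (forall j, c 0 j != 0)%R -> cintegrable h ->
  cintegrable (fun x => h (affrow c b x)) /\
  cintR (fun x => h (affrow c b x)) = ((\prod_j csq (c 0 j))^-1 * cintR h)%R.
Proof.
move=> c0 hi.
have P0 : (0 <= (\prod_j csq (c 0 j))^-1)%R.
  by rewrite invr_ge0 prodr_ge0// => j _; exact: csq_ge0.
have int (u : 'rV[C]_N -> R) : cintegrable u -> cintegrable (fun x => u (affrow c b x)).
  move=> ui; split; first exact: (cmeas_affine c b ui.1).
  rewrite (ge0_cint_affine b c0 (cmeas_norm ui.1)); last by move=> x; rewrite lee_fin.
  by rewrite lte_mul_pinfty// ui.2.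
have key (u : 'rV[C]_N -> R) : cintegrable u -> (forall x, 0 <= u x)%R ->
    cintR (fun x => u (affrow c b x)) = ((\prod_j csq (c 0 j))^-1 * cintR u)%R.
  move=> ui u0; apply: EFin_inj; rewrite EFinM -(cintegrableE (int _ ui)) -(cintegrableE ui).
  by rewrite -(ge0_cint_affine b c0 ui.1)// => x; rewrite lee_fin.
split; first exact: int.
rewrite (cintR_posneg (int _ hi)) (cintR_posneg hi) mulrBr.
by rewrite -(key _ (cintegrable_pos hi) (pos_part_ge0 h))
  -(key _ (cintegrable_neg hi) (neg_part_ge0 h)).
Qed.

End RealValued.

End CInt.

(** * Radial integrals *)
Section Radial.
Variable R : realType.
Local Notation mu := (@lebesgue_measure R).
Local Notation RT := (measurableTypeR R).
Local Notation C := (R[i]^o).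

(* The bound is required on the whole line because this makes the class stable
   under [tail]. *)
Definition exp_dominated (M c : R) (f : R -> R) :=
  continuous f /\ forall s, `|f s| <= M * expR (- (c * s)).

Lemma is_derive_expN (c x : R) : c != 0 ->
  is_derive x 1 (fun s => - (expR (- (c * s)) / c)) (expR (- (c * x))).
Proof.
move=> c0.
have H : is_derive x 1 (fun s : R => - (c * s)) (- c).
  by apply: is_derive_eq; rewrite /GRing.scale /= mulr1.
have H1 : is_derive x 1 (expR \o (fun s : R => - (c * s))) (- c * expR (- (c * x))).
  by rewrite mulrC; exact: is_derive1_comp.
rewrite (_ : (fun s => _) = (- c^-1) \*: (expR \o (fun s : R => - (c * s)))); last first.
  by apply/funext => s /=; rewrite /GRing.scale /= mulNr mulrC.
apply: is_derive_eq; rewrite /GRing.scale /= mulrA mulrNN mulVf ?mul1r//.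
Qed.

Lemma continuous_expN (c : R) : continuous (fun s : R => expR (- (c * s))).
Proof.
move=> x; apply: continuous_comp; last exact: continuous_expR.
by apply: cvgN; apply: cvgMr; exact: cvg_id.
Qed.

Lemma cvg_expN (c : R) : 0 < c -> expR (- (c * s)) @[s --> +oo] --> (0 : R).
Proof.
move=> c0; have H : c * s @[s --> +oo] --> +oo by apply: gt0_cvgMry => //; exact: cvg_id.
exact: (cvg_comp _ (fun x : R => expR (- x)) H (@cvgr_expR R)).
Qed.

Lemma integral_expN (c a : R) : 0 < c ->
  (\int[mu]_(s in `[a, +oo[) (expR (- (c * s)))%:E = (expR (- (c * a)) / c)%:E)%E.
Proof.
move=> c0.
rewrite (@ge0_continuous_FTC2y R _ (fun s => - (expR (- (c * s)) / c)) a 0).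
- by rewrite -EFinB sub0r opprK.
- by move=> x _; exact: expR_ge0.
- exact/continuous_subspaceT/continuous_expN.
- rewrite -oppr0; apply: cvgN; rewrite -(mul0r c^-1); apply: cvgMl.
  exact: cvg_expN.
- by move=> x _; have [] := is_derive_expN x (lt0r_neq0 c0).
- apply: cvg_at_right_filter; apply: cvgN; apply: cvgMl; exact: continuous_expN.
- by move=> x _; rewrite derive1E; have [] := is_derive_expN x (lt0r_neq0 c0).
Qed.

Lemma integral_expN_le (c u : R) : 0 < c ->
  (\int[mu]_(s in `]-oo, u]) (expR (c * s))%:E = (expR (c * u) / c)%:E)%E.
Proof.
have -> : c * u = - (c * - u) by rewrite mulrN opprK.
move=> c0; rewrite -(integral_expN _ c0) [RHS]integral_mkcond.
have mf : measurable_fun setT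
    ((fun s : R => (expR (- (c * s)))%:E) \_ `[(- u)%R, +oo[ : RT -> \bar R).
  have [H _] := @measurable_restrictT _ _ RT (\bar R) `[(- u)%R, +oo[ (fun s : R => (expR (- (c * s)))%:E) (measurable_itv _); apply: H.
  apply: (measurable_EFinP _ (fun s : RT => expR (- (c * s)))).2; apply: measurable_funTS.
  by apply: continuous_measurable_fun; exact: continuous_expN.
have f0 (s : R) : (0 <= ((fun s : R => (expR (- (c * s)))%:E) \_ `[(- u)%R, +oo[) s)%E.
  by rewrite patchE; case: ifP => // _; rewrite lee_fin expR_ge0.
have := ge0_integral_affine 0 (a := -1) _ mf f0.
rewrite normrN1 invr1 mul1e oppr_eq0 oner_eq0 => <-//.
rewrite integral_mkcond; apply: eq_integral => s _; rewrite !patchE.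
rewrite addr0 mulN1r mulrN opprK; congr (if _ then _ else _).
by apply/idP/idP; rewrite !inE /= !in_itv /= ?andbT lerN2.
Qed.

Section Primitive.
Variables (M c : R) (f : R -> R).
Hypotheses (c0 : 0 < c) (fM : exp_dominated M c f).

Let fN s := f (- s).

Let continuous_fN : continuous fN.
Proof. by move=> x; apply: continuous_comp; [exact: continuousN|exact: fM.1]. Qed.

Let M0 : 0 <= M.
Proof. by have := le_trans (normr_ge0 _) (fM.2 0); rewrite mulr0 oppr0 expR0 mulr1. Qed.

Let measurable_exp u : measurable_fun (`]-oo, u] : set R) (EFin \o (fun s : R => expR (c * s))).
Proof.
apply/measurable_EFinP; apply: measurable_funTS; apply: continuous_measurable_fun.
have := @continuous_expN (- c); by under eq_fun do rewrite mulNr opprK.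
Qed.

Let integrable_exp u : mu.-integrable `]-oo, u] (EFin \o (fun s : R => M * expR (c * s))).
Proof.
have -> : EFin \o (fun s : R => M * expR (c * s)) =
    (fun s => M%:E * (EFin \o (fun s : R => expR (c * s))) s)%E.
  by apply/funext => s; rewrite /= EFinM.
have ei : mu.-integrable `]-oo, u] (EFin \o (fun s : R => expR (c * s))).
  apply/integrableP; split; first exact: measurable_exp.
  under eq_integral => s _ do rewrite /= ger0_norm ?expR_ge0//.
  by rewrite integral_expN_le// ltry.
by apply: (integrableZl _ M ei); exact: measurable_itv.
Qed.

Let integrable_fN u : mu.-integrable `]-oo, u] (EFin \o fN).
Proof.
apply: le_integrable (integrable_exp u) => //.
  by apply/measurable_EFinP; apply: measurable_funTS; exact: continuous_measurable_fun.
move=> s _ /=; rewrite lee_fin (le_trans (fM.2 _))// mulrN opprK ler_norm//.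
Qed.

(** This is the integral of [f] from [t] to infinity, reflected so that the variable endpoint is the
    upper one, as the fundamental theorem wants it. *)
Definition tail (t : R) : R := \int[mu]_(s in `]-oo, (- t)%R]) fN s.

Lemma is_derive_tail (t : R) : is_derive t 1 tail (- f t).
Proof.
have tt : - t < - t + 1 by rewrite ltrDl.
have := @continuous_FTC1 R fN (BInfty R true) (- t) (- t + 1) tt (integrable_fN _).
case; [exact: ltNyr|exact: continuous_fN|move=> D E].
have H : is_derive (- t) 1 (fun y : R => \int[mu]_(s in `]-oo, y]) fN s) (f t).
  by split=> //; rewrite -derive1E; apply: etrans E _; rewrite /fN opprK.
by have := is_derive1_comp H (is_deriveNid t 1); rewrite mulrN1.
Qed.

Lemma tail_dominated : exp_dominated (M / c) c tail.
Proof.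
split.
  move=> t; apply: differentiable_continuous; apply/derivable1_diffP.
  by have [] := is_derive_tail t.
move=> t; apply: (le_trans (le_normr_Rintegral _ (integrable_fN _))) => //.
apply: (@le_trans _ _ (\int[mu]_(s in `]-oo, (- t)%R]) (M * expR (c * s)))).
  apply: le_Rintegral => //.
  - exact: (integrable_norm (integrable_fN _)).
  - by move=> s _; rewrite (le_trans (fM.2 _))// mulrN opprK.
rewrite /Rintegral; under eq_integral do rewrite EFinM.
rewrite ge0_integralZl//; last exact: measurable_exp.
by rewrite integral_expN_le//= mulrN mulrAC mulrA.
Qed.

Lemma tail_ge0 (t : R) : (forall s, 0 <= f s) -> 0 <= tail t.
Proof. by move=> f0; apply: Rintegral_ge0 => s _; exact: f0. Qed.

End Primitive.

Lemma integralT_oneDsqrV : (\int[mu]_u ((1 + u ^+ 2)^-1)%:E = (pi : R)%:E)%E.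
Proof.
have E : [set x : R | 0 <= x] = `[0, +oo[%classic.
  by apply/seteqP; split => x /=; rewrite in_itv /= andbT.
rewrite (@ge0_symfun_integralT R (fun u => (1 + u ^+ 2)^-1)).
- by rewrite E integral0y_oneDsqr -EFinM mulrCA divff ?mulr1.
- by move=> x; rewrite invr_ge0 addr_ge0// sqr_ge0.
- exact: continuous_oneDsqrV.
- by move=> x /=; rewrite sqrrN.
Qed.

Section Polar.
Variables (M c t : R) (f : R -> R).
Hypotheses (c0 : 0 < c) (fM : exp_dominated M c f) (f0 : forall s, 0 <= f s).

Let h (y : R) : R := `|y| * f (t + y ^+ 2).

Let continuous_sq : continuous (fun y : R => t + y ^+ 2).
Proof. by move=> y; apply: cvgD; [exact: cvg_cst|exact: exprn_continuous]. Qed.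

Let continuous_h : continuous h.
Proof.
move=> y; apply: cvgM; first exact: norm_continuous.
by apply: continuous_comp; [exact: continuous_sq|exact: fM.1].
Qed.

Let is_derive_h (y : R) : 0 <= y -> is_derive y 1 (fun y => - tail f (t + y ^+ 2) / 2) (h y).
Proof.
move=> y0; have H : is_derive y 1 (fun y : R => t + y ^+ 2) (2 * y).
  apply: is_derive_eq; rewrite add0r /GRing.scale /=. by ring.
have H1 := @is_derive1_comp R (tail f) (fun y : R => t + y ^+ 2) y _ _
  (is_derive_tail c0 fM (t + y ^+ 2)) H.
rewrite (_ : (fun y => _) = (- 2^-1) \*: (tail f \o (fun y : R => t + y ^+ 2))); last first.
  by apply/funext => x; rewrite /= /GRing.scale /= mulNr mulrC mulNr.
apply: is_derive_eq; rewrite /GRing.scale /= /h ger0_norm//.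
by field.
Qed.

Let cvg_tail : - tail f (t + y ^+ 2) / 2 @[y --> +oo] --> (0 : R).
Proof.
rewrite -(mul0r 2^-1) -oppr0; apply: cvgMl; apply: cvgN.
have Q : t + y ^+ 2 @[y --> +oo] --> +oo.
  apply/cvgryPge => A; near=> y.
  have y1 : 1 <= y by near: y; apply: nbhs_pinfty_ge; rewrite num_real.
  have yA : A - t <= y by near: y; apply: nbhs_pinfty_ge; rewrite num_real.
  by rewrite -lerBlDl (le_trans yA)// expr2 ler_peMl// (le_trans ler01).
have B : M / c * expR (- (c * s)) @[s --> +oo] --> (0 : R).
  rewrite -(mulr0 (M / c)); apply: cvgMr; exact: cvg_expN.
have T : tail f s @[s --> +oo] --> (0 : R).
  apply/norm_cvg0P; apply: (squeeze_cvgr _ (cvg_cst 0) B); near=> s.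
  by rewrite normr_ge0 /=; exact: (tail_dominated c0 fM).2.
exact: (cvg_comp _ (tail f) Q T).
Unshelve. all: by end_near. Qed.

(** [h] is even and has the primitive [- tail f (t + y^2) / 2] on the half-line [y >= 0], which
    contributes half of the result. *)
Let integral_h : (\int[mu]_y (h y)%:E = (tail f t)%:E)%E.
Proof.
have E : [set x : R | 0 <= x] = `[0, +oo[%classic.
  by apply/seteqP; split => x /=; rewrite in_itv /= andbT.
have h0 y : 0 <= h y by rewrite mulr_ge0.
rewrite (ge0_symfun_integralT h0 continuous_h) => [|y]; last by rewrite /h /= normrN sqrrN.
rewrite E (ge0_continuous_FTC2y (l := 0) (F := fun y => - tail f (t + y ^+ 2) / 2)).
- by rewrite -EFinB sub0r -EFinM expr0n /= addr0 mulNr opprK mulrCA divff ?mulr1.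
- by move=> x _.
- exact: continuous_subspaceT.
- exact: cvg_tail.
- by move=> x /ltW/is_derive_h[].
- apply: cvg_at_right_filter.
  suff : {for 0, continuous (fun y : R => - tail f (t + y ^+ 2) / 2)} by [].
  apply: differentiable_continuous; apply/derivable1_diffP.
  by have [] := is_derive_h (lexx 0).
- by move=> x; rewrite in_itv /= andbT => /ltW/is_derive_h[] _ <-; rewrite derive1E.
Qed.

Let measurable_f e (T : measurableType e) (g : T -> RT) : measurable_fun setT g ->
  measurable_fun setT (fun x => (f (g x))%:E).
Proof.
move=> mg; apply/measurable_EFinP; apply: measurableT_comp mg.
exact: continuous_measurable_fun fM.1.
Qed.

Let measurable_G : measurable_fun setT (fun p : RT * RT =>
  (`|p.1| * f (t + (p.1 ^+ 2 * p.2 ^+ 2 + p.1 ^+ 2)))%:E).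
Proof.
apply/measurable_EFinP; apply: measurable_funM.
  by apply: measurableT_comp => //; exact: measurable_normr.
apply/measurable_EFinP; apply: measurable_f; apply: measurable_funD => //.
apply: measurable_funD; last by apply: measurable_funX.
by apply: measurable_funM; apply: measurable_funX.
Qed.

(* Substitute [x = y u], exchange the integrals and rescale [y] by [sqrt (1 + u^2)];
   the integral of [1 / (1 + u^2)] is [pi]. *)
Lemma polar_integral :
  (\int[mu]_y \int[mu]_x (f (t + (x ^+ 2 + y ^+ 2)))%:E = (pi * tail f t)%:E)%E.
Proof.
transitivity (\int[mu]_y \int[mu]_u (`|y| * f (t + (y ^+ 2 * u ^+ 2 + y ^+ 2)))%:E)%E.
  apply: ae_eq_integral => //.
  - apply: (@measurable_integral R _ RT (fun p : RT * RT => (f (t + (p.2 ^+ 2 + p.1 ^+ 2)))%:E)).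
    apply: measurable_f; apply: measurable_funD => //; apply: measurable_funD;
      apply: measurable_funX; [exact: measurable_snd|exact: measurable_fst].
  - apply: (@measurable_integral R _ RT (fun p : RT * RT =>
      (`|p.1| * f (t + (p.1 ^+ 2 * p.2 ^+ 2 + p.1 ^+ 2)))%:E)).
    exact: measurable_G.
  (* The substitution [x = y u] degenerates on the null set [y = 0]. *)
  exists [set 0%R]; split; [exact: measurable_set1|exact: lebesgue_measure_set1|].
  move=> y /=; apply: contra_notP => /eqP y0 _.
  have mx : measurable_fun setT (fun x : RT => (f (t + (x ^+ 2 + y ^+ 2)))%:E).
    by apply: measurable_f; apply: measurable_funD => //; apply: measurable_funD => //;
      apply: measurable_funX.
  have fx0 (x : R) : (0 <= (f (t + (x ^+ 2 + y ^+ 2)))%:E)%E by rewrite lee_fin.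
  have := ge0_integral_affine 0 y0 mx fx0 => /(congr1 (mule `|y|%:E)).
  rewrite muleA -EFinM divff ?normr_eq0// mul1e => <-.
  rewrite -ge0_integralZl//.
    by apply: eq_integral => x _; rewrite addr0 exprMn EFinM.
  apply: (@measurable_f _ _ (fun x : RT => t + ((y * x + 0) ^+ 2 + y ^+ 2))).
  apply: measurable_funD => //; apply: measurable_funD => //; apply: measurable_funX.
  exact: measurable_affine.
rewrite (@fubini_tonelliT R (fun p => (`|p.1| * f (t + (p.1 ^+ 2 * p.2 ^+ 2 + p.1 ^+ 2)))%:E)); last 2 first.
- exact: measurable_G.
- by move=> p; rewrite lee_fin mulr_ge0.
transitivity (\int[mu]_u ((tail f t)%:E * ((1 + u ^+ 2)^-1)%:E))%E.
  apply: eq_integral => u _.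
  have u1 : 0 < 1 + u ^+ 2 by rewrite ltr_wpDr ?sqr_ge0.
  pose s := Num.sqrt (1 + u ^+ 2).
  have s0 : 0 < s by rewrite sqrtr_gt0.
  have mh : measurable_fun setT (fun y : RT => (h y)%:E).
    by apply/measurable_EFinP; exact: continuous_measurable_fun.
  have h0 (y : R) : (0 <= (h y)%:E)%E by rewrite lee_fin mulr_ge0.
  have := ge0_integral_affine 0 (lt0r_neq0 s0) mh h0; rewrite integral_h.
  move=> /(congr1 (mule s^-1%:E)); rewrite gtr0_norm// muleA -EFinM.
  rewrite -[s^-1 * s^-1]expr2 exprVn sqr_sqrtr ?(ltW u1)// => H; rewrite -EFinM mulrC -H.
  rewrite -ge0_integralZl//.
  - apply: eq_integral => y _; rewrite addr0 -EFinM /h normrM gtr0_norm//.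
    rewrite !mulrA mulVf ?lt0r_neq0// mul1r exprMn sqr_sqrtr ?(ltW u1)//.
    congr (_ * f (t + _))%:E => /=; ring.
  - apply: (measurableT_comp mh); exact: measurable_affine.
  - by rewrite lee_fin invr_ge0 ltW.
rewrite ge0_integralZl//.
- by rewrite integralT_oneDsqrV -EFinM mulrC.
- apply/measurable_EFinP; apply: continuous_measurable_fun; exact: continuous_oneDsqrV.
- by move=> u _; rewrite lee_fin invr_ge0 addr_ge0// sqr_ge0.
- by rewrite lee_fin tail_ge0.
Qed.

End Polar.
End Radial.
Arguments tail {R} f t.

(** * Measurability of open sets and continuous functions *)

Section OpenMeasurable.
Variables (R : realType) (N : nat).
Local Notation RT := (measurableTypeR R).
Local Notation C := (R[i]^o).
Local Notation V := 'rV[C]_N.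
Implicit Types (D : set V) (h : V -> R).

Let box (k : {ffun 'I_N -> rat * rat} * rat) : set V := [set x | forall j : 'I_N,
  `|complex.Re (x 0 j) - ratr (k.1 j).1| < ratr k.2 /\
  `|complex.Im (x 0 j) - ratr (k.1 j).2| < ratr k.2].

Let box_covers D x : open D -> D x -> exists2 k, box k x & box k `<=` D.
Proof.
move=> oD Dx; have [r r0 rD] := open_near_by oD Dx.
have r40 : 0 < r / 4 by lra.
have [e] := rat_in_itvoo r40.
rewrite in_itv /= => /andP[e0 er].
have approx (a : R) : exists q, `|a - ratr q| < ratr e.
  have ae : a - ratr e < a + ratr e by lra.
  have [q] := rat_in_itvoo ae.
  by rewrite in_itv /= => qa; exists q; rewrite ltr_distlC.
pose q j := (xchoose (approx (complex.Re (x 0 j))), xchoose (approx (complex.Im (x 0 j)))).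
exists ([ffun j => q j], e).
  by move=> j; rewrite !ffunE /=; split; exact: (xchooseP (approx _)).
move=> y By; apply: rD => j; have [/= y1 y2] := By j.
have x1 := xchooseP (approx (complex.Re (x 0 j))).
have x2 := xchooseP (approx (complex.Im (x 0 j))).
apply: (le_lt_trans (normc_le_ReIm _)); rewrite ReB ImB.
move: y1 y2; rewrite !ffunE /= => y1 y2.
have t1 := ler_distD (ratr (xchoose (approx (complex.Re (x 0 j))))) (complex.Re (y 0 j)) (complex.Re (x 0 j)).
have t2 := ler_distD (ratr (xchoose (approx (complex.Im (x 0 j))))) (complex.Im (y 0 j)) (complex.Im (x 0 j)).
rewrite [X in _ <= _ + X]distrC in t1; rewrite [X in _ <= _ + X]distrC in t2; lra.
Qed.

Let measurable_box k : measurable ((toC N : seqR R -> V) @^-1` box k).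
Proof.
have key i (a b : R) : measurable ((fun s : seqR R => s i) @^-1` `]a, b[).
  have mi : measurable (`]a, b[%classic : set RT) by exact: measurable_itv.
  by have := @measurable_coord R i measurableT _ mi; rewrite setTI.
have -> : (toC N : seqR R -> V) @^-1` box k = \bigcap_(j : 'I_N)
   (((fun s : seqR R => s (2 * j)%N) @^-1`
        `](ratr (k.1 j).1 - ratr k.2), (ratr (k.1 j).1 + ratr k.2)[) `&`
    ((fun s : seqR R => s (2 * j + 1)%N) @^-1`
        `](ratr (k.1 j).2 - ratr k.2), (ratr (k.1 j).2 + ratr k.2)[)).
  apply/seteqP; split=> s H j; first by move=> _; have := H j; rewrite mxE /= !in_itv /= -!ltr_distl.
  by have := H j I; rewrite mxE /= !in_itv /= -!ltr_distl.
apply: fin_bigcap_measurable => // j _; apply: measurableI.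
  exact: key.
exact: key.
Qed.

(** An open set is the union of the countably many rational boxes that it contains, and a box is a
    finite intersection of conditions on single coordinates. *)
Lemma open_toC_measurable D : open D -> measurable ((toC N : seqR R -> V) @^-1` D).
Proof.
move=> oD; have -> : (toC N : seqR R -> V) @^-1` D =
    \bigcup_k [set s | box k (toC N s) /\ box k `<=` D].
  apply/seteqP; split=> s; last by move=> [k _ [+ kD]]; exact: kD.
  by move=> /(box_covers oD)[k Bk kD]; exists k.
apply: countable_bigcupT_measurable => // k.
have [kD|kD] := pselect (box k `<=` D).
  have -> : [set s | box k (toC N s) /\ box k `<=` D] = (toC N : seqR R -> V) @^-1` box k.
    by apply/seteqP; split=> [s []|s].
  exact: measurable_box.
have -> : [set s : seqR R | box k (toC N s) /\ box k `<=` D] = set0; last exact: measurable0.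
by rewrite -subset0 => s [].
Qed.

Lemma cmeas_continuous D h : open D -> (forall x, D x -> {for x, continuous h}) ->
  cmeas (fun x => ((\1_D x : R) * h x)%:E).
Proof.
move=> oD hc; apply/cmeas_EFin.
pose U a := D `&` [set x | a < h x].
have oU a : open (U a).
  rewrite openE => x [Dx ax]; apply: filterI; first exact: open_nbhs_nbhs.
  have H : nbhs (h x) [set y | a < y] by exact: lt_nbhsr.
  exact: (hc x Dx _ H).
apply: (measurability (@RGenOInfty.G R)); first exact: RGenOInfty.measurableE.
move=> _ [_ [a ->] <-]; rewrite setTI.
(* The function vanishes off [D], so a superlevel set contains the complement of [D] exactly when
   [a < 0]. *)
have [a0|a0] := leP 0 a.
  have -> : (fun s : seqR R => (\1_D (toC N s) : R) * h (toC N s)) @^-1` `]a, +oo[ =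
      (toC N : seqR R -> V) @^-1` U a; last exact: open_toC_measurable.
  apply/seteqP; split=> s /=; rewrite in_itv /= andbT indicE.
    case: (boolP (toC N s \in D)) => [/[!inE] Ds|_]; first by rewrite mul1r.
    by rewrite mul0r ltNge a0.
  by move=> [Ds ?]; rewrite mem_set// mul1r.
have -> : (fun s : seqR R => (\1_D (toC N s) : R) * h (toC N s)) @^-1` `]a, +oo[ =
    (toC N : seqR R -> V) @^-1` U a `|` ~` ((toC N : seqR R -> V) @^-1` D).
  apply/seteqP; split=> s /=; rewrite in_itv /= andbT indicE.
    case: (boolP (toC N s \in D)) => [/[!inE] Ds|/negP nD _].
      by rewrite mul1r => ?; left.
    by right => Ds; apply: nD; rewrite inE.
  case=> [[Ds ?]|Ds]; first by rewrite mem_set// mul1r.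
  by rewrite memNset// mul0r.
by apply: measurableU; [|apply: measurableC]; exact: open_toC_measurable.
Qed.

End OpenMeasurable.

Section RadialIntegral.
Variable R : realType.
Local Notation C := (R[i]^o).

Lemma sqnorm_row_mx N k (q : 'rV[C]_N) (w : 'rV[C]_k) :
  sqnorm (row_mx q w) = sqnorm q + sqnorm w.
Proof.
by rewrite /sqnorm big_split_ord; congr (_ + _); apply: eq_bigr => i _;
  rewrite ?row_mxEl ?row_mxEr.
Qed.

Lemma sqnorm_ge0 N (w : 'rV[C]_N) : 0 <= sqnorm w.
Proof. by apply: sumr_ge0 => i _; exact: csq_ge0. Qed.

Lemma cmeas_radial N (f : R -> R) : measurable_fun setT (f : measurableTypeR R -> R) ->
  cmeas (fun w : 'rV[C]_N => (f (sqnorm w))%:E).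
Proof.
move=> mf; apply/cmeas_EFin; apply: (measurableT_comp mf).
apply: (eq_measurable_fun (fun s : seqR R =>
  \sum_(i < N) (s (2 * i)%N ^+ 2 + s (2 * i + 1)%N ^+ 2))).
  by move=> s _; apply: eq_bigr => i _; rewrite mxE.
apply: measurable_sum => i; apply: measurable_funD; apply: measurable_funX;
  exact: measurable_coord.
Qed.

Lemma cint_radial1 (f : R -> R) : cint (fun w : 'rV[C]_1 => (f (sqnorm w))%:E) =
  (\int[@lebesgue_measure R]_y \int[@lebesgue_measure R]_x (f (x ^+ 2 + y ^+ 2))%:E)%E.
Proof.
apply: eq_integral => y _ /=; apply: eq_integral => x _.
by rewrite /sqnorm big_ord1 mxE.
Qed.

Lemma exp_dominated_tails (M c : R) (f : R -> R) n : 0 < c -> exp_dominated M c f ->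
  exp_dominated (M / c ^+ n) c (iter n tail f).
Proof.
move=> c0 fM; elim: n => [|n IH]; first by rewrite expr0 divr1.
by rewrite iterS exprSr invfM mulrA; exact: tail_dominated.
Qed.

Lemma tails_ge0 (M c : R) (f : R -> R) n : 0 < c -> exp_dominated M c f ->
  (forall s, 0 <= f s) -> forall s, 0 <= iter n tail f s.
Proof.
move=> c0 fM f0; elim: n => [//|n IH] s; rewrite iterS.
exact: (tail_ge0 _ IH).
Qed.

(** Integrating over one complex coordinate in polar form yields [pi] times a tail integral, which
    is again nonnegative and dominated, so the step can be iterated. *)
Lemma ge0_cint_radial k (M c : R) (f : R -> R) (t : R) : 0 < c -> exp_dominated M c f ->
  (forall s, 0 <= f s) ->
  cint (fun w : 'rV[C]_k => (f (t + sqnorm w))%:E) = (pi ^+ k * iter k tail f t)%:E.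
Proof.
move=> c0 fM f0; elim: k t => [|k IH] t.
  by rewrite /cint /= /sqnorm big_ord0 addr0 mul1r.
transitivity (cint (fun w : 'rV[C]_(k + 1) => (f (t + sqnorm w))%:E)).
  by rewrite addn1.
rewrite cint_split.
transitivity (cint (fun w : 'rV[C]_1 => (pi ^+ k)%:E * (iter k tail f (t + sqnorm w))%:E)%E).
  congr cint; apply/funext => w; rewrite -EFinM -IH; congr cint; apply/funext => q.
  by rewrite sqnorm_row_mx -addrA (addrC (sqnorm w)).
have fk := exp_dominated_tails k c0 fM; have fk0 := tails_ge0 k c0 fM f0.
rewrite ge0_cintZ; last 3 first.
- by rewrite exprn_ge0// pi_ge0.
- apply: (@cmeas_radial _ (fun s => iter k tail f (t + s))).
  apply: continuous_measurable_fun => s; apply: continuous_comp; last exact: fk.1.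
  by apply: cvgD; [exact: cvg_cst|exact: cvg_id].
- by move=> w; rewrite lee_fin fk0.
rewrite (cint_radial1 (fun s => iter k tail f (t + s))) (polar_integral t c0 fk fk0).
by rewrite -EFinM exprSr -mulrA iterS.
Qed.

End RadialIntegral.

Section RadialOde.
Variable R : realType.
Local Notation C := (R[i]^o).

Lemma exp_dominated_exp (M c : R) : 0 <= M -> exp_dominated M c (fun s => M * expR (- (c * s))).
Proof.
move=> M0; split=> [x|s]; first by apply: cvgMr; exact: continuous_expN.
by rewrite ger0_norm// mulr_ge0// expR_ge0.
Qed.

Lemma exp_dominated_shift (M c : R) f : exp_dominated M c f ->
  exp_dominated (2 * M) c (fun s => f s + M * expR (- (c * s))).
Proof.
move=> [fc fM]; have M0 : 0 <= M.
  by have := le_trans (normr_ge0 _) (fM 0); rewrite mulr0 oppr0 expR0 mulr1.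
have [ec eM] := exp_dominated_exp c M0; split=> [x|s].
  by apply: cvgD; [exact: fc|exact: ec].
by rewrite (le_trans (ler_normD _ _))// mulr_natl mulr2n mulrDl lerD.
Qed.

Lemma ge0_radial_cintegrable k (M c : R) (f : R -> R) (t : R) : 0 < c ->
  exp_dominated M c f -> (forall s, 0 <= f s) ->
  cintegrable (fun w : 'rV[C]_k => f (t + sqnorm w)) /\
  cintR (fun w : 'rV[C]_k => f (t + sqnorm w)) = pi ^+ k * iter k tail f t.
Proof.
move=> c0 fM f0.
have E : cint (EFin \o (fun w : 'rV[C]_k => f (t + sqnorm w))) = (pi ^+ k * iter k tail f t)%:E.
  exact: (ge0_cint_radial k t c0 fM f0).
split; last by rewrite /cintR E.
split.
  apply: (@cmeas_radial R k (fun s => f (t + s))).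
  apply: continuous_measurable_fun => s; apply: continuous_comp; last exact: fM.1.
  by apply: cvgD; [exact: cvg_cst|exact: cvg_id].
rewrite (_ : (fun w => _) = EFin \o (fun w : 'rV[C]_k => f (t + sqnorm w))) ?E ?ltry//.
by apply/funext => w; rewrite /= ger0_norm.
Qed.

(** [f] may change sign, but adding [M e^(-cs)] makes it nonnegative; the radial formula is applied
    to both terms of this difference. *)
Lemma radial_cintegrable k (M c : R) (f : R -> R) : 0 < c -> exp_dominated M c f ->
  exists f1 f2, [/\ exp_dominated (2 * M) c f1, exp_dominated M c f2, forall s, f s = f1 s - f2 s &
   forall t, cintegrable (fun w : 'rV[C]_k => f (t + sqnorm w)) /\
   cintR (fun w : 'rV[C]_k => f (t + sqnorm w)) = pi ^+ k * (iter k tail f1 t - iter k tail f2 t)].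
Proof.
move=> c0 fM; pose f2 s := M * expR (- (c * s)); pose f1 s := f s + f2 s.
have M0 : 0 <= M.
  by have := le_trans (normr_ge0 _) (fM.2 0); rewrite mulr0 oppr0 expR0 mulr1.
have f2M := exp_dominated_exp c M0; have f1M := exp_dominated_shift fM.
have f20 s : 0 <= f2 s by rewrite mulr_ge0// expR_ge0.
have f10 s : 0 <= f1 s.
  by have := fM.2 s; rewrite ler_norml => /andP[+ _]; rewrite /f1 -/(f2 s); lra.
have ff s : f s = f1 s - f2 s by rewrite /f1 addrK.
exists f1, f2; split=> // t.
have [i1 E1] := ge0_radial_cintegrable k t c0 f1M f10.
have [i2 E2] := ge0_radial_cintegrable k t c0 f2M f20.
have ni2 := cintegrableZ (-1) i2.
have fE : (fun w : 'rV[C]_k => f (t + sqnorm w)) =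
    (fun w => f1 (t + sqnorm w) + -1 * f2 (t + sqnorm w)).
  by apply/funext => w; rewrite ff mulN1r.
rewrite fE; split; first exact: cintegrableD.
by rewrite (cintRD i1 ni2) (cintRZ _ i2) E1 E2; ring.
Qed.

(* [P 0] is [pi ^ k] times the [k]-th iterated tail integral of [f], and
   differentiating a tail integral gives back minus the integrand. *)
Lemma radial_ode k (M c : R) (f : R -> R) (P : nat -> R -> R) : 0 < c ->
  exp_dominated M c f ->
  (forall t, 0 < t -> P 0%N t = cintR (fun w : 'rV[C]_k => f (t + sqnorm w))) ->
  (forall j (t : R), 0 < t -> is_derive t 1 (P j) (- P j.+1 t)) ->
  forall t, 0 < t -> P k t = pi ^+ k * f t.
Proof.
move=> c0 fM P0 PS; have [f1 [f2 [f1M f2M ff f12]]] := radial_cintegrable k c0 fM.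
suff H j : (j <= k)%N -> forall t, 0 < t ->
    P j t = pi ^+ k * (iter (k - j) tail f1 t - iter (k - j) tail f2 t).
  by move=> t t0; rewrite (H k)// subnn /= ff.
elim: j => [_|j IH jk] t t0; first by rewrite P0// subn0; exact: (f12 t).2.
have D1 := is_derive_tail c0 (exp_dominated_tails (k - j.+1) c0 f1M) t.
have D2 := is_derive_tail c0 (exp_dominated_tails (k - j.+1) c0 f2M) t.
have D := is_deriveZ (pi ^+ k) (is_deriveB D1 D2).
have PD := PS j t t0.
have PE : \near t, P j t = (pi ^+ k \*: (tail (iter (k - j.+1) tail f1) -
      tail (iter (k - j.+1) tail f2))) t.
  near=> s; rewrite -!iterS subnSK//; apply: IH; [exact: ltnW|near: s; exact: lt_nbhsr].
have [_ E1] := near_eq_is_derive PE PD; have [_ E2] := D.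
have := etrans (esym E1) E2; rewrite /GRing.scale /= => /(congr1 -%R).
by rewrite opprK => ->; ring.
Unshelve. all: by end_near. Qed.

End RadialOde.

(** * Bergman kernels *)
Section Bergman.
Variable R : realType.
Local Notation C := (R[i]^o).

Lemma cmeas_comp_continuous N M (A : 'rV[C]_N -> 'rV[C]_M) (F : 'rV[C]_M -> \bar R) :
  (forall j, continuous (fun x => A x 0 j : C)) -> cmeas F -> cmeas (fun x => F (A x)).
Proof.
move=> cA mF.
apply: (eq_measurable_fun (fun s : seqR R => F (toC M (fromC (A (toC N s)))))).
  by move=> s _; rewrite toC_fromC.
apply: (measurableT_comp mF (g := fun s : seqR R => fromC (A (toC N s)) : seqR R)).
have cont (h : 'rV[C]_N -> R) : continuous h ->
    measurable_fun setT ((fun s : seqR R => h (toC N s)) : seqR R -> measurableTypeR R).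
  move=> hc; apply/cmeas_EFin; have := @cmeas_continuous R N setT h openT (fun x _ => hc x).
  by under eq_fun do rewrite indicT mul1r.
apply: measurable_seqR => i; rewrite /fromC; case: insubP => [j _ _|_]; last exact: measurable_cst.
case: (odd i).
  apply: (cont (fun x => complex.Im (A x 0 j))) => x.
  by apply: (continuous_comp (cA j x)); exact: Im_continuous.
apply: (cont (fun x => complex.Re (A x 0 j))) => x.
by apply: (continuous_comp (cA j x)); exact: Re_continuous.
Qed.

Definition Cintegrable N (H : 'rV[C]_N -> C) :=
  cintegrable (fun x => complex.Re (H x)) /\ cintegrable (fun x => complex.Im (H x)).

Lemma cintCE N (H : 'rV[C]_N -> C) :
  cintC H = cintR (fun x => complex.Re (H x)) +i* cintR (fun x => complex.Im (H x)).
Proof. by []. Qed.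

Lemma cintC_conj N (H : 'rV[C]_N -> C) : Cintegrable H ->
  cintC (fun x => conjc (H x)) = conjc (cintC H).
Proof.
move=> [Hr Hi]; apply: complexP; rewrite ?Re_conj ?Im_conj !cintCE /=.
  by congr cintR; apply/funext => x; rewrite Re_conj.
by rewrite -(cintRN Hi); congr cintR; apply/funext => x; rewrite Im_conj.
Qed.

Lemma cintCZ N (a : C) (H : 'rV[C]_N -> C) : Cintegrable H ->
  cintC (fun x => a * H x) = a * cintC H.
Proof.
move=> [Hr Hi]; apply: complexP.
  rewrite ReM !cintCE /= -(cintRZ _ Hr) -mulNr -(cintRZ _ Hi).
  rewrite -cintRD; [|exact: cintegrableZ|exact: cintegrableZ].
  by congr cintR; apply/funext => x; rewrite ReM mulNr.
rewrite ImM !cintCE /= -(cintRZ _ Hr) -(cintRZ _ Hi).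
rewrite -cintRD; [|exact: cintegrableZ|exact: cintegrableZ].
by congr cintR; apply/funext => x; rewrite ImM.
Qed.

Lemma dot_le (a b c d : R) : `|a * c + b * d| <= a ^+ 2 + b ^+ 2 + (c ^+ 2 + d ^+ 2).
Proof.
have h1 := sqr_ge0 (a + c); have h2 := sqr_ge0 (b + d).
have h3 := sqr_ge0 (a - c); have h4 := sqr_ge0 (b - d).
have h5 := sqr_ge0 a; have h6 := sqr_ge0 b; have h7 := sqr_ge0 c; have h8 := sqr_ge0 d.
rewrite !sqrrD !sqrrN !mulrN !mulNrn in h1 h2 h3 h4.
by rewrite ler_norml; apply/andP; split; lra.
Qed.

Definition l2prod N (D : set 'rV[C]_N) (f g : 'rV[C]_N -> C) (x : 'rV[C]_N) : C :=
  (\1_D x : R)%:C * f x * conjc (g x).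

Section Domain.
Variables (N : nat) (D : set 'rV[C]_N).
Hypothesis oD : open D.
Implicit Types f g : 'rV[C]_N -> C.

Lemma bergman_cintegrable f : bergman_space D f ->
  cintegrable (fun x => (\1_D x : R) * csq (f x)).
Proof.
move=> [fh foo]; split.
  apply: (cmeas_continuous (h := fun x => csq (f x)) oD) => x Dx.
  have fr := continuous_comp (fh.1 x Dx) (@Re_continuous R _).
  have fi := continuous_comp (fh.1 x Dx) (@Im_continuous R _).
  have := continuousD (continuousM fr fr) (continuousM fi fi).
  rewrite (_ : (fun y => csq (f y)) = (fun y => complex.Re (f y) * complex.Re (f y) +
    complex.Im (f y) * complex.Im (f y))); first exact.
  by apply/funext => u; rewrite /csq !expr2.
rewrite (_ : (fun x => _) = (fun x => ((\1_D x : R) * csq (f x))%:E)) //.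
by apply/funext => x; rewrite ger0_norm// mulr_ge0// csq_ge0.
Qed.

Lemma l2prod_Re f g x : complex.Re (l2prod D f g x) =
  \1_D x * (complex.Re (f x) * complex.Re (g x) + complex.Im (f x) * complex.Im (g x)).
Proof. by rewrite /l2prod -mulrA ReMr ReM Re_conj Im_conj mulrN opprK. Qed.

Lemma l2prod_Im f g x : complex.Im (l2prod D f g x) =
  \1_D x * (complex.Im (f x) * complex.Re (g x) - complex.Re (f x) * complex.Im (g x)).
Proof. by rewrite /l2prod -mulrA ImMr ImM Re_conj Im_conj mulrN addrC. Qed.

Lemma l2prod_Cintegrable f g : bergman_space D f -> bergman_space D g ->
  Cintegrable (l2prod D f g).
Proof.
move=> bf bg; have [fi gi] := (bergman_cintegrable bf, bergman_cintegrable bg).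
have cont (h : 'rV[C]_N -> C) x : bergman_space D h -> D x ->
    {for x, continuous (fun y => complex.Re (h y))} /\
    {for x, continuous (fun y => complex.Im (h y))}.
  move=> [hh _] Dx; have hc := hh.1 x Dx; split.
    exact: (continuous_comp hc (@Re_continuous R _)).
  exact: (continuous_comp hc (@Im_continuous R _)).
have ind0 x : 0 <= \1_D x :> R by [].
split.
  apply: (cintegrable_le _ (cintegrableD fi gi)).
    rewrite (_ : EFin \o _ = (fun x => ((\1_D x : R) * (complex.Re (f x) * complex.Re (g x) +
      complex.Im (f x) * complex.Im (g x)))%:E)); last first.
      by apply/funext => x; rewrite /= l2prod_Re.
    apply: cmeas_continuous => // x Dx; have [f1 f2] := cont f x bf Dx.
    have [g1 g2] := cont g x bg Dx.
    exact: (continuousD (continuousM f1 g1) (continuousM f2 g2)).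
  move=> x; rewrite l2prod_Re -mulrDr !normrM !(ger0_norm (ind0 x)); apply: ler_wpM2l => //.
  rewrite (ger0_norm (addr_ge0 (csq_ge0 _) (csq_ge0 _))); exact: dot_le.
apply: (cintegrable_le _ (cintegrableD fi gi)).
  rewrite (_ : EFin \o _ = (fun x => ((\1_D x : R) * (complex.Im (f x) * complex.Re (g x) -
    complex.Re (f x) * complex.Im (g x)))%:E)); last first.
    by apply/funext => x; rewrite /= l2prod_Im.
  apply: cmeas_continuous => // x Dx; have [f1 f2] := cont f x bf Dx.
  have [g1 g2] := cont g x bg Dx.
  exact: (continuousB (continuousM f2 g1) (continuousM f1 g2)).
move=> x; rewrite l2prod_Im -mulrDr !normrM !(ger0_norm (ind0 x)); apply: ler_wpM2l => //.
rewrite (ger0_norm (addr_ge0 (csq_ge0 _) (csq_ge0 _))) -mulrN /csq [X in _ <= X + _]addrC.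
by rewrite -[X in _ <= _ + (_ + X)]sqrrN; exact: dot_le.
Qed.

(* Both sides are the inner product of [K1(., y)] and [K2(., x)]. *)
Lemma kernel_sym K1 K2 : is_bergman_kernel D K1 -> is_bergman_kernel D K2 ->
  forall x y, D x -> D y -> K1 x y = conjc (K2 y x).
Proof.
move=> [B1 R1] [B2 R2] x y Dx Dy.
rewrite (R2 _ (B1 y Dy) x Dx) (R1 _ (B2 x Dx) y Dy).
rewrite -(cintC_conj (l2prod_Cintegrable (B2 x Dx) (B1 y Dy))).
congr cintC; apply/funext => u.
change (l2prod D (K1^~ y) (K2^~ x) u = conjc (l2prod D (K2^~ x) (K1^~ y) u)).
by apply: complexP; rewrite ?Re_conj ?Im_conj ?l2prod_Re ?l2prod_Im; ring.
Qed.

(** Hermitian symmetry holds between two different kernels, and using it twice exchanges them. *)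
Lemma kernel_unique K1 K2 : is_bergman_kernel D K1 -> is_bergman_kernel D K2 ->
  forall x y, D x -> D y -> K1 x y = K2 x y.
Proof.
by move=> k1 k2 x y Dx Dy; rewrite (kernel_sym k1 k2)// (kernel_sym k2 k2)// conjcK.
Qed.

End Domain.
End Bergman.

(** * The transformation rule for Bergman kernels *)

Section Transform.
Variables (R : realType) (N : nat).
Local Notation C := (R[i]^o).
Local Notation V := 'rV[C]_N.

(** [w] stands for the real Jacobian of [A]. Only nonnegative integrands are required; signed and
    complex ones follow by splitting. *)
Definition change_var (A : V -> V) (w : V -> R) := (forall x, 0 <= w x) /\
  forall F : V -> \bar R, cmeas F -> (forall x, (0 <= F x)%E) ->
    cmeas (fun x => ((w x)%:E * F (A x))%E) /\
    cint (fun x => ((w x)%:E * F (A x))%E) = cint F.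

Section ChangeVar.
Variables (A : V -> V) (w : V -> R).
Hypothesis cv : change_var A w.

Lemma ge0_change_var_cintR (h : V -> R) : cintegrable h -> (forall x, 0 <= h x) ->
  cintegrable (fun x => w x * h (A x)) /\ cintR (fun x => w x * h (A x)) = cintR h.
Proof.
move=> hi h0; have [m E] := cv.2 (EFin \o h) hi.1 (fun x => h0 x).
have e1 : (fun x => ((w x)%:E * (EFin \o h) (A x))%E) = EFin \o (fun x => w x * h (A x)).
  by [].
rewrite e1 in m E; split; last by rewrite /cintR E.
split=> //; rewrite (_ : (fun x => _) = EFin \o (fun x => w x * h (A x))).
  by rewrite E (ge0_cintegrableE hi h0) ltry.
by apply/funext => x; rewrite /= ger0_norm// mulr_ge0//; exact: cv.1.
Qed.

Lemma change_var_cintR (h : V -> R) : cintegrable h ->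
  cintegrable (fun x => w x * h (A x)) /\ cintR (fun x => w x * h (A x)) = cintR h.
Proof.
move=> hi; have [pi_ Ep] := ge0_change_var_cintR (cintegrable_pos hi) (pos_part_ge0 h).
have [ni En] := ge0_change_var_cintR (cintegrable_neg hi) (neg_part_ge0 h).
have nni := cintegrableZ (-1) ni.
have -> : (fun x => w x * h (A x)) =
    (fun x => w x * pos_part h (A x) + -1 * (w x * neg_part h (A x))).
  by apply/funext => x; rewrite -(pos_negB h (A x)) mulN1r mulrBr.
split; first exact: cintegrableD.
by rewrite (cintRD pi_ nni) (cintRZ _ ni) Ep En mulN1r (cintR_posneg hi).
Qed.

Lemma change_var_cintC (H : V -> C) : Cintegrable H ->
  Cintegrable (fun x => (w x)%:C * H (A x)) /\ cintC (fun x => (w x)%:C * H (A x)) = cintC H.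
Proof.
move=> [Hr Hi]; have [r Er] := change_var_cintR Hr; have [i Ei] := change_var_cintR Hi.
have fr : (fun x => complex.Re ((w x)%:C * H (A x))) = (fun x => w x * complex.Re (H (A x))).
  by apply/funext => x; rewrite ReMr.
have fi : (fun x => complex.Im ((w x)%:C * H (A x))) = (fun x => w x * complex.Im (H (A x))).
  by apply/funext => x; rewrite ImMr.
by split; [rewrite /Cintegrable fr fi|rewrite !cintCE fr fi Er Ei].
Qed.

End ChangeVar.

Lemma bergman_finite (D : set V) (f : V -> C) (F : V -> R) :
  holomorphic_on D f -> cintegrable F -> (forall x, \1_D x * csq (f x) = F x) ->
  bergman_space D f.
Proof.
move=> fh Fi fF; split=> //; apply: le_lt_trans Fi.2.
have -> : (fun x => ((\1_D x : R) * csq (f x))%:E) = (fun x => `|F x|%:E).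
  by apply/funext => x; rewrite -fF ger0_norm// mulr_ge0// csq_ge0.
exact: lexx.
Qed.

Lemma holomorphicM (D : set V) (f g : V -> C) : open D -> holomorphic_on D f -> holomorphic_on D g ->
  holomorphic_on D (fun x => f x * g x).
Proof.
move=> oD fh gh; apply: differentiable_holomorphic => x Dx.
exact: (differentiableM (holomorphic_differentiable oD fh Dx) (holomorphic_differentiable oD gh Dx)).
Qed.

Lemma bergmanZ D (a : C) (f : V -> C) : open D -> bergman_space D f -> bergman_space D (fun x => a * f x).
Proof.
move=> oD bf; apply: (bergman_finite _ (cintegrableZ (csq a) (bergman_cintegrable oD bf))).
  apply: (holomorphicM oD _ bf.1); apply: differentiable_holomorphic => x _.
  exact: differentiable_cst.
by move=> x; rewrite csqM mulrCA.
Qed.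

Lemma bergman_pull (D1 D2 : set V) (A : V -> V) (J f : V -> C) : open D1 -> open D2 ->
  (forall x, D1 x <-> D2 (A x)) ->
  (forall x j, D1 x -> differentiable (fun y => A y 0 j : C) x) ->
  holomorphic_on D1 J -> change_var A (fun x => csq (J x)) ->
  bergman_space D2 f -> bergman_space D1 (fun x => J x * f (A x)).
Proof.
move=> o1 o2 D12 Ad Jh cv bf.
have [Fi _] := change_var_cintR cv (bergman_cintegrable o2 bf).
apply: (bergman_finite _ Fi).
  by apply: (holomorphicM o1 Jh); apply: (holomorphic_comp o2 bf.1) => // x; case: (D12 x).
move=> x; rewrite csqM mulrCA !indicE.
by have -> : (x \in D1) = (A x \in D2) by apply/idP/idP; rewrite !inE => /D12.
Qed.

(** Weighted composition with [B] moves [f] to [D2], where [K] reproduces it at [A y]; the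
    substitution [A] brings the integral back to [D1]. *)
Lemma transform_kernel (D1 D2 : set V) (A B : V -> V) (J : V -> C) K : open D1 -> open D2 ->
  (forall x, D1 x <-> D2 (A x)) -> cancel A B -> cancel B A ->
  (forall x j, differentiable (fun y => A y 0 j : C) x) ->
  (forall x j, differentiable (fun y => B y 0 j : C) x) ->
  (forall x, differentiable J x) -> (forall x, J x != 0) ->
  change_var A (fun x => csq (J x)) -> change_var B (fun y => (csq (J (B y)))^-1) ->
  is_bergman_kernel D2 K ->
  is_bergman_kernel D1 (fun x y => J x * K (A x) (A y) * conjc (J y)).
Proof.
move=> o1 o2 D12 AB BA Ad Bd Jd J0 cvA cvB [KB KR].
have Jh : holomorphic_on D1 J by apply: differentiable_holomorphic => x _; exact: Jd.
split=> [y D1y|f bf y D1y].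
  have := bergmanZ (conjc (J y)) o1 (bergman_pull o1 o2 D12 (fun x j _ => Ad x j) Jh cvA
    (KB _ ((D12 y).1 D1y))).
  by under eq_fun do rewrite mulrC.
have D21 x : D2 x <-> D1 (B x) by rewrite D12 BA.
pose J' x := (J (B x))^-1.
have bg : bergman_space D2 (fun x => J' x * f (B x)).
  apply: (bergman_pull o2 o1 D21 (fun x j _ => Bd x j) _ _ bf).
    apply: differentiable_holomorphic => x _; apply: differentiableV; last exact: J0.
    apply: (@differentiable_comp _ _ _ _ B J); last exact: Jd.
    by apply: differentiable_row => j; exact: Bd.
  rewrite (_ : (fun x => csq (J' x)) = (fun y => (csq (J (B y)))^-1))//.
  by apply/funext => x; rewrite /J' !csq_normc normcV exprVn.
have D2y := (D12 y).1 D1y.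
have := KR _ bg _ D2y; rewrite /J' AB => E.
have Hi := l2prod_Cintegrable o2 bg (KB _ D2y).
have [Hi' E'] := change_var_cintC cvA Hi.
have -> : f y = J y * ((J y)^-1 * f y) by rewrite mulrA divff// mul1r.
rewrite E -E' -cintCZ//; congr cintC; apply/funext => x.
(* The integrands agree pointwise: [|J|^2] from the substitution against [1 / J] from the
   transported function leaves [conj J]. *)
rewrite /l2prod /J' AB !rmorphM /= conjcK !indicE.
have -> : (A x \in D2) = (x \in D1) by apply/idP/idP; rewrite !inE => /D12.
rewrite -mul_conjc; have := J0 x; set a := J x; set b := conjc a; set c := conjc _.
by move=> a0; field.
Qed.

End Transform.

Section Instances.
Variable R : realType.
Local Notation C := (R[i]^o).

Lemma csq_continuous : continuous (@csq R : C -> R).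
Proof.
move=> z; have fr := @Re_continuous R z; have fi := @Im_continuous R z.
have := continuousD (continuousM fr fr) (continuousM fi fi).
rewrite (_ : @csq R = (fun y => complex.Re y * complex.Re y +
  complex.Im y * complex.Im y) :> (C -> R)); first exact.
by apply/funext => u; rewrite /csq !expr2.
Qed.

Lemma csq_eq0 (z : R[i]) : (csq z == 0) = (z == 0).
Proof. by rewrite csq_normc expf_eq0 /= normc_eq0. Qed.

Lemma change_var_affrow N (c b : 'rV[C]_N) : (forall j, c 0 j != 0) ->
  change_var (affrow c b) (fun=> \prod_j csq (c 0 j)).
Proof.
move=> c0; have P0 : 0 <= \prod_j csq (c 0 j) by rewrite prodr_ge0// => j _; exact: csq_ge0.
have P1 : \prod_j csq (c 0 j) != 0.
  by apply/prodf_neq0 => j _; rewrite csq_eq0.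
split=> // F mF F0; have mA := cmeas_affine c b mF.
split; first exact: measurable_funeM.
rewrite (ge0_cintZ P0 mA)// (ge0_cint_affine b c0 mF F0).
by rewrite muleA -EFinM mulfV// mul1e.
Qed.

(** Common form of [heis] and its inverse: the Jacobian matrix is block triangular, so only the
    fibre factors [c] enter the determinant. *)
Definition fibered N k (c : 'rV[C]_k -> 'rV[C]_N) (b : 'rV[C]_k) (x : 'rV[C]_(N + k)) :=
  row_mx (\row_j (c (rsubmx x) 0 j * lsubmx x 0 j)) (rsubmx x + b).

Lemma differentiable_coordC N (j : 'I_N) (x : 'rV[C]_N) :
  differentiable (fun y : 'rV[C]_N => y 0 j : C) x.
Proof. exact: differentiable_coord. Qed.

Lemma differentiable_lsub N k (j : 'I_N) (x : 'rV[C]_(N + k)) :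
  differentiable (fun x : 'rV[C]_(N + k) => lsubmx x 0 j : C) x.
Proof.
rewrite (_ : (fun x => _) = (fun x : 'rV[C]_(N + k) => x 0 (lshift k j) : C)).
  exact: differentiable_coordC.
by apply/funext => y; rewrite mxE.
Qed.

Lemma differentiable_rsub N k (j : 'I_k) (x : 'rV[C]_(N + k)) :
  differentiable (fun x : 'rV[C]_(N + k) => rsubmx x 0 j : C) x.
Proof.
rewrite (_ : (fun x => _) = (fun x : 'rV[C]_(N + k) => x 0 (rshift N j) : C)).
  exact: differentiable_coordC.
by apply/funext => y; rewrite mxE.
Qed.

Lemma rsubmx_continuous N k : continuous (fun x : 'rV[C]_(N + k) => rsubmx x).
Proof.
move=> x; apply: differentiable_continuous; apply: differentiable_row => j.
exact: differentiable_rsub.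
Qed.

Lemma row_mx_coord_continuous N k M (f : 'rV[C]_M -> 'rV[C]_N) (g : 'rV[C]_M -> 'rV[C]_k) j :
  (forall i, continuous (fun x => f x 0 i : C)) -> (forall i, continuous (fun x => g x 0 i : C)) ->
  continuous (fun x => row_mx (f x) (g x) 0 j : C).
Proof.
move=> cf cg; case: (split_ordP j) => i ->.
  rewrite (_ : (fun x => _) = (fun x => f x 0 i : C)); first exact: cf.
  by apply/funext => x; rewrite row_mxEl.
rewrite (_ : (fun x => _) = (fun x => g x 0 i : C)); first exact: cg.
by apply/funext => x; rewrite row_mxEr.
Qed.

Lemma cmeas_weight N (w : 'rV[C]_N -> R) F : continuous w -> cmeas F ->
  cmeas (fun x => ((w x)%:E * F x)%E).
Proof.
move=> cw mF; have := @cmeas_continuous R N setT w openT (fun x _ => cw x).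
under eq_fun do rewrite indicT mul1r.
by move=> mw; exact: (emeasurable_funM mw mF).
Qed.

(** For fixed base point the map is a diagonal scaling of the fibre, integrated first by
    [cint_split]; what remains is a translation of the base. *)
Lemma change_var_fibered N k (c : 'rV[C]_k -> 'rV[C]_N) (b : 'rV[C]_k) :
  (forall j, continuous (fun v => c v 0 j : C)) -> (forall v j, c v 0 j != 0) ->
  change_var (fibered c b) (fun x => \prod_j csq (c (rsubmx x) 0 j)).
Proof.
move=> cc c0; have wc : continuous (fun v => \prod_j csq (c v 0 j)).
  have wcs (r : seq 'I_N) : continuous (fun v => \prod_(j <- r) csq (c v 0 j)).
    elim: r => [|j r IH] v.
      rewrite (_ : (fun v => _) = fun=> 1); first exact: cst_continuous.
      by apply/funext => u; rewrite big_nil.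
    rewrite (_ : (fun v => _) = fun v => csq (c v 0 j) * \prod_(i <- r) csq (c v 0 i)); last first.
      by apply/funext => u; rewrite big_cons.
    exact: (continuousM (continuous_comp (cc j v) (@csq_continuous _)) (IH v)).
  exact: wcs.
split=> [x|F mF F0]; first by rewrite prodr_ge0// => j _; exact: csq_ge0.
have rc := @rsubmx_continuous N k.
have mA : cmeas (fun x => F (fibered c b x)).
  apply: (cmeas_comp_continuous _ mF) => j; apply: row_mx_coord_continuous => i x.
    rewrite (_ : (fun y => _) = (fun y : 'rV[C]_(N + k) => c (rsubmx y) 0 i * lsubmx y 0 i : C)); last first.
      by apply/funext => y; rewrite mxE.
    exact: (continuousM (continuous_comp (rc x) (cc i _)) (differentiable_continuous (differentiable_lsub i x))).
  rewrite (_ : (fun y => _) = (fun y : 'rV[C]_(N + k) => rsubmx y 0 i + b 0 i : C)); last first.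
    by apply/funext => y; rewrite mxE.
  by apply: continuousD; [exact: (differentiable_continuous (differentiable_rsub i x))|exact: cst_continuous].
split; first by apply: cmeas_weight => // x; exact: (continuous_comp (rc x) (wc _)).
have P0 v : 0 <= \prod_j csq (c v 0 j) by rewrite prodr_ge0// => j _; exact: csq_ge0.
have P1 v : \prod_j csq (c v 0 j) != 0.
  by apply/prodf_neq0 => j _; rewrite csq_eq0.
rewrite !cint_split.
transitivity (cint (fun v => cint (fun q => F (row_mx q (v + b))))).
  congr cint; apply/funext => v.
  have mv := cmeas_section (v + b) mF.
  transitivity (cint (fun q => ((\prod_j csq (c v 0 j))%:E * F (row_mx (affrow (c v) 0 q) (v + b)))%E)).
    congr cint; apply/funext => q; rewrite /fibered row_mxKr row_mxKl.
    by congr (_ * F (row_mx _ _))%E; apply/rowP => j; rewrite !mxE addr0.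
  have := ge0_cint_affine 0 (c0 v) mv (fun q => F0 _) => E.
  rewrite ge0_cintZ// ?E ?muleA -?EFinM ?mulfV ?mul1e//.
  exact: (cmeas_affine (c v) 0 mv).
have mG := cmeas_cint mF; have G0 v : (0 <= cint (fun q => F (row_mx q v)))%E by exact: cint_ge0.
have one0 (j : 'I_k) : (const_mx 1 : 'rV[C]_k) 0 j != 0 by rewrite mxE oner_neq0.
have := ge0_cint_affine b one0 mG G0.
rewrite [in RHS]big1 ?invr1 ?mul1e => [<-|j _]; last by rewrite mxE /csq /= expr1n expr0n /= addr0.
congr cint; apply/funext => v; congr cint; apply/funext => q; congr (F (row_mx _ _)).
by apply/rowP => j; rewrite !mxE mul1r.
Qed.

End Instances.

(** * Moving coordinate scalings across the kernel *)

Section Scaling.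
Variables (R : realType) (N : nat).
Local Notation C := (R[i]^o).
Local Notation V := 'rV[C]_N.

Definition scale (c x : V) : V := \row_i (c 0 i * x 0 i).
Definition one_at (j : 'I_N) (a : C) : V := \row_i (if i == j then a else 1).
Definition star_at (D : set V) (j : 'I_N) :=
  forall (x : V) (a : C), normc a <= 1 -> D x -> D (scale (one_at j a) x).

Lemma scaleA c d x : scale c (scale d x) = scale (scale c d) x.
Proof. by apply/rowP => i; rewrite !mxE mulrA. Qed.

Lemma scale1 x : scale (const_mx 1) x = x.
Proof. by apply/rowP => i; rewrite !mxE mul1r. Qed.

Lemma one_atM j (a b : C) : scale (one_at j a) (one_at j b) = one_at j (a * b).
Proof. by apply/rowP => i; rewrite !mxE; case: eqP => // _; rewrite mul1r. Qed.

Lemma one_at1 j : one_at j 1 = const_mx 1.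
Proof. by apply/rowP => i; rewrite !mxE; case: eqP. Qed.

Lemma affrow0 c x : affrow c 0 x = scale c x.
Proof. by apply/rowP => i; rewrite !mxE addr0. Qed.

Lemma differentiable_scale c j (x : V) : differentiable (fun y => scale c y 0 j : C) x.
Proof.
rewrite (_ : (fun y => _) = (fun y : V => c 0 j * y 0 j : C)).
  by apply: differentiableM; [exact: differentiable_cst|exact: differentiable_coordC].
by apply/funext => y; rewrite mxE.
Qed.

Lemma differentiable_one_at j (y : V) (a : C) : differentiable (fun z : C => scale (one_at j z) y) a.
Proof.
have -> : (fun z : C => scale (one_at j z) y) =
    (fun z : C => scale (one_at j 0) y + z *: scale (delta_mx 0 j) y).
  apply/funext => z; apply/rowP => i; rewrite !mxE /GRing.scale /=.
  by case: eqP => _; rewrite ?mul0r ?add0r ?mul1r ?mulr0 ?addr0.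
apply: differentiableD; first exact: differentiable_cst.
by apply: differentiableZl; exact: ex_diff.
Qed.

Lemma normc_mul_conj (a : R[i]) : normc a = 1 -> a * conjc a = 1.
Proof. by move=> a1; rewrite mul_conjc csq_normc a1 expr1n. Qed.

Lemma differentiable_conj (h : C -> C) (a : C) : differentiable h (conjc a : C) ->
  differentiable (fun z : C => conjc (h (conjc z)) : C) a.
Proof.
move=> /differentiable_cdiff[l H]; apply/differentiable_cdiff; exists (conjc l) => e e0.
have [d d0 dH] := H e e0; exists d => // u ud.
have := dH (conjc u); rewrite normc_conj => /(_ ud).
set L := (_ - _ - _) => HL; rewrite (_ : _ - _ - _ = conjc L) ?normc_conj//.
by rewrite /L !rmorphB rmorphM /= conjcK rmorphD.
Qed.

Section Kernel.
Variables (D : set V) (K : V -> V -> C).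
Hypotheses (oD : open D) (kK : is_bergman_kernel D K).

(** The rotation is an automorphism of [D] that preserves volume, so the transformation rule with
    [J = 1] gives another Bergman kernel of [D], and uniqueness identifies the two. *)
Let rotation j (a : C) x y : normc a = 1 -> star_at D j -> D x -> D y ->
  K (scale (one_at j a) x) (scale (one_at j a) y) = K x y.
Proof.
move=> a1 Dj Dx Dy; have aa := normc_mul_conj a1.
have a1' : normc (conjc a) = 1 by rewrite normc_conj.
pose A := scale (one_at j a); pose B := scale (one_at j (conjc a)).
have AB : cancel A B by move=> u; rewrite /A /B scaleA one_atM mulrC aa one_at1 scale1.
have BA : cancel B A by move=> u; rewrite /A /B scaleA one_atM aa one_at1 scale1.
have D12 u : D u <-> D (A u).
  split=> [|Du]; first by apply: Dj; rewrite a1.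
  by rewrite -(AB u); apply: Dj => //; rewrite a1'.
have cvar b : normc b = 1 -> change_var (scale (one_at j b)) (fun=> 1).
  move=> b1; have b0 i : one_at j b 0 i != 0.
    rewrite mxE; case: (i == j); last exact: oner_neq0.
    by apply/eqP => bz; move: b1; rewrite bz normc0 => /eqP; rewrite eq_sym oner_eq0.
  have := change_var_affrow 0 b0.
  rewrite (_ : affrow _ _ = scale (one_at j b)); last by apply/funext => u; rewrite affrow0.
  rewrite big1 => [//|i _]; rewrite mxE csq_normc; case: eqP => _; first by rewrite b1 expr1n.
  by rewrite normc1 expr1n.
have csq1 : csq (1 : R[i]) = 1 by rewrite csq_normc normc1 expr1n.
have := @transform_kernel R N D D A B (fun=> 1) K oD oD D12 AB BA.
move=> /(_ (fun u i => differentiable_scale _ i u) (fun u i => differentiable_scale _ i u)).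
move=> /(_ (fun u => differentiable_cst _ _) (fun u => oner_neq0 _)).
rewrite csq1 invr1 => /(_ (cvar _ a1) (cvar _ a1') kK) kA.
by have := kernel_unique oD kA kK Dx Dy; rewrite mul1r rmorph1 mulr1.
Qed.

(* For [|a| = 1] this is invariance of the kernel under a rotation; both sides are
   holomorphic in [a], so the identity extends from the circle to the disc. *)
Lemma kernel_one_at j (a : C) x y : normc a <= 1 -> star_at D j -> D x -> D y ->
  K (scale (one_at j a) x) y = K x (scale (one_at j (conjc a)) y).
Proof.
move=> a1 Dj Dx Dy.
(* By symmetry the second term is [K(x, conj(z) y)]; in this form it is visibly holomorphic in [z],
   being conjugated twice. *)
pose f (z : C) : C := K (scale (one_at j z) x) y - conjc (K (scale (one_at j (conjc z)) y) x).
have symK (w : C) : normc w <= 1 ->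
    conjc (K (scale (one_at j (conjc w)) y) x) = K x (scale (one_at j (conjc w)) y).
  by move=> w1; rewrite [RHS](kernel_sym oD kK kK) //; apply: Dj => //; rewrite normc_conj.
suff : f a = 0 by move=> /eqP; rewrite subr_eq0 symK// => /eqP.
have Kd u : D u -> forall v, D v -> differentiable (K^~ u) v.
  by move=> Du v Dv; exact: (holomorphic_differentiable oD (kK.1 u Du).1 Dv).
have Kz u v (z : C) : D u -> D v -> normc z <= 1 ->
    differentiable (fun z : C => K (scale (one_at j z) u) v : C) z.
  move=> Du Dv z1; apply: (@differentiable_comp _ _ _ _ (fun z : C => scale (one_at j z) u) (K^~ v)).
    exact: differentiable_one_at.
  by apply: (Kd v Dv); exact: Dj.
apply: (holomorphic_zero_on_circle _ _ a1) => z z1.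
  apply: differentiableB; first exact: Kz.
  apply: (@differentiable_conj (fun z : C => K (scale (one_at j z) y) x : C)).
  by apply: Kz; rewrite // normc_conj.
have zz := normc_mul_conj z1.
rewrite /f symK ?z1// -(@rotation j z x (scale (one_at j (conjc z)) y))//.
  by rewrite scaleA one_atM zz one_at1 scale1 subrr.
by apply: Dj; rewrite // normc_conj z1.
Qed.

Definition conj_row (c : V) : V := \row_i conjc (c 0 i).

Lemma kernel_scale (c : V) : (forall i, normc (c 0 i) <= 1) ->
  (forall i, c 0 i = 1 \/ star_at D i) -> forall x y, D x -> D y ->
  D (scale c x) /\ K (scale c x) y = K x (scale (conj_row c) y).
Proof.
move=> c1 cS.
pose cr (c : V) (r : nat) : V := \row_(i < N) (if (i < r)%N then c 0 i else 1).
have step (d : V) r (rN : (r < N)%N) : cr d r.+1 = scale (one_at (Ordinal rN) (d 0 (Ordinal rN))) (cr d r).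
  apply/rowP => i; rewrite !mxE ltnS leq_eqVlt -val_eqE /=.
  case: (eqVneq (val i) r) => [ir|_] /=; last by rewrite mul1r.
  by rewrite ir ltnn mulr1; congr (d 0 _); apply: val_inj.
suff H r : (r <= N)%N -> forall x y, D x -> D y ->
    D (scale (cr c r) x) /\ K (scale (cr c r) x) y = K x (scale (cr (conj_row c) r) y).
  have e (d : V) : cr d N = d by apply/rowP => i; rewrite mxE ltn_ord.
  by move=> x y Dx Dy; have := H N (leqnn _) x y Dx Dy; rewrite !e.
elim: r => [_|r IH rN] x y Dx Dy.
  have e (d : V) : cr d 0%N = const_mx 1 by apply/rowP => i; rewrite !mxE.
  by rewrite !e !scale1.
have [Dr Er] := IH (ltnW rN) x y Dx Dy.
rewrite !(step _ _ rN) -!scaleA; set j := Ordinal rN.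
have -> : conj_row c 0 j = conjc (c 0 j) by rewrite mxE.
have [cj|sj] := cS j.
  by rewrite cj rmorph1 one_at1 !scale1.
split; first exact: sj.
have Dy' : D (scale (one_at j (conjc (c 0 j))) y) by apply: sj; rewrite ?normc_conj.
rewrite kernel_one_at// (IH (ltnW rN) _ _ Dx Dy').2; congr K.
by apply/rowP => i; rewrite !mxE mulrCA.
Qed.

End Kernel.
End Scaling.

(** * Hartogs domains *)
Section Dilation.
Variable R : realType.
Local Notation C := (R[i]^o).

Lemma row_continuous (T : topologicalType) N (f : T -> 'rV[C]_N) :
  (forall j, continuous (fun x => f x 0 j : C)) -> continuous f.
Proof.
move=> fc x U /nbhs_rVP[e e0 eU].
have H : \forall y \near nbhs x, forall j, normc (f y 0 j - f x 0 j) < e.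
  apply: filter_forall => j.
  have P := @cvg_complexP _ _ (nbhs x) _ (fun x => f x 0 j) (f x 0 j).
  by have /P H := fc j x; exact: H.
by apply: (filterS _ H) => y Hy; exact: eU.
Qed.

Variables (n m k : nat) (gam : 'I_n -> R) (Om : set 'rV[C]_(n + m)).
Hypotheses (gam0 : forall j, 0 < gam j) (oO : open Om) (sO : star_hartogs Om).

(** One-parameter family of dilations, additive in [s]. The dilation [delta_w] is
    [dil (sqnorm w / 2)], and the fibre of [V] over [w] is the preimage of [Om] under its
    inverse. *)
Definition dil (s : R) : 'rV[C]_(n + m) :=
  row_mx (\row_j (expR (- (gam j * s)))%:C) (const_mx 1).

Lemma scale_row_mx N M (a x : 'rV[C]_N) (b y : 'rV[C]_M) :
  scale (row_mx a b) (row_mx x y) = row_mx (scale a x) (scale b y).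
Proof.
by apply/rowP => i; case: (split_ordP i) => j ->; rewrite !(row_mxEl, row_mxEr, mxE).
Qed.

Lemma dilE s (z : 'rV[C]_n) (z' : 'rV[C]_m) : scale (dil s) (row_mx z z') =
  row_mx (\row_j ((expR (- (gam j * s)))%:C * z 0 j)) z'.
Proof.
by rewrite /dil scale_row_mx scale1; congr row_mx; apply/rowP => j; rewrite !mxE.
Qed.

Lemma dilD s t x : scale (dil s) (scale (dil t) x) = scale (dil (s + t)) x.
Proof.
rewrite -[x]hsubmxK !dilE; congr row_mx; apply/rowP => j.
by rewrite !mxE mulrA -rmorphM -expRD -opprD -mulrDr.
Qed.

Lemma dil0 x : scale (dil 0) x = x.
Proof.
rewrite -[x]hsubmxK dilE; congr row_mx; apply/rowP => j.
by rewrite !mxE mulr0 oppr0 expR0 mul1r.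
Qed.

Lemma dil_coord s (i : 'I_(n + m)) : exists2 a : R, 0 < a & dil s 0 i = a%:C.
Proof.
case: (split_ordP i) => j ->.
  by exists (expR (- (gam j * s))); rewrite ?expR_gt0// row_mxEl mxE.
by exists 1; rewrite // row_mxEr mxE.
Qed.

Lemma conj_row_dil s : conj_row (dil s) = dil s.
Proof. by apply/rowP => i; rewrite mxE; have [a _ ->] := dil_coord s i; rewrite /= oppr0. Qed.

Lemma dil_neq0 s i : dil s 0 i != 0.
Proof.
have [a a0 ->] := dil_coord s i; apply/eqP => /(congr1 (@complex.Re R)) /= az.
by rewrite az ltxx in a0.
Qed.

Lemma normc_dil s i : 0 <= s -> normc (dil s 0 i) <= 1.
Proof.
move=> s0; case: (split_ordP i) => j ->.
  rewrite row_mxEl mxE normc_real ger0_norm ?expR_ge0// -expR0 ler_expR oppr_le0.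
  by rewrite mulr_ge0// ltW.
by rewrite row_mxEr mxE normc1.
Qed.

Lemma star_at_lshift j : star_at Om (lshift m j).
Proof.
move=> x a a1 Ox; rewrite -[x]hsubmxK in Ox *.
have H i : csq (one_at j a 0 i) <= 1.
  by rewrite csq_le1 mxE; case: (i == j); rewrite ?normc1.
have := sO Ox H.
rewrite (_ : scale _ _ = row_mx (\row_i (one_at j a 0 i * lsubmx x 0 i)) (rsubmx x)) //.
apply/rowP => i; rewrite [LHS]mxE; case: (split_ordP i) => l ->.
  by rewrite !row_mxEl [RHS]mxE ![one_at _ _ _ _]mxE (inj_eq (@lshift_inj _ _)).
by rewrite !row_mxEr mxE eq_rlshift mul1r.
Qed.

Lemma dil_star s i : dil s 0 i = 1 \/ star_at Om i.
Proof.
case: (split_ordP i) => j ->; last by left; rewrite row_mxEr mxE.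
by right; exact: star_at_lshift.
Qed.

Lemma dil_in s x : 0 <= s -> Om x -> Om (scale (dil s) x).
Proof.
move=> s0; rewrite -[x]hsubmxK dilE => Ox.
have H j : csq ((\row_j (expR (- (gam j * s)))%:C : 'rV[C]_n) 0 j) <= 1.
  rewrite mxE csq_le1 normc_real ger0_norm ?expR_ge0// -expR0 ler_expR oppr_le0.
  by rewrite mulr_ge0// ltW.
have := sO Ox H.
rewrite (_ : (\row_j ((\row_j (expR (- (gam j * s)))%:C) 0 j * lsubmx x 0 j)) =
   \row_j ((expR (- (gam j * s)))%:C * lsubmx x 0 j)); last first.
  by apply/rowP => j; rewrite !mxE.
exact.
Qed.

Lemma kernel_dil K s x y : is_bergman_kernel Om K -> 0 <= s -> Om x -> Om y ->
  K (scale (dil s) x) y = K x (scale (dil s) y).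
Proof.
move=> kK s0 Ox Oy.
by have [_ ->] := kernel_scale oO kK (fun i => normc_dil i s0) (dil_star s) Ox Oy;
  rewrite conj_row_dil.
Qed.

Lemma prod_csq_dil s : \prod_i csq (dil s 0 i) = expR (- (2 * (\sum_j gam j) * s)).
Proof.
rewrite big_split_ord /= [X in _ * X]big1 => [|i _]; last first.
  by rewrite row_mxEr mxE csq_normc normc1 expr1n.
rewrite mulr1 (_ : - _ = \sum_j - (2 * gam j * s)); last first.
  by rewrite mulr_sumr mulr_suml sumrN.
rewrite expR_sum.
apply: eq_bigr => j _; rewrite row_mxEl mxE csq_normc normc_real ger0_norm ?expR_ge0//.
by rewrite expr2 -expRD; congr expR; ring.
Qed.

Lemma VgamE (p : 'rV[C]_(n + m + k)) : Vgam gam Om p <->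
  Om (scale (dil (- (sqnorm (rsubmx p) / 2))) (lsubmx p)).
Proof.
rewrite -[X in scale _ X]hsubmxK dilE /Vgam /=.
rewrite (_ : g_gamma _ _ _ = \row_j ((expR (- (gam j * - (sqnorm (rsubmx p) / 2))))%:C *
  lsubmx (lsubmx p) 0 j))//.
by apply/rowP => j; rewrite !mxE mulrN opprK mulrA.
Qed.

Local Notation V := (Vgam (k := k) gam Om).

Lemma real_complex_continuous : continuous (fun x : R => x%:C : C).
Proof.
move=> x; have := @complex_line_continuous R 0 1 x.
rewrite (_ : (fun t : R => 0 + t%:C * 1 : C) = (fun x : R => x%:C : C))//.
by apply/funext => t; rewrite add0r mulr1.
Qed.

Lemma sqnorm_continuous N : continuous (fun x : 'rV[C]_N => sqnorm x).
Proof.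
have sc (r : seq 'I_N) : continuous (fun x : 'rV[C]_N => \sum_(j <- r) csq (x 0 j)).
  elim: r => [|j r IH] x.
    rewrite (_ : (fun v => _) = fun=> 0); first exact: cst_continuous.
    by apply/funext => u; rewrite big_nil.
  rewrite (_ : (fun v => _) = fun v : 'rV[C]_N => csq (v 0 j) + \sum_(i <- r) csq (v 0 i)).
    have cj := differentiable_continuous (differentiable_coordC j x).
    exact: (continuousD (continuous_comp cj (@csq_continuous R _)) (IH x)).
  by apply/funext => u; rewrite big_cons.
exact: sc.
Qed.

Lemma dil_continuous (T : topologicalType) (t : T -> R) (q : T -> 'rV[C]_(n + m)) :
  continuous t -> (forall j, continuous (fun x => q x 0 j : C)) ->
  continuous (fun x => scale (dil (t x)) (q x)).
Proof.
move=> tc qc; apply: row_continuous => j x.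
rewrite (_ : (fun x => _) = (fun x => dil (t x) 0 j * q x 0 j : C)); last first.
  by apply/funext => y; rewrite mxE.
apply: (continuousM _ (qc j x)); case: (split_ordP j) => l ->; last first.
  rewrite (_ : (fun x => _) = fun=> 1); first exact: cst_continuous.
  by apply/funext => y; rewrite row_mxEr mxE.
rewrite (_ : (fun x => _) = (fun y => (expR (- (gam l * t y)))%:C : C)); last first.
  by apply/funext => y; rewrite row_mxEl mxE.
exact: (continuous_comp (continuous_comp (tc x) (@continuous_expN R (gam l) _))
  (@real_complex_continuous _)).
Qed.

Lemma open_Vgam : open V.
Proof.
have sc := @rsubmx_continuous R (n + m) k.
have tc : continuous (fun p : 'rV[C]_(n + m + k) => - (sqnorm (rsubmx p) / 2)).
  have hc : continuous (fun s : R => - (s / 2)).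
    by move=> s; apply: cvgN; apply: cvgMl; exact: cvg_id.
  by move=> p; exact: (continuous_comp (continuous_comp (sc p) (@sqnorm_continuous k _)) (hc _)).
have := @dil_continuous _ _ _ tc (fun j p => differentiable_continuous (differentiable_lsub j p)).
move=> /continuousP/(_ _ oO); congr open; apply/seteqP; split => p; by move/VgamE.
Qed.

(** Shrinking a coordinate of [w] lowers [sqnorm w], which amounts to a further dilation by a
    nonnegative parameter, and such dilations preserve [Om]. *)
Lemma Vgam_star_w i : star_at V (rshift (n + m) i).
Proof.
move=> p a a1 /VgamE Vp; apply/VgamE.
have -> : lsubmx (scale (one_at (rshift (n + m) i) a) p) = lsubmx p.
  by apply/rowP => j; rewrite !mxE eq_lrshift mul1r.
have -> : rsubmx (scale (one_at (rshift (n + m) i) a) p) = scale (one_at i a) (rsubmx p).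
  by apply/rowP => j; rewrite !mxE (inj_eq (@rshift_inj _ _)).
set w := rsubmx p in Vp *.
have le : sqnorm (scale (one_at i a) w) <= sqnorm w.
  apply: ler_sum => j _; rewrite !mxE csqM; case: (j == i).
    by rewrite ler_piMl ?csq_ge0// csq_le1.
  by rewrite ler_piMl ?csq_ge0// csq_le1 normc1.
have s0 : 0 <= (sqnorm w - sqnorm (scale (one_at i a) w)) / 2 by lra.
have := dil_in s0 Vp; rewrite dilD; congr (Om (scale (dil _) _)); lra.
Qed.

(* [kernel_scale] with the factor 0 on the coordinates of [w] *)
Lemma Vgam_kernel_w K x w y : is_bergman_kernel V K -> V (row_mx x w) -> V (row_mx y 0) ->
  V (row_mx x 0) /\ K (row_mx x w) (row_mx y 0) = K (row_mx x 0) (row_mx y 0).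
Proof.
move=> kK Vx Vy; pose c : 'rV[C]_(n + m + k) := row_mx (const_mx 1) 0.
have c1 i : normc (c 0 i) <= 1.
  by case: (split_ordP i) => j ->; rewrite ?row_mxEl ?row_mxEr !mxE ?normc1 ?normc0.
have cS i : c 0 i = 1 \/ star_at V i.
  case: (split_ordP i) => j ->; first by left; rewrite row_mxEl mxE.
  by right; exact: Vgam_star_w.
have c0 u : scale (0 : 'rV[C]_k) u = 0 by apply/rowP => j; rewrite !mxE mul0r.
have cc : conj_row c = c.
  apply/rowP => i; rewrite mxE; case: (split_ordP i) => j ->.
    by rewrite !row_mxEl !mxE rmorph1.
  by rewrite !row_mxEr !mxE rmorph0.
have [] := kernel_scale open_Vgam kK c1 cS Vx Vy.
by rewrite cc /c !scale_row_mx !scale1 !c0 => ? ->.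
Qed.

End Dilation.

Section PathBound.
Variable R : realType.
Local Notation C := (R[i]^o).
Variables (n m k : nat) (gam : 'I_n -> R) (Om : set 'rV[C]_(n + m)).
Hypotheses (gam0 : forall j, 0 < gam j) (oO : open Om) (sO : star_hartogs Om).
Local Notation dil := (@dil R n m gam).

Lemma normc_continuous : continuous (@normc R : C -> R).
Proof.
move=> z; have P := @cvgrPdist_lt _ _ _ (nbhs z) _ (@normc R : C -> R).
apply/P => e e0; apply/nbhs_complexP; exists e => // y yz.
rewrite ltr_distl; have h1 := normcD_le (y - z) z; have h2 := normcD_le (z - y) y.
move: h1 h2; rewrite !subrK normc_subC => h1 h2; rewrite normc_subC in yz.
apply/andP; split; lra.
Qed.

Lemma path_continuous p : continuous (fun s => scale (dil s) p).
Proof.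
apply: (@dil_continuous R n m gam R id (fun=> p)) => [x|j x]; first exact: cvg_id.
exact: cst_continuous.
Qed.

(** Continuity at the limit of the path bounds [h] for large [s], and the extreme value theorem
    bounds it on the compact rest. *)
Lemma path_bounded (h : 'rV[C]_(n + m) -> C) p :
  (forall x, Om x -> {for x, continuous h}) -> Om p ->
  exists M : R, forall s, 0 <= s -> normc (h (scale (dil s) p)) <= M.
Proof.
(* The limit [(0, z')] of the path lies in [Om] because the factors 0 are allowed in
   [star_hartogs]. *)
move=> hc Op; pose p0 := scale (row_mx 0 (const_mx 1)) p.
have Op0 : Om p0.
  have H j : csq ((0 : 'rV[C]_n) 0 j) <= 1 by rewrite mxE csq_le1 normc0 ler01.
  have Op' := Op; rewrite -[p]hsubmxK in Op'; have := sO Op' H.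
  rewrite (_ : row_mx _ _ = p0)// /p0 -[p in RHS]hsubmxK scale_row_mx scale1.
  by congr row_mx; apply/rowP => j; rewrite !mxE.
have /continuous_rVP /(_ 1 ltr01)[d d0 dH] := hc p0 Op0.
have : \forall s \near +oo, forall j : 'I_n, expR (- (gam j * s)) * normc (p 0 (lshift m j)) < d.
  apply: filter_forall => j.
  have E : expR (- (gam j * s)) * normc (p 0 (lshift m j)) @[s --> +oo] --> (0 : R).
    rewrite -(mul0r (normc (p 0 (lshift m j)))); apply: cvgMl; exact: cvg_expN.
  move/cvgrPdist_lt : E => /(_ d d0); apply: filterS => s.
  by rewrite sub0r normrN ger0_norm// mulr_ge0 ?expR_ge0 ?normc_ge0.
case=> S [_ SH].
pose T := Num.max S 0 + 1.
have S0 : 0 <= Num.max S 0 by rewrite le_max lexx orbT.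
have ST s : T <= s -> S < s.
  have : S <= Num.max S 0 by rewrite le_max lexx.
  by rewrite /T; lra.
have pc s : 0 <= s -> {for s, continuous (fun s => normc (h (scale (dil s) p)))}.
  move=> s0; have c1 := @path_continuous p s.
  have c2 := hc _ (dil_in gam0 sO s0 Op).
  exact: (continuous_comp (continuous_comp c1 c2) (@normc_continuous _)).
have T0 : 0 <= T by rewrite addr_ge0.
have wc : {within `[0, T], continuous (fun s => normc (h (scale (dil s) p)))}.
  apply: continuous_in_subspaceT => s; rewrite inE /= in_itv /= => /andP[s0 _].
  exact: pc.
have [c _ cM] := EVT_max T0 wc.
exists (normc (h (scale (dil c) p)) + normc (h p0) + 1) => s s0.
have n1 := normc_ge0 (h (scale (dil c) p)); have n2 := normc_ge0 (h p0).
have [sT|Ts] := leP s T.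
  have := cM s; rewrite in_itv /= s0 sT => /(_ isT); lra.
suff lt1 : normc (h (scale (dil s) p) - h p0) < 1.
  have := normcD_le (h (scale (dil s) p) - h p0) (h p0); rewrite subrK; lra.
apply: dH => j; rewrite /p0 ![scale _ _ 0 j]mxE; case: (split_ordP j) => l ->.
  rewrite !row_mxEl !mxE mul0r subr0 normcM normc_real ger0_norm ?expR_ge0//.
  by apply: SH; apply: ST; exact: ltW.
by rewrite !row_mxEr subrr normc0.
Qed.

End PathBound.

Section L2prod.
Variables (R : realType) (N : nat).
Local Notation C := (R[i]^o).

Lemma l2prod_conj (D : set 'rV[C]_N) f g x : conjc (l2prod D f g x) = l2prod D g f x.
Proof.
by apply: complexP; rewrite ?Re_conj ?Im_conj ?l2prod_Re ?l2prod_Im; ring.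
Qed.

Lemma cintC_l2prod_conj (D : set 'rV[C]_N) f g : open D -> bergman_space D f -> bergman_space D g ->
  conjc (cintC (l2prod D f g)) = cintC (l2prod D g f).
Proof.
move=> oD bf bg; rewrite -(cintC_conj (l2prod_Cintegrable oD bf bg)).
by congr cintC; apply/funext => x; rewrite l2prod_conj.
Qed.

Lemma kernel_diag (D : set 'rV[C]_N) K y : open D -> is_bergman_kernel D K -> D y ->
  cint (fun x => ((\1_D x : R) * csq (K x y))%:E) = (complex.Re (K y y))%:E.
Proof.
move=> oD [KB KR] Dy; rewrite (KR _ (KB y Dy) y Dy) cintCE /=.
rewrite -cintegrableE; last exact: (l2prod_Cintegrable oD (KB y Dy) (KB y Dy)).1.
congr cint; apply/funext => x; rewrite /= -/(l2prod D (K^~ y) (K^~ y) x) l2prod_Re.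
by rewrite /csq !expr2.
Qed.

End L2prod.

(** * Integral formula relating the kernels of [Om] and [V] *)

Section Core.
Variable R : realType.
Local Notation C := (R[i]^o).
Variables (n m k : nat) (gam : 'I_n -> R) (Om : set 'rV[C]_(n + m)).
Hypotheses (gam0 : forall j, 0 < gam j) (oO : open Om) (sO : star_hartogs Om).
Local Notation dil := (@dil R n m gam).
Local Notation V := (Vgam (k := k) gam Om).
Let c := \sum_j gam j.
Hypothesis c0 : 0 < c.
Variables (KO : 'rV[C]_(n + m) -> 'rV[C]_(n + m) -> C)
  (KV : 'rV[C]_(n + m + k) -> 'rV[C]_(n + m + k) -> C).
Hypotheses (kO : is_bergman_kernel Om KO) (kV : is_bergman_kernel V KV).

Let oV : open V. Proof. exact: open_Vgam. Qed.

Lemma Vgam_row_mx q w : V (row_mx q w) <-> Om (scale (dil (- (sqnorm w / 2))) q).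
Proof. by rewrite VgamE row_mxKl row_mxKr. Qed.

Lemma Vgam_row_mx0 q : V (row_mx q 0) <-> Om q.
Proof.
rewrite Vgam_row_mx (_ : sqnorm 0 = 0) ?mul0r ?oppr0 ?dil0//.
by rewrite /sqnorm big1// => i _; rewrite mxE /csq /= expr0n /= addr0.
Qed.

Lemma indic_Vgam q w : \1_V (row_mx q w) = \1_Om (scale (dil (- (sqnorm w / 2))) q) :> R.
Proof.
rewrite !indicE; congr (nat_of_bool _)%:R.
by apply/idP/idP; rewrite !inE => /Vgam_row_mx.
Qed.

Let dilK s q : scale (dil s) (scale (dil (- s)) q) = q.
Proof. by rewrite dilD subrr dil0. Qed.

Let inv_prod s : (\prod_j csq (dil (- s) 0 j))^-1 = expR (- (2 * c * s)).
Proof. by rewrite prod_csq_dil -expRN opprK mulrN. Qed.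

Lemma ge0_cint_dil s F : cmeas F -> (forall x, (0 <= F x)%E) ->
  cint (fun q => F (scale (dil (- s)) q)) = ((expR (- (2 * c * s)))%:E * cint F)%E.
Proof.
move=> mF F0; rewrite -inv_prod -(ge0_cint_affine 0 _ mF F0); last exact: dil_neq0.
by congr cint; apply/funext => q; rewrite affrow0.
Qed.

Lemma cintR_dil s h : cintegrable h -> cintegrable (fun q => h (scale (dil (- s)) q)) /\
  cintR (fun q => h (scale (dil (- s)) q)) = expR (- (2 * c * s)) * cintR h.
Proof.
move=> hi; rewrite -inv_prod.
have := cintR_affine 0 (@dil_neq0 R n m gam (- s)) hi.
by rewrite (_ : (fun q => _) = (fun q => h (scale (dil (- s)) q)))//;
  apply/funext => q; rewrite affrow0.
Qed.

Let half (w : 'rV[C]_k) : 0 <= sqnorm w / 2.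
Proof. by rewrite divr_ge0// sqnorm_ge0. Qed.

Let pull_in w q : V (row_mx q w) -> Om q.
Proof. by move=> /Vgam_row_mx/(dil_in gam0 sO (half w)); rewrite dilK. Qed.

Section Point.
Variable p : 'rV[C]_(n + m).
Hypothesis Op : Om p.

Let g (x : 'rV[C]_(n + m + k)) := KO (lsubmx x) p.

Let g_holomorphic : holomorphic_on V g.
Proof.
apply: (holomorphic_comp oO (kO.1 p Op).1) => [x Vx|x j _]; last exact: differentiable_lsub.
by rewrite -[x]hsubmxK in Vx; exact: pull_in Vx.
Qed.

(** Rescaling the fibre to [Om] costs [e^(-c |w|^2)]. Moving the dilation to the other argument
    leaves the squared norm of [KO(., dil s p)], a diagonal value of [KO]. *)
Let section_norm w : cint (fun q => ((\1_V (row_mx q w) : R) * csq (g (row_mx q w)))%:E) =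
  (expR (- (c * sqnorm w)) * complex.Re (KO (scale (dil (sqnorm w)) p) p))%:E.
Proof.
pose s := sqnorm w / 2; have s0 : 0 <= s by exact: half.
have Ops := dil_in gam0 sO s0 Op.
pose F x := ((\1_Om x : R) * csq (KO x (scale (dil s) p)))%:E.
have mF : cmeas F.
  exact: (bergman_cintegrable oO (kO.1 _ Ops)).1.
have F0 x : (0 <= F x)%E by rewrite lee_fin mulr_ge0// csq_ge0.
transitivity (cint (fun q => F (scale (dil (- s)) q))).
  congr cint; apply/funext => q; rewrite /F /g row_mxKl indic_Vgam -/s; congr (_%:E).
  rewrite indicE; case: (boolP (_ \in Om)) => [|_]; last by rewrite !mul0r.
  by rewrite inE => Oq; rewrite -(kernel_dil gam0 oO sO kO s0)// dilK.
rewrite ge0_cint_dil// /F kernel_diag// -(kernel_dil gam0 oO sO kO s0)// dilD -EFinM.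
by rewrite /s -splitr; congr (expR (- _) * _)%:E; field.
Qed.

(** By [path_bounded] the fibre norms are at most [M e^(-c |w|^2)], which is integrable over [C^k]
    because [c > 0]. *)
Let g_bergman : bergman_space V g.
Proof.
split; first exact: g_holomorphic.
have [M HM] := path_bounded gam0 sO (fun x Ox => (kO.1 p Op).1.1 x Ox) Op.
have M0 : 0 <= M by exact: le_trans (normc_ge0 _) (HM 0 (lexx 0)).
rewrite cint_split.
have fin := (ge0_radial_cintegrable k 0 c0 (exp_dominated_exp c M0) _).1.
have [|_] := fin; first by move=> s; rewrite mulr_ge0// expR_ge0.
apply: le_lt_trans; apply: le_cint.
- apply: (@cmeas_cint R (n + m) k (fun x => ((\1_V x : R) * csq (g x))%:E)).
  apply: (cmeas_continuous (h := fun x => csq (g x)) oV) => x Vx.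
  exact: (continuous_comp (g_holomorphic.1 x Vx) (@csq_continuous R _)).
- apply: cmeas_norm; apply: (@cmeas_radial R k (fun s => M * expR (- (c * (0 + s))))).
  apply: measurable_funM => //; apply: measurableT_comp => //.
  by apply: measurableT_comp => //; apply: measurable_funM => //; apply: measurable_funD.
- by move=> w; apply: cint_ge0 => q; rewrite lee_fin mulr_ge0// csq_ge0.
move=> w; rewrite section_norm lee_fin add0r ger0_norm ?mulr_ge0 ?expR_ge0// mulrC.
apply: ler_wpM2r; first exact: expR_ge0.
apply: (le_trans (ler_norm _)); apply: (le_trans (Re_le_normc _)); apply: HM.
exact: sqnorm_ge0.
Qed.

Variable y : 'rV[C]_(n + m).
Hypothesis Oy : Om y.
Let Vy : V (row_mx y 0). Proof. exact/Vgam_row_mx0. Qed.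
Let Q x := KV (row_mx x 0) (row_mx y 0).

Lemma Vgam_slice_holomorphic : holomorphic_on Om (fun x => KV (row_mx x 0) (row_mx y 0)).
Proof.
apply: (holomorphic_comp oV (kV.1 _ Vy).1) => [x|x j _]; first by move/Vgam_row_mx0.
case: (split_ordP j) => i ->.
  have -> : (fun u : 'rV[C]_(n + m) => row_mx u (0 : 'rV[C]_k) 0 (lshift k i) : C) =
      (fun u => u 0 i : C) by apply/funext => u; rewrite row_mxEl.
  exact: differentiable_coordC.
have -> : (fun u : 'rV[C]_(n + m) => row_mx u (0 : 'rV[C]_k) 0 (rshift (n + m) i) : C) =
    fun=> 0 by apply/funext => u; rewrite row_mxEr mxE.
exact: differentiable_cst.
Qed.

Let Q_holomorphic : holomorphic_on Om Q := Vgam_slice_holomorphic.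

Let Qs_holomorphic s : 0 <= s -> holomorphic_on Om (fun x => Q (scale (dil s) x)).
Proof.
move=> s0; apply: (holomorphic_comp oO Q_holomorphic) => [x|x j _]; first exact: dil_in.
exact: differentiable_scale.
Qed.

Let H w := cint (fun q => ((\1_V (row_mx q w) : R) * csq (KV (row_mx q w) (row_mx y 0)))%:E).

(** Square integrability on [V] gives finite fibre norm only for almost every [w]. The condition is
    kept explicit here and discharged through [cint_ae]. *)
Let section_bergman w : (H w < +oo)%E ->
  bergman_space Om (fun x => Q (scale (dil (sqnorm w / 2)) x)).
Proof.
set s := sqnorm w / 2 => Hw; split; first exact/Qs_holomorphic/half.
pose F x := ((\1_Om x : R) * csq (Q (scale (dil s) x)))%:E.
have mF : cmeas F.
  apply: (cmeas_continuous (h := fun x => csq (Q (scale (dil s) x))) oO) => x Ox.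
  exact: (continuous_comp ((Qs_holomorphic (half w)).1 x Ox) (@csq_continuous R _)).
have F0 x : (0 <= F x)%E by rewrite lee_fin mulr_ge0// csq_ge0.
have HE : H w = cint (fun q => F (scale (dil (- s)) q)).
  congr cint; apply/funext => q; rewrite /F indic_Vgam -/s; congr (_%:E).
  rewrite indicE; case: (boolP (_ \in Om)) => [|_]; last by rewrite !mul0r.
  rewrite inE => Oq; rewrite dilK /Q; congr (_ * csq _).
  by apply: (Vgam_kernel_w gam0 oO sO kV _ Vy).2; exact/Vgam_row_mx.
move: Hw; rewrite HE ge0_cint_dil// => Hw.
change (cint F < +oo)%E; case: (cint F) Hw => [r _|+|_] //=; first exact: ltry.
by rewrite gt0_muley ?lte_fin ?expR_gt0.
Qed.

Section Part.
(** The formula is stated through a real functional compatible with integration, since [radial_ode]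
    is about real functions. It is used with [l a = Re (b a)]. *)
Variable l : C -> R.
Hypothesis lc : continuous l.
Hypothesis lI : forall N (F : 'rV[C]_N -> C), Cintegrable F ->
  cintegrable (l \o F) /\ l (cintC F) = cintR (l \o F).

(* Pair [KO(., p)], extended to [V] independently of [w], with [KV(., (y, 0))] and
   integrate over the fibres: the fibre over [w] is a dilate of [Om], on which [KO]
   reproduces. *)
Lemma kernel_integral : l (KO p y) =
  cintR (fun w : 'rV[C]_k => expR (- (c * sqnorm w)) *
    l (KV (row_mx (scale (dil (sqnorm w)) p) 0) (row_mx y 0))).
Proof.
pose f x := KV x (row_mx y 0).
have bf : bergman_space V f by exact: kV.1.
have gy : g (row_mx y 0) = KO y p by rewrite /g row_mxKl.
have -> : KO p y = cintC (l2prod V f g).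
  rewrite (kernel_sym oO kO kO Op Oy) -gy (kV.2 _ g_bergman _ Vy).
  exact: (cintC_l2prod_conj oV g_bergman bf).
have [hi ->] := lI (l2prod_Cintegrable oV bf g_bergman).
rewrite /cintR; congr fine; rewrite cint_split.
have mf := (bergman_cintegrable oV bf).1.
have Hoo : (cint H < +oo)%E by rewrite -(cint_split (fun x => ((\1_V x : R) * csq (f x))%:E)) bf.2.
apply: (cint_ae (H := H)) => //.
- exact: (cmeas_cint mf).
- by move=> w; apply: cint_ge0 => q; rewrite lee_fin mulr_ge0// csq_ge0.
- exact: (cmeas_cint hi.1).
- have cq : forall w : 'rV[C]_k, setT w -> {for w, continuous (fun w : 'rV[C]_k =>
      expR (- (c * sqnorm w)) * l (Q (scale (dil (sqnorm w)) p)))}.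
    move=> w _.
    have C1 : {for w, continuous (fun w : 'rV[C]_k => expR (- (c * sqnorm w)))}.
      exact: (continuous_comp (@sqnorm_continuous R k w) (@continuous_expN R c _)).
    have c2 := continuous_comp (@sqnorm_continuous R k w) (@path_continuous R n m gam p _).
    have c3 := Q_holomorphic.1 _ (dil_in gam0 sO (sqnorm_ge0 w) Op).
    have C2 : {for w, continuous (fun w : 'rV[C]_k => l (Q (scale (dil (sqnorm w)) p)))}.
      by apply: continuous_comp (continuous_comp c2 c3) _; exact: lc.
    exact: (continuousM C1 C2).
  have := cmeas_continuous openT cq.
  by under eq_fun do rewrite indicT mul1r.
move=> w Hw; pose s := sqnorm w / 2; have s0 : 0 <= s by exact: half.
have Ops := dil_in gam0 sO s0 Op.
have bQ := section_bergman Hw.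
have [Li LE] := lI (l2prod_Cintegrable oO bQ (kO.1 _ Ops)).
have [di dE] := cintR_dil s Li.
rewrite (_ : (fun q => _) = EFin \o (fun q => (l \o l2prod Om (fun x => Q (scale (dil s) x))
    (KO^~ (scale (dil s) p))) (scale (dil (- s)) q))); last first.
  apply/funext => q /=; congr (_%:E); congr l.
  rewrite /l2prod indic_Vgam -/s.
  rewrite indicE; case: (boolP (_ \in Om)) => [|_]; last by rewrite !mul0r.
  rewrite inE => Oq; rewrite dilK -(kernel_dil gam0 oO sO kO s0)// dilK /g row_mxKl.
  congr (_ * _ * _); apply: (Vgam_kernel_w gam0 oO sO kV _ Vy).2; exact/Vgam_row_mx.
(* One dilation by [s = |w|^2 / 2] comes from rescaling the fibre, a second one from reproducing at
   [dil s p]; together they give [dil (sqnorm w)]. *)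
rewrite (cintegrableE di) dE -LE -(kO.2 _ bQ _ Ops) dilD /s -splitr.
by congr (expR (- _) * _)%:E; field.
Qed.

End Part.
End Point.
End Core.

(** * The operator [Lop] along dilation paths *)

Section EulerOperator.
Variable R : realType.
Local Notation C := (R[i]^o).
Variables (n : nat) (gam : 'I_n -> R).
Local Notation e_ j := (delta_mx 0 j : 'rV[C]_n).

Lemma chain_rule_row (D : set 'rV[C]_n) (G : 'rV[C]_n -> C) (h : 'I_n -> C -> C) (dh : 'I_n -> C) (t : C) :
  open D -> holomorphic_on D G -> D (\row_j h j t) -> (forall j, is_derive t 1 (h j) (dh j)) ->
  is_derive t 1 (fun s => G (\row_j h j s)) (\sum_j dh j * 'D_(e_ j) G (\row_j h j t)).
Proof.
move=> oD hG Dt hd; pose H (s : C) : 'rV[C]_n := \row_j h j s.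
have HE : H = \sum_(j < n) (fun s => h j s *: e_ j).
  apply/funext => s; rewrite fct_sumE [LHS]row_sum_delta.
  by apply: eq_bigr => j _; rewrite mxE.
have hdiff j : differentiable (h j) t by apply/derivable1_diffP; have [] := hd j.
have Hdiff : differentiable H t.
  by rewrite HE; apply: differentiable_sum => j; apply: differentiableZl.
have Hder : is_derive t 1 H (\sum_j dh j *: e_ j).
  rewrite HE; apply: is_derive_sum => j.
  have zd : differentiable (fun s => h j s *: e_ j) t by exact: differentiableZl.
  apply: DeriveDef; first exact: diff_derivable.
  by rewrite deriveE// diffZl//= -deriveE//; have [_ ->] := hd j.
have Gdiff := holomorphic_differentiable oD hG Dt.
apply: DeriveDef; first by apply: diff_derivable; exact: (differentiable_comp Hdiff Gdiff).
rewrite deriveE; last exact: (differentiable_comp Hdiff Gdiff).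
rewrite (diff_comp Hdiff Gdiff) /= -(deriveE _ Hdiff); have [_ ->] := Hder.
by rewrite linear_sum; apply: eq_bigr => j _; rewrite linearZ -deriveE.
Qed.

Lemma Lop_holomorphic (D : set 'rV[C]_n) (G : 'rV[C]_n -> C) : open D -> holomorphic_on D G ->
  holomorphic_on D (Lop gam G).
Proof.
move=> oD hG; apply: differentiable_holomorphic => x Dx.
have -> : Lop gam G = \sum_(j < n) (fun z => (gam j)%:C * (G z + z 0 j * 'D_(e_ j) G z)).
  by apply/funext => z; rewrite fct_sumE.
apply: differentiable_sum => j.
have d1 := holomorphic_differentiable oD hG Dx.
have d2 := holomorphic_differentiable oD (partial_holomorphic oD hG j) Dx.
have d3 := differentiableD d1 (differentiableM (differentiable_coordC j x) d2).
exact: (differentiableM (differentiable_cst ((gam j)%:C : C) x) d3).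
Qed.

Lemma iter_Lop_holomorphic (D : set 'rV[C]_n) (G : 'rV[C]_n -> C) i : open D -> holomorphic_on D G ->
  holomorphic_on D (iter i (Lop gam) G).
Proof. by move=> oD hG; elim: i => [//|i IH]; rewrite iterS; exact: Lop_holomorphic. Qed.

Lemma cdiff_mulc (f : R[i] -> R[i]) (a t d : R[i]) : cdiff f (a * t) d ->
  cdiff (fun s => f (a * s)) t (a * d).
Proof.
move=> fd e e0; have a0 : 0 < normc a + 1 by rewrite ltr_wpDl ?normc_ge0.
have [r r0 rH] := fd _ (divr_gt0 e0 a0).
exists (r / (normc a + 1)); first exact: divr_gt0.
move=> u ud; have le1 : normc (a * u) <= (normc a + 1) * normc u.
  by rewrite normcM; apply: ler_wpM2r; [exact: normc_ge0|rewrite lerDl ler01].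
have ur : normc (a * u) < r by apply: (le_lt_trans le1); rewrite mulrC -ltr_pdivlMr.
have := rH _ ur; rewrite -mulrDr (mulrCA u) mulrA; move/le_trans; apply.
rewrite -mulrA ler_pM2l// mulrC ler_pdivrMr//.
by rewrite [X in _ <= X]mulrC; exact: le1.
Qed.

Lemma is_derive_cexpM (a t : C) : is_derive t 1 (fun s : C => cexp (- (a * s))) (- a * cexp (- (a * t))).
Proof.
have := @cdiff_mulc (@cexp R) (- a) t (cexp (- a * t)) (cdiff_cexp _).
rewrite (_ : (fun s => cexp (- a * s)) = fun s => cexp (- (a * s))).
  by rewrite [X in cexp X]mulNr => /cdiff_is_derive.
by apply/funext => s; rewrite mulNr.
Qed.

(** Differentiating the factor [e^(-cs)] gives the terms [gamma_j I], and the chain rule along the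
    path gives [gamma_j z_j d/dz_j], all with a minus sign. *)
Lemma euler_derivative (D : set 'rV[C]_n) (G : 'rV[C]_n -> C) (x : 'rV[C]_n) (t : C) :
  open D -> holomorphic_on D G -> let p s := \row_j (cexp (- ((gam j)%:C * s)) * x 0 j) in
  D (p t) ->
  is_derive t 1 (fun s : C => cexp (- ((\sum_j gam j)%:C * s)) * G (p s))
    (- (cexp (- ((\sum_j gam j)%:C * t)) * Lop gam G (p t))).
Proof.
move=> oD hG p Dt; set c := (\sum_j gam j)%:C.
have h1 j : is_derive t 1 (fun s : C => cexp (- ((gam j)%:C * s)) * x 0 j)
    (- (gam j)%:C * p t 0 j).
  have := is_deriveM (is_derive_cexpM (gam j)%:C t) (is_derive_cst (x 0 j : C) t 1).
  move=> /(@is_derive_eq _ _ _ _ _ _ _ _); apply.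
  by rewrite /GRing.scale /= mulr0 add0r mxE; ring.
have h2 := chain_rule_row oD hG Dt h1.
have h3 := is_deriveM (is_derive_cexpM c t) h2.
have LE : Lop gam G (p t) = c * G (p t) -
    \sum_j (- (gam j)%:C * p t 0 j) * 'D_(e_ j) G (p t).
  rewrite /c rmorph_sum mulr_suml -sumrN -big_split /=.
  by apply: eq_bigr => j _; ring.
apply: (is_derive_eq h3); rewrite LE /GRing.scale /=.
by set S := (\sum_j _); set E := cexp _; set g := G _; ring.
Qed.

Lemma open_scale (D : set 'rV[C]_n) (a : 'rV[C]_n) : open D -> open [set x | D (scale a x)].
Proof.
move=> oD; have := @row_continuous R _ n (scale a).
move=> /(_ (fun j x => differentiable_continuous (differentiable_scale a j x))).
by move=> /continuousP/(_ _ oD).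
Qed.

Lemma derive_scale (D : set 'rV[C]_n) (G : 'rV[C]_n -> C) (a x : 'rV[C]_n) j : open D ->
  holomorphic_on D G -> D (scale a x) ->
  'D_(e_ j) (fun u => G (scale a u)) x = a 0 j * 'D_(e_ j) G (scale a x).
Proof.
move=> oD hG Dx; have D0 : D (scale a x + (0 : C) *: e_ j) by rewrite scale0r addr0.
have := slice_cdiff hG D0; rewrite scale0r addr0.
rewrite -{1}(mulr0 (a 0 j)) => /cdiff_mulc H.
apply: (cdiff_derivable _).2; move: H.
rewrite (_ : (fun s => _) = (fun t : R[i] => G (scale a (x + (t : C) *: e_ j)))); first exact.
apply/funext => s; congr G; apply/rowP => i; rewrite !mxE /GRing.scale /=.
by case: eqP => [->|_]; rewrite /= ?mulr1 ?mulr0 ?addr0// mulrDr.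
Qed.

(** Each [z_j d/dz_j] commutes with coordinate scalings. This carries the operator past [lmap],
    which is linear and diagonal in [z]. *)
Lemma iter_Lop_scale (D : set 'rV[C]_n) (G : 'rV[C]_n -> C) (a : 'rV[C]_n) i : open D ->
  holomorphic_on D G -> forall x, D (scale a x) ->
  iter i (Lop gam) (fun u => G (scale a u)) x = iter i (Lop gam) G (scale a x).
Proof.
move=> oD hG; elim: i => [//|i IH] x Dx; rewrite !iterS /Lop; apply: eq_bigr => j _.
have S0 : scale a x 0 j = a 0 j * x 0 j by rewrite mxE.
have DE : 'D_(e_ j) (iter i (Lop gam) (fun u => G (scale a u))) x =
    a 0 j * 'D_(e_ j) (iter i (Lop gam) G) (scale a x).
  rewrite -(derive_scale j oD (iter_Lop_holomorphic i oD hG) Dx).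
  apply: near_eq_derive.
  have : nbhs x [set x | D (scale a x)].
    by apply: open_nbhs_nbhs; split; [exact: open_scale|exact: Dx].
  by apply: filterS => u Du; exact: IH.
by rewrite (IH x Dx) DE S0 mulrCA mulrA.
Qed.

End EulerOperator.

(** * The kernel formula at the origin *)

Section CoreTheorem.
Variable R : realType.
Local Notation C := (R[i]^o).
Variables (n m k : nat) (gam : 'I_n -> R) (Om : set 'rV[C]_(n + m)).
Hypotheses (gam0 : forall j, 0 < gam j) (oO : open Om) (sO : star_hartogs Om).
Local Notation dil := (@dil R n m gam).
Local Notation V := (Vgam (k := k) gam Om).
Let c := \sum_j gam j.
Hypothesis c0 : 0 < c.
Variables (KO : 'rV[C]_(n + m) -> 'rV[C]_(n + m) -> C)
  (KV : 'rV[C]_(n + m + k) -> 'rV[C]_(n + m + k) -> C).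
Hypotheses (kO : is_bergman_kernel Om KO) (kV : is_bergman_kernel V KV).
Variables (y : 'rV[C]_(n + m)) (z' : 'rV[C]_m).
Hypothesis Oy : Om y.

Let D : set 'rV[C]_n := [set x | Om (row_mx x z')].
Let G (x : 'rV[C]_n) := KO (row_mx x z') y.

Let differentiable_row_mxl (j : 'I_(n + m)) (x : 'rV[C]_n) :
  differentiable (fun u : 'rV[C]_n => row_mx u z' 0 j : C) x.
Proof.
case: (split_ordP j) => i ->.
  have -> : (fun u : 'rV[C]_n => row_mx u z' 0 (lshift m i) : C) =
      (fun u => u 0 i : C) by apply/funext => u; rewrite row_mxEl.
  exact: differentiable_coordC.
have -> : (fun u : 'rV[C]_n => row_mx u z' 0 (rshift n i) : C) =
    fun=> z' 0 i by apply/funext => u; rewrite row_mxEr.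
exact: differentiable_cst.
Qed.

Lemma open_row_slice : open [set x : 'rV[C]_n | Om (row_mx x z')].
Proof.
have := @row_continuous R _ (n + m) (fun u : 'rV[C]_n => row_mx u z').
move=> /(_ (fun j x => differentiable_continuous (differentiable_row_mxl j x))).
by move=> /continuousP/(_ _ oO).
Qed.

Let oD : open D := open_row_slice.

Lemma holomorphic_row_slice :
  holomorphic_on [set x : 'rV[C]_n | Om (row_mx x z')] (fun x => KO (row_mx x z') y).
Proof. by apply: (holomorphic_comp oO (kO.1 y Oy).1) => // x j _; exact: differentiable_row_mxl. Qed.

Let hG : holomorphic_on D G := holomorphic_row_slice.

Section Path.
Variables (x0 : 'rV[C]_n) (b : C).
Hypothesis Dx0 : D x0.
Let p0 := row_mx x0 z'.
Let x (t : R) : 'rV[C]_n := \row_j ((expR (- (gam j * t)))%:C * x0 0 j).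
Let l (a : C) : R := complex.Re (b * a).
Let Q (x : 'rV[C]_(n + m)) := KV (row_mx x 0) (row_mx y 0).

Let dil_p0 t : scale (dil t) p0 = row_mx (x t) z'.
Proof. by rewrite /p0 dilE. Qed.

Let Dx (t : R) : 0 <= t -> D (x t).
Proof. by move=> t0; rewrite /D /= -dil_p0; exact: dil_in. Qed.

Let lZ (r : R) (a : C) : l (r%:C * a) = r * l a.
Proof. by rewrite /l mulrCA ReMr. Qed.

Let l_le a : `|l a| <= normc b * normc a.
Proof. by rewrite -normcM; exact: Re_le_normc. Qed.

Let l_continuous : continuous l.
Proof.
move=> a; have bc := differentiable_continuous (differentiable_mulc b a).
exact: (continuous_comp bc (@Re_continuous R _)).
Qed.

Let l_cint N (F : 'rV[C]_N -> C) : Cintegrable F ->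
  cintegrable (l \o F) /\ l (cintC F) = cintR (l \o F).
Proof.
move=> Fi; split; last by rewrite /l -(cintCZ b Fi).
have := cintegrableD (cintegrableZ (complex.Re b) Fi.1) (cintegrableZ (- complex.Im b) Fi.2).
by congr cintegrable; apply/funext => u; rewrite /l /= ReM mulNr.
Qed.

(** The path may leave [Om] at negative times; the absolute value extends [rho] continuously so that
    the bound of [exp_dominated] holds on the whole line. *)
Let rho (t : R) := expR (- (c * t)) * l (Q (scale (dil `|t|) p0)).

Let Qc q : Om q -> {for q, continuous Q}.
Proof. by by move=> Oq; exact: ((Vgam_slice_holomorphic oO kV Oy).1 q Oq). Qed.

Let rho_dominated : exists M, exp_dominated M c rho.
Proof.
have [M HM] := path_bounded gam0 sO Qc Dx0.
exists (normc b * M); split=> t.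
  have C1 := @continuous_expN R c t.
  have c2 := continuous_comp (@norm_continuous _ R t) (@path_continuous R n m gam p0 _).
  have c3 := Qc (dil_in gam0 sO (normr_ge0 t) Dx0).
  have C2 : {for t, continuous (fun t => l (Q (scale (dil `|t|) p0)))}.
    by apply: continuous_comp (continuous_comp c2 c3) _; exact: l_continuous.
  exact: (continuousM C1 C2).
rewrite normrM (ger0_norm (expR_ge0 _)) mulrC; apply: ler_wpM2r; first exact: expR_ge0.
apply: (le_trans (l_le _)); apply: ler_wpM2l; first exact: normc_ge0.
exact: HM.
Qed.

Let P (j : nat) (t : R) := expR (- (c * t)) * l (iter j (Lop gam) G (x t)).

Let P_derive j (t : R) : 0 < t -> is_derive t 1 (P j) (- P j.+1 t).
Proof.
move=> t0; pose g (s : C) : C := cexp (- (c%:C * s)) *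
  iter j (Lop gam) G (\row_i (cexp (- ((gam i)%:C * s)) * x0 0 i)).
have xE (s : R) : (\row_i (cexp (- ((gam i)%:C * s%:C)) * x0 0 i)) = x s.
  by apply/rowP => i; rewrite !mxE -rmorphM -rmorphN cexp_real.
have gE (s : R) : g s%:C = (expR (- (c * s)))%:C * iter j (Lop gam) G (x s).
  by rewrite /g xE -rmorphM -rmorphN cexp_real.
have gd : is_derive (t%:C : C) 1 g (- ((expR (- (c * t)))%:C * iter j.+1 (Lop gam) G (x t))).
  have := @euler_derivative R n gam D (iter j (Lop gam) G) x0 t%:C oD
    (iter_Lop_holomorphic gam j oD hG).
  rewrite /= xE => /(_ (Dx (ltW t0))).
  by rewrite -!rmorphM -!rmorphN cexp_real.
have bgd : cdiff (fun s : R[i] => b * g s) (0 + t%:C * 1)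
    (b * - ((expR (- (c * t)))%:C * iter j.+1 (Lop gam) G (x t))).
  by rewrite add0r mulr1; apply/cdiff_is_derive; exact: (is_deriveZ b gd).
have := cdiff_Re_line bgd.
rewrite (_ : (fun s : R => complex.Re (b * g (0 + s%:C * 1))) = P j); last first.
  by apply/funext => s; rewrite add0r mulr1 gE -/(l _) lZ.
by rewrite mul1r mulrN ReN -/(l _) lZ.
Qed.

(** Multiplied by [e^(-ct)], the integral formula at [dil t p0] says that [P 0] is the radial
    integral of [rho]. [radial_ode] then identifies [P k], and the factor [e^(-ct)] cancels. *)
Lemma core_path t : 0 < t ->
  complex.Re (b * iter k (Lop gam) G (x t)) =
  complex.Re (b * ((pi ^+ k)%:C * KV (row_mx (row_mx (x t) z') 0) (row_mx y 0))).
Proof.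
move=> t0; have [M rM] := rho_dominated.
suff E : P k t = pi ^+ k * rho t.
  have e0 : expR (- (c * t)) != 0 by rewrite gt_eqF// expR_gt0.
  apply: (mulfI e0); move: E; rewrite /P /rho ger0_norm ?ltW// dil_p0 -/(Q _).
  by rewrite -/(l _) -/(l _) lZ mulrCA.
suff H0 (s : R) : 0 < s -> P 0%N s = cintR (fun w : 'rV[C]_k => rho (s + sqnorm w)).
  exact: (radial_ode c0 rM H0 P_derive t0).
move=> s0.
have [f1 [f2 [_ _ _ f12]]] := radial_cintegrable k c0 rM.
have Os := dil_in gam0 sO (ltW s0) (Dx0 : Om p0).
have := kernel_integral gam0 oO sO c0 kO kV Os Oy l_continuous l_cint.
rewrite /P /= /G -dil_p0 => ->.
(* [rho (s + |w|^2)] contains [e^(-cs)] in addition to the Gaussian weight; it is compensated inside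
   the integral. *)
transitivity (expR (- (c * s)) *
    cintR (fun w : 'rV[C]_k => expR (c * s) * rho (s + sqnorm w))); last first.
  by rewrite (cintRZ _ (f12 s).1) mulrA -expRD addNr expR0 mul1r.
congr (_ * cintR _); apply/funext => w.
have sw0 : 0 <= s + sqnorm w by rewrite addr_ge0 ?sqnorm_ge0// ltW.
rewrite /rho (ger0_norm sw0) mulrA -expRD mulrDr opprD addrA subrr add0r.
by rewrite dilD (addrC (sqnorm w)).
Qed.

End Path.

(** [core_path] speaks of positive times, so the path is started at a point slightly beyond [z],
    which [Om] contains by openness, and reaches [z] at time [s > 0]. *)
Lemma core_kernel z : Om (row_mx z z') ->
  KV (row_mx (row_mx z z') 0) (row_mx y 0) =
  ((pi ^+ k)%:C)^-1 * iter k (Lop gam) G z.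
Proof.
move=> Oz.
have [s s0 Os] : exists2 s : R, 0 < s & Om (scale (dil (- s)) (row_mx z z')).
  have pc := @path_continuous R n m gam (row_mx z z') 0.
  have nO : nbhs (scale (dil 0) (row_mx z z')) Om.
    by apply: open_nbhs_nbhs; rewrite dil0.
  have /nbhs_ballP[e /= e0 eO] := pc _ nO.
  exists (e / 2); first exact: divr_gt0.
  by apply: eO; rewrite /ball /= sub0r opprK ger0_norm; lra.
have pik : (pi ^+ k)%:C != 0 :> R[i].
  by apply/eqP => /(congr1 (@complex.Re R)) /= /eqP; rewrite expf_eq0 gt_eqF ?pi_gt0// andbF.
pose x0 : 'rV[C]_n := \row_j ((expR (- (gam j * (- s))))%:C * z 0 j).
have Dx0 : D x0 by move: Os; rewrite dilE.
have xs : (\row_j ((expR (- (gam j * s)))%:C * x0 0 j)) = z.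
  by apply/rowP => j; rewrite !mxE mulrA -rmorphM -expRD mulrN opprK addNr expR0 mul1r.
have key b := @core_path x0 b Dx0 s s0.
apply: (mulfI pik); rewrite mulVKf//.
(* [b = 1] gives the real parts and [b = -i] the imaginary parts. *)
have k1 := key 1; have ki := key (0 +i* -1); rewrite xs !mul1r in k1; rewrite xs !ReM /= in ki.
by apply: esym; apply: complexP; [exact: k1|move: ki; rewrite !mul0r !sub0r !mulN1r !opprK].
Qed.

End CoreTheorem.

(** * Reduction to the slice through the origin *)
Section ComplexDilation.
Variable R : realType.
Local Notation C := (R[i]^o).
Variables (n m k : nat) (gam : 'I_n -> R) (Om : set 'rV[C]_(n + m)).
Hypotheses (gam0 : forall j, 0 < gam j) (oO : open Om) (sO : star_hartogs Om).
Local Notation dil := (@dil R n m gam).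
Local Notation V := (Vgam (k := k) gam Om).
Let c := \sum_j gam j.

(** Complex times extend [dil], because the exponent [<v, eta>] of the change of variables is
    complex; dependence on the time is holomorphic. *)
Definition cdil (s : C) : 'rV[C]_(n + m) :=
  row_mx (\row_j cexp (- ((gam j)%:C * s))) (const_mx 1).

Lemma cdilE s (z : 'rV[C]_n) (z' : 'rV[C]_m) : scale (cdil s) (row_mx z z') =
  row_mx (\row_j (cexp (- ((gam j)%:C * s)) * z 0 j)) z'.
Proof.
by rewrite /cdil scale_row_mx scale1; congr row_mx; apply/rowP => j; rewrite !mxE.
Qed.

Lemma cdilD s t x : scale (cdil s) (scale (cdil t) x) = scale (cdil (s + t)) x.
Proof.
rewrite -[x]hsubmxK !cdilE; congr row_mx; apply/rowP => j.
by rewrite !mxE mulrA -cexpD -opprD -mulrDr.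
Qed.

Lemma cdil_real (s : R) : cdil s%:C = dil s.
Proof.
by congr row_mx; apply/rowP => j; rewrite !mxE -rmorphM -rmorphN cexp_real.
Qed.

Lemma cdil0 x : scale (cdil 0) x = x.
Proof. by have := cdil_real 0; rewrite rmorph0 => ->; exact: dil0. Qed.

Lemma cdil_neq0 s j : cdil s 0 j != 0.
Proof.
case: (split_ordP j) => i ->; first by rewrite row_mxEl mxE; exact: cexp_neq0.
by rewrite row_mxEr mxE; exact: oner_neq0.
Qed.

Lemma csq_cexp (z : R[i]) : csq (cexp z) = expR (2 * complex.Re z).
Proof. by rewrite csq_normc normc_cexp expr2 -expRD mulr_natl mulr2n. Qed.

Lemma prod_csq_cdil s : \prod_j csq (cdil s 0 j) = csq (cexp (- (c%:C * s))).
Proof.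
rewrite big_split_ord /= [X in _ * X]big1 => [|i _]; last first.
  by rewrite row_mxEr mxE csq_normc normc1 expr1n.
rewrite mulr1 csq_cexp ReN ReMr /c mulr_suml -sumrN mulr_sumr expR_sum.
by apply: eq_bigr => j _; rewrite row_mxEl mxE csq_cexp ReN ReMr.
Qed.

Lemma phase_in (t : R) x : Om x -> Om (scale (cdil (0 +i* t)) x).
Proof.
rewrite -[x]hsubmxK cdilE => Ox.
have H j : csq ((\row_j cexp (- ((gam j)%:C * (0 +i* t))) : 'rV[C]_n) 0 j) <= 1.
  by rewrite mxE csq_cexp ReN ReMr /= !mulr0 oppr0 mulr0 expR0.
have := sO Ox H; congr Om; congr row_mx.
by apply/rowP => j; rewrite !mxE.
Qed.

(** An imaginary time multiplies coordinates by unit factors, which preserves [Om], and so does its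
    opposite. *)
Lemma cdil_in s x : Om (scale (cdil s) x) <-> Om (scale (dil (complex.Re s)) x).
Proof.
have sE : s = (complex.Re s)%:C + (0 +i* complex.Im s).
  by apply: complexP; rewrite ?ReD ?ImD /= ?addr0 ?add0r.
rewrite -cdil_real; split => [|H].
  move/(phase_in (- complex.Im s)); rewrite cdilD; congr (Om (scale (cdil _) x)).
  by apply: complexP; rewrite ?ReD ?ImD /= ?addr0 ?add0r ?addNr.
by have := phase_in (complex.Im s) H; rewrite cdilD addrC -sE.
Qed.

Lemma open_Vslice (eta : 'rV[C]_k) : open (Vslice gam Om eta).
Proof.
have dc := @dil_continuous R n m gam _ (fun=> - (sqnorm eta / 2)) (fun q => q).
have := dc (@cst_continuous _ _ _) (fun j x => differentiable_continuous (differentiable_coordC j x)).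
move=> /continuousP/(_ _ oO); congr open; apply/seteqP.
by split=> q; rewrite /Vslice /= Vgam_row_mx.
Qed.

Lemma star_Vslice (eta : 'rV[C]_k) : star_hartogs (Vslice gam Om eta).
Proof.
move=> z z' + lam lam1; rewrite /Vslice /= !Vgam_row_mx !dilE => /sO/(_ _ lam1).
by congr Om; congr row_mx; apply/rowP => j; rewrite !mxE mulrCA.
Qed.

(** The squared norms add without the cross term [2 Re <v, eta>] of [sqnorm (v + eta)]; that term is
    what [heis] has to remove. *)
Lemma Vgam_Vslice (eta v : 'rV[C]_k) q : Vgam (k := k) gam (Vslice gam Om eta) (row_mx q v) <->
  Om (scale (dil (- ((sqnorm eta + sqnorm v) / 2))) q).
Proof.
rewrite Vgam_row_mx /Vslice /= Vgam_row_mx dilD.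
by rewrite -opprD -mulrDl.
Qed.

Lemma cdotDl (v w eta : 'rV[C]_k) : cdot (v + w) eta = cdot v eta + cdot w eta.
Proof. by rewrite /cdot -big_split; apply: eq_bigr => i _; rewrite mxE mulrDl. Qed.

Lemma cdotN (v eta : 'rV[C]_k) : cdot (- v) eta = - cdot v eta.
Proof. by rewrite /cdot -sumrN; apply: eq_bigr => i _; rewrite mxE mulNr. Qed.

Lemma cdot0 (eta : 'rV[C]_k) : cdot 0 eta = 0.
Proof. by rewrite /cdot big1// => i _; rewrite mxE mul0r. Qed.

Lemma cdot_self (eta : 'rV[C]_k) : cdot eta eta = (sqnorm eta)%:C.
Proof. by rewrite /cdot /sqnorm rmorph_sum; apply: eq_bigr => i _; rewrite mul_conjc. Qed.

Lemma sqnormD (v eta : 'rV[C]_k) :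
  sqnorm (v + eta) = sqnorm v + sqnorm eta + 2 * complex.Re (cdot v eta).
Proof.
have Re_sum (F : 'I_k -> C) : complex.Re (\sum_i F i) = \sum_i complex.Re (F i).
  by elim/big_ind2: _ => // a b a' b' <- <-; rewrite ReD.
rewrite /sqnorm /cdot Re_sum mulr_sumr -!big_split; apply: eq_bigr => i _ /=.
by rewrite mxE /csq ReD ImD ReM Re_conj Im_conj; ring.
Qed.

Lemma differentiable_cdot (eta v : 'rV[C]_k) : differentiable (fun w : 'rV[C]_k => cdot w eta : C) v.
Proof.
have -> : (fun w : 'rV[C]_k => cdot w eta : C) =
    \sum_(i < k) (fun w : 'rV[C]_k => w 0 i * conjc (eta 0 i) : C).
  by apply/funext => w; rewrite fct_sumE.
apply: differentiable_sum => i.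
exact: (differentiableM (differentiable_coordC i v) (differentiable_cst (conjc (eta 0 i) : C) v)).
Qed.

End ComplexDilation.

Section Heisenberg.
Variable R : realType.
Local Notation C := (R[i]^o).
Variables (n m k : nat) (gam : 'I_n -> R) (Om : set 'rV[C]_(n + m)) (eta : 'rV[C]_k).
Hypotheses (gam0 : forall j, 0 < gam j) (oO : open Om) (sO : star_hartogs Om).
Local Notation cdil := (@cdil R n m gam).
Local Notation V := (Vgam (k := k) gam Om).
Local Notation Om' := (Vslice gam Om eta).
Local Notation V1 := (Vgam (k := k) gam Om').
Let c := \sum_j gam j.

(* Biholomorphism from the domain over the slice at [eta] onto [V], sending the
   slice [v = 0] to the slice [w = eta]. *)
Definition heis (x : 'rV[C]_(n + m + k)) : 'rV[C]_(n + m + k) :=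
  fibered (fun v => cdil (cdot v eta)) eta x.
Definition heis_inv (x : 'rV[C]_(n + m + k)) : 'rV[C]_(n + m + k) :=
  fibered (fun w => cdil (- cdot (w - eta) eta)) (- eta) x.
(** Complex Jacobian determinant of [heis]: the product of its fibre factors. *)
Definition heis_jac (x : 'rV[C]_(n + m + k)) : C := cexp (- (c%:C * cdot (rsubmx x) eta)).

Lemma heisE q v : heis (row_mx q v) = row_mx (scale (cdil (cdot v eta)) q) (v + eta).
Proof. by rewrite /heis /fibered row_mxKl row_mxKr. Qed.

Lemma heis_invE q w : heis_inv (row_mx q w) =
  row_mx (scale (cdil (- cdot (w - eta) eta)) q) (w - eta).
Proof. by rewrite /heis_inv /fibered row_mxKl row_mxKr. Qed.

Lemma heisK : cancel heis heis_inv.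
Proof.
by move=> x; rewrite -[x]hsubmxK heisE heis_invE cdilD addrK addNr cdil0.
Qed.

Lemma heis_invK : cancel heis_inv heis.
Proof.
by move=> x; rewrite -[x]hsubmxK heis_invE heisE cdilD subrK subrr cdil0.
Qed.

(** Only the real part of the dilation time matters for membership, and [Re <v, eta>] cancels half
    the cross term of [sqnorm (v + eta)]. *)
Lemma heis_in x : V1 x <-> V (heis x).
Proof.
rewrite -[x]hsubmxK heisE Vgam_Vslice Vgam_row_mx.
rewrite -(cdil_real m gam (- (sqnorm (_ + _) / 2))) cdilD (cdil_in _ sO) ReD /=.
rewrite sqnormD; set a := sqnorm _; set b := sqnorm _; set d := complex.Re _.
by rewrite (_ : - ((b + a + 2 * d) / 2) + d = - ((a + b) / 2)) //; lra.
Qed.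

Let differentiable_cdil (f : 'rV[C]_k -> C) v j : (forall v, differentiable f v) ->
  differentiable (fun v => cdil (f v) 0 j : C) v.
Proof.
move=> fd; case: (split_ordP j) => i ->.
  have -> : (fun v => cdil (f v) 0 (lshift m i) : C) = (fun v => cexp (- ((gam i)%:C * f v))).
    by apply/funext => u; rewrite row_mxEl mxE.
  apply: differentiable_cexp; apply: differentiableN.
  exact: (differentiableM (differentiable_cst ((gam i)%:C : C) v) (fd v)).
have -> : (fun v => cdil (f v) 0 (rshift n i) : C) = fun=> 1.
  by apply/funext => u; rewrite row_mxEr mxE.
exact: differentiable_cst.
Qed.

Let differentiable_rsubmx (x : 'rV[C]_(n + m + k)) : differentiable (fun x => rsubmx x) x.
Proof. by apply: differentiable_row => j; exact: differentiable_rsub. Qed.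

Let differentiable_fibered (f : 'rV[C]_k -> C) b (x : 'rV[C]_(n + m + k)) j :
  (forall v, differentiable f v) ->
  differentiable (fun x => fibered (fun v => cdil (f v)) b x 0 j : C) x.
Proof.
move=> fd; case: (split_ordP j) => i ->.
  have -> : (fun x : 'rV[C]_(n + m + k) => fibered (fun v => cdil (f v)) b x 0 (lshift k i) : C) =
      (fun x => cdil (f (rsubmx x)) 0 i * lsubmx x 0 i).
    by apply/funext => u; rewrite row_mxEl mxE.
  have d1 := differentiable_comp (differentiable_rsubmx x) (differentiable_cdil (rsubmx x) i fd).
  exact: (differentiableM d1 (differentiable_lsub i x)).
have -> : (fun x : 'rV[C]_(n + m + k) => fibered (fun v => cdil (f v)) b x 0 (rshift (n + m) i) : C) =
    (fun x => rsubmx x 0 i + b 0 i).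
  by apply/funext => u; rewrite row_mxEr mxE.
exact: (differentiableD (differentiable_rsub i x) (differentiable_cst (b 0 i : C) x)).
Qed.

Let differentiable_cdot_shift v : differentiable (fun w : 'rV[C]_k => - cdot (w - eta) eta : C) v.
Proof.
have -> : (fun w : 'rV[C]_k => - cdot (w - eta) eta : C) = (fun w => - (cdot w eta + cdot (- eta) eta)).
  by apply/funext => w; rewrite cdotDl.
apply: differentiableN.
exact: (differentiableD (differentiable_cdot eta v) (differentiable_cst (cdot (- eta) eta : C) v)).
Qed.

Lemma heis_jac_neq0 x : heis_jac x != 0.
Proof. exact: cexp_neq0. Qed.

Lemma differentiable_heis_jac x : differentiable heis_jac x.
Proof.
apply: differentiable_cexp; apply: differentiableN.
have d1 := differentiable_comp (differentiable_rsubmx x) (differentiable_cdot eta (rsubmx x)).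
exact: (differentiableM (differentiable_cst (c%:C : C) x) d1).
Qed.

Lemma change_var_heis : change_var heis (fun x => csq (heis_jac x)).
Proof.
have := @change_var_fibered R (n + m) k (fun v => cdil (cdot v eta)) eta.
move=> /(_ (fun j v => differentiable_continuous (differentiable_cdil v j (@differentiable_cdot R k eta)))).
move=> /(_ (fun v j => cdil_neq0 gam _ j)).
by rewrite (_ : (fun x => _) = (fun x => csq (heis_jac x)))//;
  apply/funext => x; rewrite prod_csq_cdil.
Qed.

Lemma change_var_heis_inv : change_var heis_inv (fun y => (csq (heis_jac (heis_inv y)))^-1).
Proof.
have := @change_var_fibered R (n + m) k (fun w => cdil (- cdot (w - eta) eta)) (- eta).
move=> /(_ (fun j v => differentiable_continuous (differentiable_cdil v j differentiable_cdot_shift))).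
move=> /(_ (fun v j => cdil_neq0 gam _ j)).
rewrite (_ : (fun x => _) = (fun y => (csq (heis_jac (heis_inv y)))^-1))//.
apply/funext => x; rewrite prod_csq_cdil /heis_jac -[x in RHS]hsubmxK heis_invE row_mxKr.
by rewrite !csq_normc -exprVn -normcV -cexpN mulrN.
Qed.

Lemma heis_kernel K : is_bergman_kernel V K ->
  is_bergman_kernel V1 (fun x y => heis_jac x * K (heis x) (heis y) * conjc (heis_jac y)).
Proof.
move=> hK; have o1 : open V1 by apply: open_Vgam; exact: open_Vslice.
have o2 : open V by exact: open_Vgam.
exact: (transform_kernel o1 o2 heis_in heisK heis_invK
  (fun x j => differentiable_fibered eta x j (differentiable_cdot eta))
  (fun x j => differentiable_fibered (- eta) x j differentiable_cdot_shift)
  differentiable_heis_jac heis_jac_neq0 change_var_heis change_var_heis_inv hK).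
Qed.

End Heisenberg.

Theorem theorem5 (R : realType) (n m k : nat) (hn : (0 < n)%N) (hk : (0 < k)%N)
  (gam : 'I_n -> R) (hgam : forall j, 0 < gam j)
  (Om : set 'rV[R[i]^o]_(n + m)) (hOm : is_domain Om) (hH : star_hartogs Om)
  (K : 'rV[R[i]^o]_(n + m + k) -> 'rV[R[i]^o]_(n + m + k) -> R[i]^o)
  (hK : is_bergman_kernel (Vgam (k:=k) gam Om) K)
  (Keta : 'rV[R[i]^o]_k -> 'rV[R[i]^o]_(n + m) -> 'rV[R[i]^o]_(n + m) -> R[i]^o)
  (hKeta : forall eta, is_bergman_kernel (Vslice gam Om eta) (Keta eta))
  (z zeta : 'rV[R[i]^o]_n) (z' zeta' : 'rV[R[i]^o]_m) (w eta : 'rV[R[i]^o]_k) :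
  Vgam (k:=k) gam Om (row_mx (row_mx z z') w) ->
  Vgam (k:=k) gam Om (row_mx (row_mx zeta zeta') eta) ->
  K (row_mx (row_mx z z') w) (row_mx (row_mx zeta zeta') eta) =
  cexp ((\sum_(j < n) gam j)%:C * (cdot w eta - (sqnorm eta)%:C))
    / ((pi : R) ^+ k)%:C
  * iter k (Lop gam)
      (fun x : 'rV[R[i]^o]_n =>
         Keta eta (row_mx (lmap gam x w eta) z') (row_mx zeta zeta')) z.
Proof.
move=> Vz Vzeta; have oO := hOm.1.
(* Here [n >= 1] enters: an empty sum would give no exponential decay. *)
have c0 : 0 < \sum_j gam j.
  rewrite (bigD1 (Ordinal hn)) //= ltr_pwDl ?hgam//.
  by apply: sumr_ge0 => j _; exact: ltW.
pose s : R[i]^o := cdot w eta - (sqnorm eta)%:C.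
have sE : cdot (w - eta) eta = s by rewrite cdotDl cdotN cdot_self.
(* The factors of [lmap], written as a complex dilation by time [-s], the inverse of the one in
   [heis] at [v = w - eta]. *)
pose a : 'rV[R[i]^o]_n := \row_j cexp (- ((gam j)%:C * - s)).
have lE x : lmap gam x w eta = scale a x.
  by apply/rowP => j; rewrite !mxE mulrN opprK.
have q1E : scale (cdil m gam (- s)) (row_mx z z') = row_mx (scale a z) z'.
  by rewrite cdilE; congr row_mx; apply/rowP => j; rewrite !mxE.
set y := row_mx zeta zeta'; set q1 := row_mx (scale a z) z'.
have k1 := heis_kernel eta oO hH hK.
have x1E : heis gam eta (row_mx q1 (w - eta)) = row_mx (row_mx z z') w.
  by rewrite heisE /q1 -q1E sE cdilD subrr cdil0 subrK.
have y1E : heis gam eta (row_mx y 0) = row_mx y eta by rewrite heisE cdot0 cdil0 add0r.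
have V1x : Vgam gam (Vslice gam Om eta) (row_mx q1 (w - eta)) by apply/heis_in; rewrite // x1E.
have V1y : Vgam gam (Vslice gam Om eta) (row_mx y (0 : 'rV_k)) by apply/heis_in; rewrite // y1E.
have oO' : open (Vslice gam Om eta) by exact: open_Vslice.
have sO' : star_hartogs (Vslice gam Om eta) by exact: star_Vslice.
have Oy : Vslice gam Om eta y by [].
have [V10 E1] := Vgam_kernel_w hgam oO' sO' k1 V1x V1y.
have Oq1 : Vslice gam Om eta q1 by move/Vgam_row_mx0 : V10.
have E2 := core_kernel hgam oO' sO' c0 (hKeta eta) k1 Oy Oq1.
move: E1; rewrite E2 x1E y1E.
(* Of the two Jacobian factors only the one at the first point survives; its inverse is the
   exponential in the formula. *)
have -> : heis_jac gam eta (row_mx y 0) = 1.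
  by rewrite /heis_jac row_mxKr cdot0 mulr0 oppr0 cexp0.
have -> : heis_jac gam eta (row_mx q1 (w - eta)) = (cexp ((\sum_j gam j)%:C * s))^-1.
  by rewrite /heis_jac row_mxKr sE cexpN.
have -> : (fun x => Keta eta (row_mx (lmap gam x w eta) z') y) =
    (fun x => Keta eta (row_mx (scale a x) z') y) by apply/funext => x; rewrite lE.
have oD : open [set x : 'rV[R[i]^o]_n | Vslice gam Om eta (row_mx x z')].
  exact: open_row_slice.
have hG : holomorphic_on [set x : 'rV[R[i]^o]_n | Vslice gam Om eta (row_mx x z')]
    (fun x => Keta eta (row_mx x z') y).
  by apply: holomorphic_row_slice; [exact: oO'|exact: hKeta|exact: Oy].
rewrite (iter_Lop_scale gam k oD hG Oq1).
rewrite rmorph1 mulr1 => E1; rewrite -mulrA -E1 mulrA divff ?mul1r//.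
exact: cexp_neq0.
Qed.
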